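(* Let $l\ge1$ be an integer and let $\lambda=(\lambda_1\ge\dots\ge\lambda_l\ge0)$ be a partition with at most $l$ non-zero parts. Then $$\dim_qL(d_\infty;\Lambda(\lambda))=\frac{\mathsf Q(q)^++\mathsf Q(q)^-}{2},\qquad \dim_qL(d_\infty;\Lambda(\lambda\otimes\det))=\frac{\mathsf Q(q)^+-\mathsf Q(q)^-}{2}.$$
   Context: **The Lie algebra $d_\infty$.** Let $\mathfrak{gl}$ be the Lie algebra of complex matrices $(a_{ij})_{i,j\in\mathbb Z}$ with $a_{ij}=0$ for $|i-j|$ large, and $E_{ij}$ the matrix units. Let $\overline d_\infty=\{(a_{ij})\in\mathfrak{gl}: a_{ij}=-a_{1-j,1-i}\}$ and let $d_\infty=\overline d_\infty\oplus\mathbb C C$ be its central extension by the 2-cocycle $C(A,B)=\mathrm{tr}([J,A]B)$, $J=\sum_{i\le 0}E_{ii}$. The triangular decomposition is induced from the grading in which $E_{ij}$ has weight $j-i$ (positive weight = raising). Put $H^d_i=E_{ii}+E_{-i,-i}-E_{i+1,i+1}-E_{-i+1,-i+1}$ for $i\ge1$ and $H^d_0=E_{0,0}+E_{-1,-1}-E_{2,2}-E_{1,1}+2C$; the fundamental weights $\Lambda^d_i$ satisfy $\Lambda^d_i(H^d_j)=\delta_{ij}$. $L(d_\infty;\Lambda)$ is the irreducible highest weight module of highest weight $\Lambda$; its level is the scalar by which $C$ acts. For a partition $\lambda=(m_1,\dots,m_l)$ with $m_1\ge\dots\ge m_i>m_{i+1}=\dots=m_j=1>m_{j+1}=\dots=m_l=0$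 put $$\Lambda(\lambda)=(2l+1-i-j)\Lambda_0^d+(j-i)\Lambda_1^d+\sum_{k=1}^i\Lambda^d_{m_k},\qquad \Lambda(\lambda\otimes\det)=(j-i)\Lambda_0^d+(2l+1-i-j)\Lambda_1^d+\sum_{k=1}^i\Lambda^d_{m_k},$$ both of level $l+\frac12$. Here $\det$ is the non-trivial one-dimensional representation of $O(2l+1)$, and $\lambda,\lambda\otimes\det$ label irreducible $O(2l+1)$-modules. **Fock space.** $\mathcal F^{l+\frac12}$ is the Fock space generated by a vacuum $|0\rangle$ by fermions $\psi^{\pm,p}_r$ ($1\le p\le l$) and $\varphi_r$, $r\in\frac12+\mathbb Z$, with $[\psi^{+,p}_r,\psi^{-,p'}_s]_+=\delta_{pp'}\delta_{r+s,0}$, $[\varphi_r,\varphi_s]_+=\delta_{r+s,0}$, all other anticommutators zero, and $\psi^{\pm,p}_r|0\rangle=\varphi_r|0\rangle=0$ for $r>0$. Normal ordering $:\ :$ moves operators annihilating $|0\rangle$ to the right with a sign. $d_\infty$ acts with $C=l+\frac12$ and $$E_{ij}-E_{1-j,1-i}\mapsto\sum_{p=1}^l\big(:\psi^{+,p}_{\frac12-i}\psi^{-,p}_{j-\frac12}:+:\psi^{-,p}_{\frac12-i}\psi^{+,p}_{j-\frac12}:\big)+:\varphi_{\frac12-i}\varphi_{j-\frac12}:.$$ The energy operator is $L_0=\sum_p\sum_{k\in\frac12+\mathbb Z}k:\psi^{+,p}_{-k}\psi^{-,p}_k:+\sum_{k>0}k\varphi_{-k}\varphi_k$. The commuting $\mathfrak{so}(2l+1)$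 is generated by $e_{pq}=\sum_r:\psi^{+,p}_r\psi^{-,q}_{-r}:$, $e^{\pm}_{pq}=\sum_r:\psi^{\pm,p}_r\psi^{\pm,q}_{-r}:$ ($p\ne q$), $e^\pm_p=\sum_r:\psi^{\pm,p}_r\varphi_{-r}:$. As an $(O(2l+1),d_\infty)$-module, $\mathcal F^{l+\frac12}\cong\bigoplus_\mu V_\mu(O(2l+1))\otimes L(d_\infty;\Lambda(\mu))$, where $\mu$ runs over all $\lambda$ and $\lambda\otimes\det$. The module $L(d_\infty;\Lambda(\lambda))\oplus L(d_\infty;\Lambda(\lambda\otimes\det))$ is realized in $\mathcal F^{l+\frac12}$ as the space of $\mathfrak{so}(2l+1)$-highest weight vectors of weight $\lambda$, i.e. vectors $v$ with $e_{pp}v=\lambda_pv$, $e_{pq}v=0$ ($p<q$), $e^+_{pq}v=0$, $e^+_pv=0$. **Notation.** $\dim_qM=\mathrm{tr}_Mq^{L_0}$ is the $q$-dimension of a $d_\infty$-module $M$ (a formal series in $q^{1/2}$). Let $\alpha=\sum_{k>0}\varphi_{-k}\varphi_k$, $M_\lambda=L(d_\infty;\Lambda(\lambda))\oplus L(d_\infty;\Lambda(\lambda\otimes\det))$, and $$\mathsf Q(q)^+=\mathrm{tr}_{M_\lambda}q^{L_0},\qquad \mathsf Q(q)^-=\mathrm{tr}_{M_\lambda}(-1)^\alpha q^{L_0}.$$ *)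

(* Defs.v *)
From HB Require Import structures.
From mathcomp Require Import all_boot all_order all_algebra.
From mathcomp Require Import all_classical reals complex.

Set Implicit Arguments.
Unset Strict Implicit.
Unset Printing Implicit Defensive.

Import Order.TTheory GRing.Theory Num.Theory.

Local Open Scope classical_set_scope.
Local Open Scope ring_scope.

(* Infinite sums \sum_(i \in A) below are those of fsbigop.  Each of them has
   finite support: for matrices because of the band condition, for operators on
   the Fock space because every sum is applied to a given vector. *)

Section Subspaces.
Variables (K : numFieldType) (V : lmodType K).
Implicit Types (U : set V) (g T : V -> V).

Definition subspace U : Prop :=
  U 0 /\ forall (a : K) u v, U u -> U v -> U (a *: u + v).

Definition is_basis U (n : nat) (b : 'I_n -> V) : Prop :=
  (forall c : 'I_n -> K,
     \sum_(i < n) c i *: b i = 0 -> forall i, c i = 0) /\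
  U = [set v | exists c : 'I_n -> K, v = \sum_(i < n) c i *: b i].

Definition finite_dim U : Prop := exists n (b : 'I_n -> V), is_basis U b.

Definition is_trace U g (t : K) : Prop :=
  exists n (b : 'I_n -> V) (A : 'M[K]_n),
    [/\ is_basis U b, forall j, g (b j) = \sum_(i < n) A i j *: b i & t = \tr A].

Definition trace_on U g : K := xget 0 [set t | is_trace U g t].

Definition eigen_in U T (a : K) : set V := [set v | U v /\ T v = a *: v].

(* A formal series in q^(1/2) is the sequence of its coefficients: the n-th one
   is the coefficient of q^(n/2).  The series tr_U (g q^T) makes sense when U is
   the direct sum of finite dimensional T-eigenspaces, with eigenvalues n/2, on
   each of which g acts; this is [has_qtrace]. *)
Definition has_qtrace U T g : Prop :=
  (forall n : nat, finite_dim (eigen_in U T (n%:R / 2)) /\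
     exists t, is_trace (eigen_in U T (n%:R / 2)) g t) /\
  (forall v, U v -> exists (N : nat) (w : nat -> V),
     (forall n, eigen_in U T (n%:R / 2) (w n)) /\ v = \sum_(n < N) w n).

Definition qtrace U T g : nat -> K :=
  fun n => trace_on (eigen_in U T (n%:R / 2)) g.

(* (-1)^T for an operator T that is diagonalizable with eigenvalues in nat;
   such a T has exactly one S with is_sign_pow T S. *)
Definition is_sign_pow T (S : V -> V) : Prop :=
  linear S /\ forall (m : nat) v, T v = m%:R *: v -> S v = (-1) ^+ m *: v.

Definition sign_pow T : V -> V :=
  if pselect (exists S, is_sign_pow T S) is left ex then projT1 (cid ex) else idfun.

End Subspaces.

Section DInfinity.
Variable K : numFieldType.

Definition zmat := int -> int -> K.

Definition zmat_unit (a b : int) : zmat :=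
  fun i j => ((i == a) && (j == b))%:R.

Definition zmat_mul (A B : zmat) : zmat :=
  fun i j => \sum_(k \in [set: int]) A i k * B k j.

Definition zmat_comm (A B : zmat) : zmat := zmat_mul A B - zmat_mul B A.

Definition zmat_tr (A : zmat) : K := \sum_(i \in [set: int]) A i i.

Definition gl_band (A : zmat) : Prop :=
  exists N : nat, forall i j : int, (N < `|i - j|)%N -> A i j = 0.

Definition zmat_J : zmat := fun i j => ((i == j) && (i <= 0))%:R.

Definition cocycle (A B : zmat) : K := zmat_tr (zmat_mul (zmat_comm zmat_J A) B).

(* The pair (A, c) stands for A + c C. *)
Definition dinf : set (zmat * K) :=
  [set X | gl_band X.1 /\ forall i j : int, X.1 i j = - X.1 (1 - j) (1 - i)].

Definition dinf_lincomb (a : K) (X Y : zmat * K) : zmat * K :=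
  ((fun i j : int => a * X.1 i j + Y.1 i j), a * X.2 + Y.2).

Definition dinf_bracket (X Y : zmat * K) : zmat * K :=
  (zmat_comm X.1 Y.1, cocycle X.1 Y.1).

Definition dinf_raising : set (zmat * K) :=
  [set X | [/\ dinf X, X.2 = 0 & forall i j : int, ~~ (i < j) -> X.1 i j = 0]].

Definition dinf_cartan : set (zmat * K) :=
  [set X | dinf X /\ forall i j : int, i != j -> X.1 i j = 0].

Definition dcoroot (i : nat) : zmat * K :=
  if i is 0 then
    (zmat_unit 0 0 + zmat_unit (-1) (-1) - zmat_unit 2 2 - zmat_unit 1 1, 2)
  else let z := Posz i in
    (zmat_unit z z + zmat_unit (- z) (- z)
       - zmat_unit (z + 1) (z + 1) - zmat_unit (- z + 1) (- z + 1), 0).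

(* The fundamental weights.  Since the Cartan subalgebra contains infinite
   diagonal matrices, the values on the dcoroot j (see fundwt_dcoroot) fix a
   weight only within the restricted dual, i.e. among the functionals that
   involve finitely many matrix entries; this is the functional meant here. *)
Definition fundwt (i : nat) (X : zmat * K) : K :=
  (if (i < 2)%N then X.2 / 2 else X.2) + \sum_(1 <= k < i.+1) X.1 (Posz k) (Posz k).

Lemma fundwt_dcoroot (i j : nat) : fundwt i (dcoroot j) = (i == j)%:R.
Proof.
have ne (k : nat) (z : int) : z <= 0 -> (0 < k)%N -> (Posz k == z) = false.
  by move=> z0 k0; apply/negbTE/eqP => E; move: z0; rewrite -E; case: k k0 {E}.
have sum1 (a : nat) : (0 < a)%N ->
    \sum_(1 <= k < i.+1) (Posz k == Posz a)%:R = (a <= i)%:R :> K.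
  move=> a0; case: (leqP a i) => ai.
    rewrite (bigD1_seq a) ?mem_index_iota ?a0 ?iota_uniq //= eqxx.
    by rewrite big1 ?addr0 // => k /negbTE; rewrite eqz_nat => ->.
  rewrite big_nat_cond big1 // => k /andP[/andP[_ ki] _].
  rewrite eqz_nat; case: eqP => // E; move: ki.
  by rewrite E ltnS leqNgt ai.
rewrite /fundwt /dcoroot /zmat_unit; case: j => [|j] /=.
  rewrite (_ : \sum_(1 <= k < i.+1) _ =
     \sum_(1 <= k < i.+1) (- (Posz k == Posz 2)%:R - (Posz k == Posz 1)%:R)).
    rewrite big_split /= !sumrN !sum1 //.
    case: i {sum1} => [|[|i]] /=.
    - by rewrite subr0 oppr0 addr0 divff ?pnatr_eq0.
    - by rewrite oppr0 add0r divff ?pnatr_eq0 // subrr.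
    - by rewrite -opprD subrr.
  rewrite !big_nat; apply: eq_bigr => k /andP[k0 _].
  by rewrite !fctE !andbb (ne k 0) // (ne k (-1)) // !add0r.
rewrite (_ : \sum_(1 <= k < i.+1) _ =
     \sum_(1 <= k < i.+1) ((Posz k == Posz j.+1)%:R - (Posz k == Posz j.+2)%:R)).
  rewrite big_split /= sumrN !sum1 // mul0r if_same add0r.
  by case: (ltngtP i j.+1) => //; rewrite ?subrr ?subr0.
rewrite !big_nat; apply: eq_bigr => k /andP[k0 _].
rewrite !fctE !andbb (ne k (- _)) // (ne k (- _ + 1)) //.
  by rewrite addr0 subr0 -PoszD addn1.
by rewrite addrC subr_le0 lez_nat.
Qed.

(* Modules over d_infinity; the action is constrained on dinf only. *)
Record dinf_module := DinfModule {
  dcarrier :> lmodType K;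
  dact : zmat * K -> {linear dcarrier -> dcarrier};
  dact_linear : forall (a : K) (X Y : zmat * K) v, dinf X -> dinf Y ->
    dact (dinf_lincomb a X Y) v = a *: dact X v + dact Y v;
  dact_bracket : forall (X Y : zmat * K) v, dinf X -> dinf Y ->
    dact (dinf_bracket X Y) v = dact X (dact Y v) - dact Y (dact X v)
}.

Definition dsubmodule (M : dinf_module) (U : set M) : Prop :=
  subspace U /\ forall X v, dinf X -> U v -> U (dact M X v).

Definition dirreducible (M : dinf_module) : Prop :=
  (exists v : M, v != 0) /\
  forall U : set M, dsubmodule U -> U = [set 0] \/ U = setT.

Definition dhw_vector (M : dinf_module) (L : zmat * K -> K) (v : M) : Prop :=
  [/\ v != 0,
      forall X, dinf_raising X -> dact M X v = 0,
      forall X, dinf_cartan X -> dact M X v = L X *: v &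
      forall U : set M, dsubmodule U -> U v -> U = setT].

(* M is (a model of) L(d_infinity; L), which is unique up to isomorphism. *)
Definition is_irr_hw_module (M : dinf_module) (L : zmat * K -> K) : Prop :=
  dirreducible M /\ exists v : M, dhw_vector L v.

(* The energy operator of an abstract d_infinity-module: the element
     \sum_(i >= 1) (i - 1/2) (E_(i,i) - E_(1-i,1-i))
   of d_infinity.  By the formula for the action on the Fock space, it acts there
   as the operator fock_L0 below. *)
Definition denergy : zmat * K :=
  ((fun i j : int => if i == j then i%:~R - 2^-1 else 0), 0).

Definition qdim (M : dinf_module) : nat -> K :=
  qtrace [set: M] (dact M denergy) idfun.

Definition has_qdim (M : dinf_module) : Prop :=
  has_qtrace [set: M] (dact M denergy) idfun.

Section Weights.
Variables (l : nat) (lam : l.-tuple nat).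

(* The indices i and j of m_1 >= .. >= m_i > 1 = .. = m_j > m_(j+1) = .. = 0. *)
Let i := count (fun m => (1 < m)%N) lam.
Let j := count (fun m => (0 < m)%N) lam.

Definition Lambda (X : zmat * K) : K :=
  ((2 * l + 1)%:R - i%:R - j%:R) * fundwt 0 X + (j%:R - i%:R) * fundwt 1 X
  + \sum_(m <- take i lam) fundwt m X.

Definition Lambda_det (X : zmat * K) : K :=
  (j%:R - i%:R) * fundwt 0 X + ((2 * l + 1)%:R - i%:R - j%:R) * fundwt 1 X
  + \sum_(m <- take i lam) fundwt m X.

End Weights.
End DInfinity.

Section Fock.
Variables (K : numFieldType) (l : nat).

(* The half-integer r = n + 1/2 is encoded by the integer n; thus r > 0 iff
   0 <= n, and - r is encoded by - n - 1.  The boolean is the sign: psi true p n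
   is psi^{+,p}_{n+1/2} and psi false p n is psi^{-,p}_{n+1/2}. *)
Definition hopp (n : int) : int := - n - 1.
Definition hval (n : int) : K := n%:~R + 2^-1.

Record fock_space := FockSpace {
  fcarrier :> lmodType K;
  psi : bool -> 'I_l -> int -> {linear fcarrier -> fcarrier};
  phi : int -> {linear fcarrier -> fcarrier};
  vac : fcarrier;
  psi_psi : forall s t p p' m n v,
    psi s p m (psi t p' n v) + psi t p' n (psi s p m v) =
    [&& s != t, p == p' & n == hopp m]%:R *: v;
  phi_phi : forall m n v,
    phi m (phi n v) + phi n (phi m v) = (n == hopp m)%:R *: v;
  psi_phi : forall s p m n v, psi s p m (phi n v) + phi n (psi s p m v) = 0;
  vac_neq0 : vac != 0;
  psi_vac : forall s p n, 0 <= n -> psi s p n vac = 0;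
  phi_vac : forall n, 0 <= n -> phi n vac = 0;
  vac_generates : forall U : set fcarrier, subspace U -> U vac ->
    (forall s p n v, U v -> U (psi s p n v)) ->
    (forall n v, U v -> U (phi n v)) -> U = setT
}.

Variable F : fock_space.
Implicit Types (a b : int -> F -> F) (v : F).

(* Normally ordered product : a_m b_n : *)
Definition nord a b (m n : int) v : F :=
  if 0 <= m then - b n (a m v) else a m (b n v).

(* \sum_r : a_r b_{-r} : *)
Definition nord_sum a b v : F := \sum_(n \in [set: int]) nord a b n (hopp n) v.

Definition so_e (p q : 'I_l) : F -> F := nord_sum (psi F true p) (psi F false q).
Definition so_e2 (s : bool) (p q : 'I_l) : F -> F :=
  nord_sum (psi F s p) (psi F s q).
Definition so_e1 (s : bool) (p : 'I_l) : F -> F := nord_sum (psi F s p) (phi F).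

Definition fock_L0 v : F :=
  \sum_(p < l) \sum_(n \in [set: int])
     hval n *: nord (psi F true p) (psi F false p) (hopp n) n v
  + \sum_(n \in [set n : int | 0 <= n]) hval n *: phi F (hopp n) (phi F n v).

Definition fock_alpha v : F :=
  \sum_(n \in [set n : int | 0 <= n]) phi F (hopp n) (phi F n v).

(* The realization in F of L(Lambda lam) (+) L(Lambda_det lam). *)
Definition so_hw_space (lam : l.-tuple nat) : set F :=
  [set v | [/\ forall p, so_e p p v = (tnth lam p)%:R *: v,
               forall p q : 'I_l, (p < q)%N -> so_e p q v = 0,
               forall p q : 'I_l, p != q -> so_e2 true p q v = 0 &
               forall p, so_e1 true p v = 0]].

Definition Qplus (lam : l.-tuple nat) : nat -> K :=
  qtrace (so_hw_space lam) fock_L0 idfun.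

Definition Qminus (lam : l.-tuple nat) : nat -> K :=
  qtrace (so_hw_space lam) fock_L0 (sign_pow fock_alpha).

Definition has_Qplus (lam : l.-tuple nat) : Prop :=
  has_qtrace (so_hw_space lam) fock_L0 idfun.

Definition has_Qminus (lam : l.-tuple nat) : Prop :=
  has_qtrace (so_hw_space lam) fock_L0 (sign_pow fock_alpha).

End Fock.

(* Main.v *)
(* Only quadratic operators occur, so the argument is a Casimir computation.  Let
   x run over the raising operators of so(2l+1) and y over those of d_infinity,
   with opposite lowering operators x* and y*.  On vectors with finitely many
   modes, sum x* x + sum y* y is diagonal on the monomials in the creation
   operators (the off-diagonal terms of the two sums cancel), and its eigenvalue
   on a monomial counts the terms of the x and y that do not kill it.  The
   monomials with eigenvalue 0 are Young diagrams, and exactly two of them have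
   the so(2l+1)-weight lambda, with opposite signs under (-1)^alpha; their
   d_infinity-weights are Lambda(lambda) and Lambda(lambda (x) det).  On the space
   of so(2l+1)-highest weight vectors the x vanish, so the diagonal operator lies
   in the algebra generated by d_infinity.  Hence each of the two eigenspaces of
   (-1)^alpha is irreducible: a submodule contains the joint highest weight
   vector in its lowest energy, and by induction on the energy a submodule with
   that vector contains everything.  An irreducible highest weight module is
   determined by its highest weight, so the eigenspaces for 1 and -1 are
   L(Lambda(lambda)) and L(Lambda(lambda (x) det)), and Q^+ and Q^- are the sum
   and the difference of their q-dimensions. *)
From HB Require Import structures.
Require Import Defs.
From mathcomp Require Import all_boot all_order all_algebra.
From mathcomp Require Import all_classical reals complex.
From mathcomp Require Import zify ring.
Set Implicit Arguments.
Unset Strict Implicit.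
Unset Printing Implicit Defensive.
Import Order.TTheory GRing.Theory Num.Theory.
Local Open Scope classical_set_scope.
Local Open Scope ring_scope.

(** * Finite dimensional linear algebra *)

(** The cancellation behind the Casimir computation is skew duality. On the first [N] creation modes
    a raising operator of so(2l+1) is cut into two matrix units of gl(2l+1), [so_op a b = glO a b -
    glO (bar b) (bar a)]. Products with the first piece cancel against the d_infinity-operators that
    move one fermion, products with the second against those that annihilate two. Each time the
    reason is that exchanging two species at fixed modes and exchanging two modes at fixed species
    give the same monomial with opposite signs. Energy [n/2] only involves modes below [n], so
    truncation at [N = n] is exact on that energy eigenspace; the diagonal operator D therefore
    depends on [n]. Its eigenvalue is a sum of non-negative numbers, so it vanishes only if each of
    them does. In the induction on the energy, the raising operators send [v] into the submodule
    [Z], hence D sends [v] into [Z]. A polynomial in D without the root 0 then shows that [v] is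
    congruent modulo [Z] to its component in the kernel of D, which is a multiple of the joint
    highest weight vector. *)

Section LinearFunctions.
Variables (K : numFieldType) (V W : lmodType K) (T : V -> W).
Hypothesis linT : linear T.

Definition to_linear : {linear V -> W} :=
  HB.pack T (GRing.isLinear.Build K V W *:%R T linT).

Lemma lfun0 : T 0 = 0. Proof. exact: (linear0 to_linear). Qed.
Lemma lfunD u v : T (u + v) = T u + T v. Proof. exact: (linearD to_linear). Qed.
Lemma lfunB u v : T (u - v) = T u - T v. Proof. exact: (linearB to_linear). Qed.
Lemma lfunZ a v : T (a *: v) = a *: T v. Proof. exact: (linearZ_LR to_linear). Qed.
Lemma lfun_sum I (r : seq I) P (f : I -> V) :
  T (\sum_(i <- r | P i) f i) = \sum_(i <- r | P i) T (f i).
Proof. exact: (linear_sum to_linear). Qed.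

End LinearFunctions.

Section Subspaces.
Variables (K : numFieldType) (V : lmodType K) (U : set V).
Hypothesis subU : subspace U.

Lemma subspaceZ a v : U v -> U (a *: v).
Proof. by move=> Uv; have := subU.2 a v 0 Uv subU.1; rewrite addr0. Qed.
Lemma subspaceD u v : U u -> U v -> U (u + v).
Proof. by move=> Uu Uv; have := subU.2 1 u v Uu Uv; rewrite scale1r. Qed.
Lemma subspaceN v : U v -> U (- v).
Proof. by move=> /(subspaceZ (-1)); rewrite scaleN1r. Qed.
Lemma subspaceB u v : U u -> U v -> U (u - v).
Proof. by move=> Uu /subspaceN; apply: subspaceD. Qed.
Lemma subspace_sum (I : eqType) (r : seq I) (P : pred I) (f : I -> V) :
  (forall i, i \in r -> P i -> U (f i)) -> U (\sum_(i <- r | P i) f i).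
Proof.
move=> H; rewrite big_seq_cond; elim/big_rec: _ => [|i x /andP[ir Pi] Ux].
  exact: subU.1.
by apply: subspaceD => //; apply: H.
Qed.
Lemma subspace_sumT (I : Type) (r : seq I) (f : I -> V) :
  (forall i, U (f i)) -> U (\sum_(i <- r) f i).
Proof.
by move=> H; elim/big_rec: _ => [|i x _ Ux]; [exact: subU.1|exact: subspaceD].
Qed.

End Subspaces.

Section Eigenvectors.
Variables (K : numFieldType) (V : lmodType K) (T : V -> V).
Hypothesis linT : linear T.

Lemma eigen_subspace U a : subspace U -> subspace (eigen_in U T a).
Proof.
move=> sU; split; first by split; [exact: sU.1|rewrite (lfun0 linT) scaler0].
move=> c u v [Uu Tu] [Uv Tv]; split; first exact: sU.2.
by rewrite linT Tu Tv scalerDr !scalerA mulrC.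
Qed.

(** A polynomial in [T] with roots [r]. Eigencomponents are extracted by such polynomials because
    these preserve every [T]-stable subspace. *)
Definition shift_prod (r : seq K) (v : V) : V :=
  foldr (fun t w => T w - t *: w) v r.

Lemma shift_prod_linear r : linear (shift_prod r).
Proof.
elim: r => [|t r IH] // a u v.
rewrite /= -!/(shift_prod _ _) IH linT scalerDr !scalerBr opprD addrACA.
by rewrite !scalerA [t * a]mulrC.
Qed.

Lemma shift_prod_eigen r v a : T v = a *: v ->
  shift_prod r v = (\prod_(t <- r) (a - t)) *: v.
Proof.
move=> Tv; elim: r => [|t r IH] /=; first by rewrite big_nil scale1r.
rewrite -!/(shift_prod _ _) IH (lfunZ linT) Tv big_cons !scalerA -scalerBl;
  congr (_ *: _); ring.
Qed.

Lemma shift_prod_closed r U v : subspace U -> (forall u, U u -> U (T u)) ->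
  U v -> U (shift_prod r v).
Proof.
move=> sU TU Uv; elim: r => [|t r IH] //=.
by apply: subspaceB => //; [apply: TU|apply: subspaceZ].
Qed.

Section Sum.
Variables (I : eqType) (r : seq I) (z : I -> V) (tau : I -> K) (t : K).
Hypothesis eigz : forall i, i \in r -> T (z i) = tau i *: z i.
Let q := [seq tau i | i <- r & tau i != t].

Lemma shift_prod_sum : shift_prod q (\sum_(i <- r) z i) =
  (\prod_(s <- q) (t - s)) *: \sum_(i <- r | tau i == t) z i.
Proof.
rewrite (lfun_sum (shift_prod_linear q)) scaler_sumr.
rewrite big_seq [RHS]big_seq_cond (bigID (fun i => tau i == t)) /=.
rewrite [X in _ + X]big1 ?addr0; last first.
  move=> i /andP[ir ti]; rewrite (shift_prod_eigen _ (eigz ir)).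
  suff -> : \prod_(s <- q) (tau i - s) = 0 by rewrite scale0r.
  apply/eqP; rewrite prodf_seq_eq0; apply/hasP; exists (tau i); last first.
    by rewrite /= subrr.
  by apply/mapP; exists i => //; rewrite mem_filter ti.
by apply: eq_bigr => i /andP[ir /eqP ti]; rewrite (shift_prod_eigen _ (eigz ir)) ti.
Qed.

Lemma shift_prod_neq0 : \prod_(s <- q) (t - s) != 0.
Proof.
rewrite prodf_seq_neq0 /q; apply/allP => s /mapP[j]; rewrite mem_filter.
by move=> /andP[tj _] ->; rewrite /= subr_eq0 eq_sym.
Qed.

Lemma eigen_component U : subspace U -> (forall u, U u -> U (T u)) ->
  U (\sum_(i <- r) z i) -> U (\sum_(i <- r | tau i == t) z i).
Proof.
move=> sU TU /(shift_prod_closed q sU TU); rewrite shift_prod_sum.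
move=> /(subspaceZ sU (\prod_(s <- q) (t - s))^-1).
by rewrite scalerA mulVf ?shift_prod_neq0 // scale1r.
Qed.

(** The polynomial with roots [q] multiplies the eigenvector [v] by the same non-zero scalar that it
    leaves in front of the [t]-part of the sum. The [z i] may be linearly dependent. *)
Lemma eigen_sieve v : v = \sum_(i <- r) z i -> T v = t *: v ->
  v = \sum_(i <- r | tau i == t) z i.
Proof.
move=> vE Tv; have := shift_prod_sum; rewrite -vE (shift_prod_eigen _ Tv).
exact/scalerI/shift_prod_neq0.
Qed.

End Sum.

Lemma eigen_sieve_all (I : eqType) (r : seq I) (z : I -> V) (tau : I -> K) t v s :
  (forall i, i \in r -> T (z i) = tau i *: z i) ->
  v = \sum_(i <- r) z i -> T v = t *: v ->
  \sum_(i <- r | tau i == s) z i = (s == t)%:R *: v.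
Proof.
move=> eigz vE Tv; have [->|st] := eqVneq s t.
  by rewrite scale1r -(eigen_sieve eigz vE Tv).
(* For [s != t] the [s]-part lies in the [T]-stable [t]-eigenspace and is also an [s]-eigenvector,
   hence zero. *)
rewrite scale0r; set w := LHS.
have sU : subspace (eigen_in setT T t) by apply: eigen_subspace.
have [_ Tw] : eigen_in setT T t w.
  apply: (eigen_component s eigz sU); last by rewrite -vE.
  by move=> x [_ Tx]; split=> //; rewrite Tx (lfunZ linT) Tx.
have Tw' : T w = s *: w.
  rewrite (lfun_sum linT) big_seq_cond scaler_sumr [RHS]big_seq_cond.
  by apply: eq_bigr => i /andP[ir /eqP <-]; apply: eigz.
apply/eqP; move/eqP: Tw'; rewrite Tw -subr_eq0 -scalerBl scaler_eq0.
by rewrite subr_eq0 eq_sym (negbTE st).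
Qed.

End Eigenvectors.

Section Bases.
Variables (K : numFieldType) (V : lmodType K).
Implicit Types U : set V.

(** The [b i] may lie outside [U]. Induction on their number: the vectors of [U] in the span of all
    but the first form a subspace [U'] of codimension at most one, so at most one vector [u] has to
    be added to a basis of [U']. *)
Lemma finite_dim_sub n : forall U (b : 'I_n -> V), subspace U ->
  (forall v, U v -> exists c : 'I_n -> K, v = \sum_(i < n) c i *: b i) ->
  finite_dim U.
Proof.
elim: n => [|n IH] U b sU spanU.
  exists 0%N, b; split; first by move=> c _ [].
  apply/seteqP; split=> [v|v [c ->]] /=; first exact: spanU.
  by rewrite big_ord0; exact: sU.1.
pose U' := [set v | U v /\
  exists c : 'I_n -> K, v = \sum_(i < n) c i *: b (lift ord0 i)].
have sU' : subspace U'.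
  split; first split; first exact: sU.1.
    by exists (fun=> 0); rewrite big1 // => i _; rewrite scale0r.
  move=> a u v [Uu [c uE]] [Uv [d vE]]; split; first exact: sU.2.
  exists (fun i => a * c i + d i); rewrite uE vE scaler_sumr -big_split /=.
  by apply: eq_bigr => i _; rewrite scalerDl scalerA.
have [|m [b' [ind U'E]]] := IH U' (b \o lift ord0) sU'; first by move=> v [_].
have [[u [Uu nU'u]]|none] := pselect (exists u, U u /\ ~ U' u); last first.
  exists m, b'; split=> //; rewrite -U'E; apply/seteqP; split=> [v Uv|v []] //.
  by apply: contrapT => nU'; apply: none; exists v.
have [c uE] := spanU u Uu; rewrite big_ord_recl in uE.
have c0 : c ord0 != 0.
  apply: contra_notN nU'u => /eqP c0; split=> //.
  by exists (c \o lift ord0); rewrite uE c0 scale0r add0r.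
pose B (i : 'I_m.+1) := if unlift ord0 i is Some j then b' j else u.
have BE (d : 'I_m.+1 -> K) : \sum_(i < m.+1) d i *: B i =
    d ord0 *: u + \sum_(i < m) d (lift ord0 i) *: b' i.
  rewrite big_ord_recl /B unlift_none; congr (_ + _).
  by apply: eq_bigr => i _; rewrite liftK.
have U'span (d : 'I_m -> K) : U' (\sum_(i < m) d i *: b' i).
  by rewrite U'E; exists d.
exists m.+1, B; split.
  move=> d; rewrite BE => /eqP; rewrite addr_eq0 => /eqP E.
  have d0 : d ord0 = 0.
    apply: contrapT => /eqP d0; apply: nU'u.
    have -> : u = - (d ord0)^-1 *: \sum_(i < m) d (lift ord0 i) *: b' i.
      by rewrite scaleNr -scalerN -E scalerA mulVf // scale1r.
    exact/(subspaceZ sU')/U'span.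
  move: E; rewrite d0 scale0r => /esym/eqP; rewrite oppr_eq0 => /eqP /ind dl.
  by move=> i; case: (unliftP ord0 i) => [j|] ->.
apply/seteqP; split=> [v Uv|v [d]] /=.
  have [d vE] := spanU v Uv; rewrite big_ord_recl in vE.
  pose a := d ord0 / c ord0.
  have : U' (v - a *: u).
    split; first exact/(subspaceB sU)/(subspaceZ sU).
    exists (fun i => d (lift ord0 i) - a * c (lift ord0 i)).
    rewrite vE uE scalerDr scalerA divfK // opprD addrACA subrr add0r.
    rewrite scaler_sumr -sumrB; apply: eq_bigr => i _.
    by rewrite scalerBl scalerA.
  rewrite U'E => -[e E]; exists (fun i => oapp e a (unlift ord0 i)).
  rewrite BE unlift_none /= -(subrK (a *: u) v) E addrC; congr (_ + _).
  by apply: eq_bigr => i _; rewrite liftK.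
rewrite BE => ->; apply: (subspaceD sU); first exact: (subspaceZ sU).
by have [] := U'span (d \o lift ord0).
Qed.

Lemma is_trace_diag U g n (b : 'I_n -> V) (d : 'I_n -> K) : is_basis U b ->
  (forall i, g (b i) = d i *: b i) -> is_trace U g (\sum_(i < n) d i).
Proof.
move=> bU gb; exists n, b, (diag_mx (\row_i d i)); split=> //.
  move=> j; rewrite gb (bigD1 j) //= !mxE eqxx mulr1n big1 ?addr0 // => i ij.
  by rewrite !mxE (negbTE ij) mulr0n scale0r.
by rewrite mxtrace_diag; apply: eq_bigr => i _; rewrite mxE.
Qed.

Lemma is_basis_coord U n (b : 'I_n -> V) (c d : 'I_n -> K) : is_basis U b ->
  \sum_(i < n) c i *: b i = \sum_(i < n) d i *: b i -> forall i, c i = d i.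
Proof.
move=> [ind _] E i; apply/eqP; rewrite -subr_eq0; apply/eqP.
apply: (ind (fun i => c i - d i)).
under eq_bigr do rewrite scalerBl.
by rewrite sumrB E subrr.
Qed.

(** The coordinate changes [Q] and [Q'] between two bases, of sizes not yet known to agree, are
    inverse to each other and satisfy [Q A = A' Q]; hence [tr A = tr (Q' A' Q) = tr (A' Q Q') = tr
    A']. *)
Lemma is_trace_uniq U g t t' : linear g ->
  is_trace U g t -> is_trace U g t' -> t = t'.
Proof.
move=> ling [n [b [A [bU gb ->]]]] [n' [b' [A' [bU' gb' ->]]]].
have memb i : U (b i).
  rewrite bU.2; exists (fun j => (j == i)%:R).
  rewrite (bigD1 i) //= eqxx scale1r big1 ?addr0 // => j /negbTE ->.
  by rewrite scale0r.
have memb' i : U (b' i).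
  rewrite bU'.2; exists (fun j => (j == i)%:R).
  rewrite (bigD1 i) //= eqxx scale1r big1 ?addr0 // => j /negbTE ->.
  by rewrite scale0r.
have /choice[P bE] : forall j, exists c : 'I_n' -> K,
    b j = \sum_(i < n') c i *: b' i by move=> j; have := memb j; rewrite bU'.2.
have /choice[P' bE'] : forall j, exists c : 'I_n -> K,
    b' j = \sum_(i < n) c i *: b i by move=> j; have := memb' j; rewrite bU.2.
pose Q := \matrix_(i, j) P j i : 'M[K]_(n', n).
pose Q' := \matrix_(i, j) P' j i : 'M[K]_(n, n').
have QQ : Q' *m Q = 1%:M.
  apply/matrixP => i j; rewrite !mxE; symmetry; move: i; apply: (is_basis_coord bU).
  rewrite (bigD1 j) //= eqxx scale1r big1 ?addr0; last first.
    by move=> i /negbTE ->; rewrite scale0r.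
  under [RHS]eq_bigr do rewrite scaler_suml.
  rewrite [RHS]exchange_big /= [LHS]bE; apply: eq_bigr => k _.
  rewrite [in LHS]bE' scaler_sumr; apply: eq_bigr => i _.
  by rewrite !mxE scalerA mulrC.
have AQ : Q *m A = A' *m Q.
  apply/matrixP => i j; rewrite !mxE; move: i; apply: (is_basis_coord bU').
  under eq_bigr do rewrite scaler_suml.
  under [RHS]eq_bigr do rewrite scaler_suml.
  rewrite exchange_big [RHS]exchange_big /=.
  transitivity (g (b j)).
    rewrite gb; apply: eq_bigr => k _; rewrite bE scaler_sumr.
    by apply: eq_bigr => i _; rewrite mxE scalerA mulrC.
  rewrite [b j]bE (lfun_sum ling); apply: eq_bigr => k _.
  rewrite (lfunZ ling) gb' scaler_sumr; apply: eq_bigr => i _.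
  by rewrite mxE scalerA mulrC.
have QQ' : Q *m Q' = 1%:M.
  apply/matrixP => i j; rewrite !mxE; symmetry; move: i; apply: (is_basis_coord bU').
  rewrite (bigD1 j) //= eqxx scale1r big1 ?addr0; last first.
    by move=> i /negbTE ->; rewrite scale0r.
  under [RHS]eq_bigr do rewrite scaler_suml.
  rewrite [RHS]exchange_big /= [LHS]bE'; apply: eq_bigr => k _.
  rewrite [in LHS]bE scaler_sumr; apply: eq_bigr => i _.
  by rewrite !mxE scalerA mulrC.
by rewrite -[A]mul1mx -QQ -mulmxA AQ mxtrace_mulC -mulmxA QQ' mulmx1.
Qed.

Lemma trace_onE U g t : linear g -> is_trace U g t -> trace_on U g = t.
Proof.
move=> ling tU; apply: xget_unique => // t' tU'.
exact: (is_trace_uniq ling tU' tU).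
Qed.

(** Applying [S] to [v1 + v2 = 0] gives [v1 - v2 = 0], so the two parts are independent. The
    resulting basis diagonalizes [idfun] and [S] at once, and both traces can be read off it. *)
Lemma is_basis_split U U1 U2 (S : V -> V) n1 n2
    (b1 : 'I_n1 -> V) (b2 : 'I_n2 -> V) :
  linear S -> is_basis U1 b1 -> is_basis U2 b2 ->
  (forall v, U1 v -> U v /\ S v = v) -> (forall v, U2 v -> U v /\ S v = - v) ->
  subspace U ->
  (forall v, U v -> exists v1 v2, [/\ U1 v1, U2 v2 & v = v1 + v2]) ->
  exists b : 'I_(n1 + n2) -> V, is_basis U b /\
    forall i, S (b i) = (if fintype.split i is inl _ then 1 else - 1) *: b i.
Proof.
move=> linS bU1 bU2 U1U U2U sU UU.
pose b i := match fintype.split i with inl j => b1 j | inr j => b2 j end.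
have mem1 i : U1 (b1 i).
  rewrite bU1.2; exists (fun j => (j == i)%:R).
  rewrite (bigD1 i) //= eqxx scale1r big1 ?addr0 // => j /negbTE ->.
  by rewrite scale0r.
have mem2 i : U2 (b2 i).
  rewrite bU2.2; exists (fun j => (j == i)%:R).
  rewrite (bigD1 i) //= eqxx scale1r big1 ?addr0 // => j /negbTE ->.
  by rewrite scale0r.
have bE (c : 'I_(n1 + n2) -> K) : \sum_(i < n1 + n2) c i *: b i =
    \sum_(i < n1) c (lshift n2 i) *: b1 i +
    \sum_(i < n2) c (rshift n1 i) *: b2 i.
  rewrite big_split_ord /b /=; congr (_ + _); apply: eq_bigr => i _.
    by rewrite (unsplitK (inl i)).
  by rewrite (unsplitK (inr i)).
exists b; split; last first.
  move=> i; rewrite /b; case: (fintype.split i) => j.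
    by rewrite scale1r; case: (U1U _ (mem1 j)).
  by rewrite scaleN1r; case: (U2U _ (mem2 j)).
split.
  move=> c; rewrite bE; set v1 := (X in X + _); set v2 := (X in _ + X) => v0.
  have S1 : U1 v1 by rewrite bU1.2; exists (fun i => c (lshift n2 i)).
  have S2 : U2 v2 by rewrite bU2.2; exists (fun i => c (rshift n1 i)).
  have := congr1 S v0; rewrite (lfunD linS) (lfun0 linS).
  rewrite (U1U _ S1).2 (U2U _ S2).2 => /eqP; rewrite subr_eq0 => /eqP v12.
  have v20 : v2 = 0.
    move/eqP: v0; rewrite v12 -mulr2n -scaler_nat scaler_eq0 pnatr_eq0 /=.
    by move/eqP.
  have v10 : v1 = 0 by rewrite v12.
  move=> i; rewrite -(splitK i); case: (fintype.split i) => j /=.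
    exact: (bU1.1 (fun i => c (lshift n2 i)) v10).
  exact: (bU2.1 (fun i => c (rshift n1 i)) v20).
apply/seteqP; split=> [v Uv|v [c ->]] /=.
  have [v1 [v2 []]] := UU v Uv; rewrite bU1.2 bU2.2 => -[c1 ->] [c2 ->] ->.
  exists (fun i => match fintype.split i with inl j => c1 j | inr j => c2 j end).
  rewrite bE; congr (_ + _); apply: eq_bigr => i _.
    by rewrite (unsplitK (inl i)).
  by rewrite (unsplitK (inr i)).
rewrite bE; apply: (subspaceD sU); apply: (subspace_sumT sU) => i.
  exact/(subspaceZ sU)/(U1U _ _).1.
exact/(subspaceZ sU)/(U2U _ _).1.
Qed.

End Bases.

Lemma is_basis_lift (K : numFieldType) (M V : lmodType K) (g : M -> V)
    (A : set M) (U : set V) n (b : 'I_n -> V) :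
  linear g -> injective g -> (forall m, A m <-> U (g m)) ->
  (forall u, U u -> exists m, g m = u) -> is_basis U b ->
  exists b' : 'I_n -> M, is_basis A b'.
Proof.
move=> ling injg AU surg bU.
have memb i : U (b i).
  rewrite bU.2; exists (fun j => (j == i)%:R).
  rewrite (bigD1 i) //= eqxx scale1r big1 ?addr0 // => j /negbTE ->.
  by rewrite scale0r.
have /choice[b' b'E] : forall i, exists m, g m = b i by move=> i; apply: surg.
have gE (c : 'I_n -> K) : g (\sum_(i < n) c i *: b' i) = \sum_(i < n) c i *: b i.
  by rewrite (lfun_sum ling); apply: eq_bigr => i _; rewrite (lfunZ ling) b'E.
exists b'; split.
  by move=> c /(congr1 g); rewrite gE (lfun0 ling) => /bU.1.
apply/seteqP; split=> [m /AU|m [c ->]] /=; last by rewrite AU gE bU.2; exists c.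
by rewrite bU.2 => -[c E]; exists c; apply: injg; rewrite gE.
Qed.

(** * The Clifford action *)

Section Window.

(** The interval [1 - N .. N], stable under the reflection [i -> 1 - i] that defines d_infinity. Its
    first half consists of creation modes, its second of annihilation modes. *)
Definition win (N : nat) : seq int :=
  [seq Posz k.+1 | k <- iota 0 N] ++ [seq - Posz k | k <- iota 0 N].

Lemma mem_win N i : (i \in win N) = (- N%:Z < i <= N%:Z).
Proof.
rewrite mem_cat; apply/orP/idP => [[] /mapP[k]|H].
- by rewrite mem_iota => kN ->; lia.
- by rewrite mem_iota => kN ->; lia.
have [i0|i0] := leP i 0; [right|left]; apply/mapP.
  by exists `|i|%N; rewrite ?mem_iota; lia.
by exists (`|i|.-1)%N; rewrite ?mem_iota; lia.
Qed.

Lemma win_uniq N : uniq (win N).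
Proof.
rewrite cat_uniq !map_inj_uniq ?iota_uniq /=.
- rewrite andbT; apply/hasPn => x /mapP[k _ ->]; apply/mapP => -[m _]; lia.
- by move=> a b; lia.
- by move=> a b [].
Qed.

Lemma fsum_win (V : nmodType) N (f : int -> V) :
  (forall i, i \notin win N -> f i = 0) ->
  \sum_(i \in [set: int]) f i = \sum_(i <- win N) f i.
Proof.
move=> f0; rewrite (fsbigE (win N)) ?win_uniq // => [|i _]; last exact: f0.
by apply: eq_bigl => i; rewrite in_setT.
Qed.

Lemma sum_win_refl (V : nmodType) N (f : int -> V) :
  \sum_(i <- win N) f i = \sum_(i <- win N) f (1 - i).
Proof.
rewrite -[RHS](big_map (fun i : int => 1 - i) xpredT f); apply: perm_big.
apply: uniq_perm; rewrite ?win_uniq ?map_inj_uniq ?win_uniq //; first by move=> a b; lia.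
move=> i; apply/idP/mapP => [|[j]]; rewrite ?mem_win.
  by move=> H; exists (1 - i); rewrite ?mem_win; lia.
by move=> H ->; lia.
Qed.

Lemma sum_winE (V : nmodType) N (f : int -> V) :
  \sum_(i <- win N) f i = \sum_(k < N) (f (Posz k.+1) + f (- Posz k)).
Proof.
by rewrite -(big_mkord xpredT (fun k => f (Posz k.+1) + f (- Posz k)))
  big_split /index_iota subn0 big_cat !big_map.
Qed.

Lemma sum_win_delta (K : pzRingType) (V : lmodType K) N (f : int -> V) n :
  n \in win N -> \sum_(i <- win N) (i == n)%:R *: f i = f n.
Proof.
move=> nN; rewrite (bigD1_seq n) ?win_uniq //= eqxx scale1r big1 ?addr0 //.
by move=> i /negbTE ->; rewrite scale0r.
Qed.

End Window.

Section Fock.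
Variables (K : numFieldType) (l : nat) (F : fock_space K l).

Local Notation A := (option (bool * 'I_l)).
Implicit Types (a b e : A) (i j n : int) (v w : F).

Definition bar a : A := if a is Some (s, p) then Some (~~ s, p) else None.

Lemma barK : involutive bar. Proof. by case=> [[s p]|] //=; rewrite negbK. Qed.
Lemma bar_eq a b : (bar a == b) = (a == bar b).
Proof. exact: (can2_eq barK barK). Qed.

(* The 2l+1 species of fermions on one footing: the label Some (true, p) stands
   for psi^{+,p}, Some (false, p) for psi^{-,p} and None for phi.  The integer i
   stands for the mode 1/2 - i, so that d_infinity acts on the index i as on the
   standard basis of its defining representation. *)
Definition fmode a i : {linear F -> F} :=
  if a is Some (s, p) then psi F s p (- i) else phi F (- i).

Local Notation u := fmode.

Lemma uZ a i c v : u a i (c *: v) = c *: u a i v.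
Proof. exact: linearZ_LR. Qed.

Lemma uu a b i j v :
  u a i (u b j v) + u b j (u a i v) = ((b == bar a) && (i + j == 1))%:R *: v.
Proof.
have E : (- j == hopp (- i)) = (i + j == 1) by rewrite /hopp; lia.
case: a b => [[s p]|] [[t q]|] /=.
- rewrite psi_psi E; congr (_%:R *: v); rewrite -[Some _ == Some _]/((t, q) == (~~ s, p)).
  by rewrite xpair_eqE [q == p]eq_sym; case: s t => [] [] //=; rewrite ?andbF.
- by rewrite psi_phi scale0r.
- by rewrite addrC psi_phi scale0r.
- by rewrite phi_phi E.
Qed.

Lemma uuC a b i j v :
  u a i (u b j v) = ((b == bar a) && (i + j == 1))%:R *: v - u b j (u a i v).
Proof. by rewrite -uu addrK. Qed.

Lemma u_vac a i : i <= 0 -> u a i (vac F) = 0.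
Proof.
by case: a => [[s p]|] i0 /=; [apply: psi_vac|apply: phi_vac]; rewrite oppr_ge0.
Qed.

Lemma u_generates (U : set F) : subspace U -> U (vac F) ->
  (forall a i v, U v -> U (u a i v)) -> U = setT.
Proof.
move=> sU Uvac Uu; apply: vac_generates => // [s p n v Uv|n v Uv].
  by have := Uu (Some (s, p)) (- n) v Uv; rewrite /= opprK.
by have := Uu None (- n) v Uv; rewrite /= opprK.
Qed.

(** The substitute for convergence: only the annihilation modes [1 - N .. 0] can act non-trivially
    on [v], so every infinite sum of normally ordered products reduces to a window. *)
Definition below N v := forall a i, i <= - N%:Z -> u a i v = 0.

Lemma below_le N M v : (N <= M)%N -> below N v -> below M v.
Proof. by move=> NM vN a i iM; apply: vN; lia. Qed.

Lemma ex_below v : exists N, below N v.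
Proof.
suff E : [set v | exists N, below N v] = setT by have : [set: F] v by []; rewrite -E.
apply: u_generates.
- split; first by exists 0%N => a i _; rewrite linear0.
  move=> c x y [N xN] [M yM]; exists (maxn N M) => a i iNM.
  by rewrite linearP xN ?yM ?scaler0 ?addr0 //; lia.
- by exists 0%N => a i i0; apply: u_vac; lia.
- move=> a i x [N xN]; exists (maxn N `|i|.+1) => b j jN.
  rewrite uuC xN ?linear0 ?subr0; last lia.
  have -> : (j + i == 1) = false by lia.
  by rewrite andbF scale0r addr0.
Qed.

Lemma card_species : #|{: A}| = (2 * l + 1)%N.
Proof. by rewrite card_option card_prod card_bool card_ord addn1. Qed.

(* The image of E_(i,j) - E_(1-j,1-i); subtracting the constant is the normal ordering. *)
Definition bilin i j v : F :=
  \sum_a (u a i (u (bar a) (1 - j) v) - ((i == j) && (j <= 0))%:R *: v).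

Lemma bilin_linear i j : linear (bilin i j).
Proof.
move=> c x y; rewrite /bilin scaler_sumr -big_split /=; apply: eq_bigr => a _.
rewrite (linearP (u (bar a) (1 - j))) (linearP (u a i)) scalerBr scalerDr.
by rewrite opprD !scalerA [c * _]mulrC addrACA.
Qed.

Lemma bilinE i j v : bilin i j v = \sum_a u a i (u (bar a) (1 - j) v)
  - ((2 * l + 1)%:R * ((i == j) && (j <= 0))%:R) *: v.
Proof.
by rewrite /bilin sumrB sumr_const card_species -[in RHS]scalerA -scaler_nat.
Qed.

(** Exchanging the two fermions yields an anticommutator when [i = j]. It is absorbed by the normal
    ordering constants, since exactly one of [j <= 0] and [1 - j <= 0] holds. *)
Lemma bilin_anti i j v : bilin (1 - j) (1 - i) v = - bilin i j v.
Proof.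
rewrite /bilin (reindex_inj (inv_inj barK)) -sumrN; apply: eq_bigr => a _.
rewrite barK /= [1 - (1 - i)]subKr uuC barK eqxx /= opprB addrAC.
rewrite -scalerBl; congr (_ *: v - _).
have -> : (1 - j + i == 1) = (i == j) by lia.
have -> : (1 - j == 1 - i) = (i == j) by lia.
have -> : (1 - i <= 0) = (0 < i) by lia.
have [->|_] := eqVneq i j; rewrite ?subr0 //=.
by case: ltP; rewrite ?subrr ?subr0.
Qed.

Lemma bilin_eq0 N i j v : below N v -> (N%:Z < j) || (i <= - N%:Z) -> bilin i j v = 0.
Proof.
have H i' j' : below N v -> N%:Z < j' -> bilin i' j' v = 0.
  move=> vN Nj; rewrite /bilin big1 // => a _; rewrite vN ?linear0; last lia.
  have -> : (j' <= 0) = false by lia.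
  by rewrite andbF scale0r subr0.
move=> vN /orP[Nj|iN]; first exact: H.
by apply/eqP; rewrite -oppr_eq0 -bilin_anti H //; lia.
Qed.

(** The fermion [u a n] transforms like the [n]-th basis vector under [E_(i,j) - E_(1-j,1-i)]. The
    two terms come from the summands [a] and [bar a] of [bilin]; the normal ordering constants drop
    out. *)
Lemma bilin_u i j a n v : bilin i j (u a n v) = u a n (bilin i j v) +
  ((n == j)%:R *: u a i v - (i + n == 1)%:R *: u a (1 - j) v).
Proof.
pose f b := ((b == a) && (n == j))%:R *: u a i v -
  ((b == bar a) && (i + n == 1))%:R *: u a (1 - j) v.
transitivity (\sum_b (u a n (u b i (u (bar b) (1 - j) v) -
    ((i == j) && (j <= 0))%:R *: v) + f b)).
  apply: eq_bigr => b _; rewrite linearB uZ /= addrAC; congr (_ - _).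
  rewrite (uuC (bar b) a) linearB uZ /= barK (uuC b a _ n) opprB.
  rewrite addrCA /f; congr (_ + (_ - _)).
    have -> : (1 - j + n == 1) = (n == j) by lia.
    by rewrite eq_sym; case: eqP => [->|_] //=; rewrite !scale0r.
  rewrite eq_sym -bar_eq eq_sym.
  by case: eqP => [->|_] /=; rewrite ?barK ?scale0r.
rewrite big_split /= -linear_sum /=; congr (_ + _).
rewrite sumrB; congr (_ - _).
  rewrite (bigD1 a) //= eqxx big1 ?addr0 // => b /negbTE ->.
  by rewrite scale0r.
rewrite (bigD1 (bar a)) //= eqxx big1 ?addr0 // => b /negbTE ->.
by rewrite scale0r.
Qed.

End Fock.

(** * The action of d_infinity on the Fock space *)

Section MatrixLemmas.
Variable K : numFieldType.
Implicit Types A B : zmat K.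

Definition banded (N : nat) A := forall i j : int, (N < `|i - j|)%N -> A i j = 0.

Lemma zmat_mulE N M A B i j : banded N A -> (`|i| + N < M)%N ->
  zmat_mul A B i j = \sum_(k <- win M) A i k * B k j.
Proof.
move=> bA NM; apply: fsum_win => k; rewrite mem_win => kM.
by rewrite bA ?mul0r //; lia.
Qed.

Lemma banded_mul N M A B : banded N A -> banded M B -> banded (N + M) (zmat_mul A B).
Proof.
move=> bA bB i j ij; apply: fsbig1 => k _.
have [ik|ik] := ltnP N `|i - k|; first by rewrite bA ?mul0r.
by rewrite bB ?mulr0 //; lia.
Qed.

Lemma banded_comm N M A B : banded N A -> banded M B -> banded (N + M) (zmat_comm A B).
Proof.
move=> bA bB i j ij; rewrite /zmat_comm !fctE.
by rewrite (banded_mul bA bB) // (banded_mul bB bA) ?subrr // addnC.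
Qed.

Definition antisym A := forall i j : int, A i j = - A (1 - j) (1 - i).

Lemma antisym_mul N M A B i j : banded N A -> banded M B -> antisym A -> antisym B ->
  zmat_mul A B i j = zmat_mul B A (1 - j) (1 - i).
Proof.
move=> bA bB aA aB.
rewrite (@zmat_mulE N (`|i| + `|j| + N + M + 3)) //; last lia.
rewrite (@zmat_mulE M (`|i| + `|j| + N + M + 3)) //; last lia.
rewrite sum_win_refl; apply: eq_bigr => k _.
by rewrite aA aB mulrNN mulrC subKr.
Qed.

Lemma dinf_comm (X Y : zmat K * K) c : dinf X -> dinf Y -> dinf (zmat_comm X.1 Y.1, c).
Proof.
move=> [[N bX] aX] [[M bY] aY]; split; first by exists (N + M)%N; apply: banded_comm.
move=> i j; rewrite /zmat_comm /= !fctE opprB.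
by rewrite (antisym_mul i j bX bY) // (antisym_mul i j bY bX).
Qed.

Lemma zmat_mul_diagl D A i j : (forall i k : int, i != k -> D i k = 0) ->
  zmat_mul D A i j = D i i * A i j.
Proof.
move=> D0; rewrite /zmat_mul (fsbigE [:: i]) //=.
  by rewrite big_mkcond big_seq1 in_setT.
by move=> k _; rewrite inE => ki; rewrite D0 ?mul0r // eq_sym.
Qed.

Lemma zmat_mul_diagr D A i j : (forall i k : int, i != k -> D i k = 0) ->
  zmat_mul A D i j = A i j * D j j.
Proof.
move=> D0; rewrite /zmat_mul (fsbigE [:: j]) //=.
  by rewrite big_mkcond big_seq1 in_setT.
by move=> k _; rewrite inE => kj; rewrite D0 ?mulr0.
Qed.

Lemma zmat_comm_diag D A i j : (forall i k : int, i != k -> D i k = 0) ->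
  zmat_comm D A i j = (D i i - D j j) * A i j.
Proof.
move=> D0; rewrite /zmat_comm !fctE zmat_mul_diagl // zmat_mul_diagr //.
by rewrite mulrBl [D j j * _]mulrC.
Qed.

Lemma zmat_J_diag (i k : int) : i != k -> zmat_J K i k = 0.
Proof. by rewrite /zmat_J => /negbTE ->. Qed.

(** The commutator with [J] weights [A i j * B j i] by [[i <= 0] - [j <= 0]]. Inside the band this
    vanishes away from the origin, so a window suffices, and swapping [i] and [j] in the second half
    gives the diagonal of a commutator over [i <= 0]. That is the form in which normal ordering
    produces it. *)
Lemma cocycleE N M A B : banded N A -> (N < M)%N ->
  cocycle A B = \sum_(i <- win M | i <= 0) \sum_(j <- win M)
     (A i j * B j i - B i j * A j i).
Proof.
move=> bA NM; pose f (i j : int) := ((i <= 0)%R%:R - (j <= 0)%R%:R) * A i j * B j i.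
have f0 (i j : int) : (i \notin win M) || (j \notin win M) -> f i j = 0.
  rewrite !mem_win /f => ij.
  have [ijN|ijN] := ltnP N `|i - j|; first by rewrite bA // mulr0 mul0r.
  have -> : (j <= 0) = (i <= 0) by lia.
  by rewrite subrr !mul0r.
have -> : cocycle A B = \sum_(i <- win M) \sum_(j <- win M) f i j.
  rewrite /cocycle /zmat_tr /zmat_mul.
  have fE (i j : int) : zmat_comm (zmat_J K) A i j * B j i = f i j.
    by rewrite (zmat_comm_diag _ _ _ zmat_J_diag) /zmat_J !eqxx.
  rewrite (@fsum_win _ M); last first.
    by move=> i iM; apply: fsbig1 => j _; rewrite fE f0 // iM.
  apply: eq_bigr => i _; rewrite (@fsum_win _ M).
    by apply: eq_bigr => j _; rewrite fE.
  by move=> j jM; rewrite fE f0 // jM orbT.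
rewrite [RHS]big_mkcond /=.
under eq_bigr => i _ do under eq_bigr => j _ do rewrite /f -mulrA mulrBl.
under eq_bigr => i _ do rewrite sumrB.
rewrite sumrB [X in _ - X]exchange_big /= -sumrB; apply: eq_bigr => i _.
case: (i <= 0).
  by rewrite -sumrB; apply: eq_bigr => j _; rewrite !mul1r [B i j * _]mulrC.
by rewrite !big1 ?subrr // => j _; rewrite mul0r.
Qed.

End MatrixLemmas.

Section Fock.
Variables (K : numFieldType) (l : nat) (F : fock_space K l).
Local Notation bilin := (@bilin K l F).
Implicit Types (X Y : zmat K * K) (v w : F).

(* The sum over all i, j counts each E_(i,j) - E_(1-j,1-i) twice. *)
Definition fock_act X v : F := 2^-1 *:
    (\sum_(i \in [set: int]) \sum_(j \in [set: int]) X.1 i j *: bilin i j v)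
  + (X.2 * (l%:R + 2^-1)) *: v.

Definition act_win N X v : F := 2^-1 *:
    (\sum_(i <- win N) \sum_(j <- win N) X.1 i j *: bilin i j v)
  + (X.2 * (l%:R + 2^-1)) *: v.

Lemma fock_actE N b X v : banded b X.1 -> below N v ->
  forall M, (N + b < M)%N -> fock_act X v = act_win M X v.
Proof.
move=> bX vN M NM; rewrite /fock_act /act_win; congr (_ *: _ + _).
have H i j : (i \notin win M) || (j \notin win M) -> X.1 i j *: bilin i j v = 0.
  rewrite !mem_win => ij.
  have [ijb|ijb] := ltnP b `|i - j|; first by rewrite bX ?scale0r.
  by rewrite (bilin_eq0 vN) ?scaler0 //; lia.
rewrite (@fsum_win _ M); last first.
  by move=> i iM; apply: fsbig1 => j _; rewrite H // iM.
by apply: eq_bigr => i _; rewrite (@fsum_win _ M) // => j jM; rewrite H // jM orbT.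
Qed.

Lemma act_win_linear N X : linear (act_win N X).
Proof.
move=> c x y; rewrite /act_win.
under eq_bigr => i _ do under eq_bigr => j _ do
  rewrite bilin_linear scalerDr scalerA mulrC -scalerA.
under eq_bigr => i _ do rewrite big_split /= -scaler_sumr.
rewrite big_split /= -scaler_sumr !scalerDr !scalerA addrACA.
by rewrite [2^-1 * c]mulrC [_ * c]mulrC.
Qed.

Lemma ex_act_win X v : gl_band X.1 ->
  exists N, forall M, (N < M)%N -> fock_act X v = act_win M X v.
Proof.
by move=> [b bX]; have [N vN] := ex_below v; exists (N + b)%N; apply: fock_actE.
Qed.

Lemma fock_act_linear X : gl_band X.1 -> linear (fock_act X).
Proof.
move=> bX c x y.
have [N1 H1] := ex_act_win x bX; have [N2 H2] := ex_act_win y bX.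
have [N3 H3] := ex_act_win (c *: x + y) bX.
pose N := (N1 + N2 + N3).+1.
by rewrite (H1 N) ?(H2 N) ?(H3 N) ?act_win_linear // /N; lia.
Qed.

Lemma fock_act_lincomb a X Y v : gl_band X.1 -> gl_band Y.1 ->
  fock_act (dinf_lincomb a X Y) v = a *: fock_act X v + fock_act Y v.
Proof.
move=> [b bX] [c cY]; have [N vN] := ex_below v.
rewrite (fock_actE bX vN (M := (N + b + c).+1)); last lia.
rewrite (fock_actE cY vN (M := (N + b + c).+1)); last lia.
rewrite (@fock_actE N (b + c) _ _ _ vN (N + b + c).+1); last lia; last first.
  by move=> i j ij /=; rewrite bX ?cY ?mulr0 ?addr0 //; lia.
have -> : act_win (N + b + c).+1 (dinf_lincomb a X Y) v =
    2^-1 *: (a *: (\sum_(i <- win (N + b + c).+1)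
       \sum_(j <- win (N + b + c).+1) X.1 i j *: bilin i j v) +
       \sum_(i <- win (N + b + c).+1)
       \sum_(j <- win (N + b + c).+1) Y.1 i j *: bilin i j v) +
    ((a * X.2 + Y.2) * (l%:R + 2^-1)) *: v.
  rewrite /act_win; congr (_ *: _ + _).
  rewrite scaler_sumr -big_split; apply: eq_bigr => i _ /=.
  rewrite scaler_sumr -big_split; apply: eq_bigr => j _ /=.
  by rewrite scalerDl scalerA.
by rewrite /act_win !scalerDr mulrDl scalerDl !scalerA addrACA mulrA [2^-1 * a]mulrC.
Qed.

(* The action of gl_N truncated to a finite window and without normal ordering:
   there the bracket relation holds without a central term. *)
Definition quad_win N (A : zmat K) v : F := 2^-1 *: \sum_(i <- win N)
  \sum_(j <- win N) A i j *: \sum_a fmode F a i (fmode F (bar a) (1 - j) v).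

(** Undoing the normal ordering removes [2l+1] constants for each diagonal entry with [i <= 0]; the
    prefactor 1/2 turns this into [l + 1/2], the value of [C]. *)
Lemma act_winE N X v : act_win N X v = quad_win N X.1 v +
  ((X.2 - \sum_(i <- win N | i <= 0) X.1 i i) * (l%:R + 2^-1)) *: v.
Proof.
have H i : i \in win N -> \sum_(j <- win N) X.1 i j *: bilin i j v =
  \sum_(j <- win N) X.1 i j *: (\sum_a fmode F a i (fmode F (bar a) (1 - j) v)) -
  ((2 * l + 1)%:R * (if i <= 0 then X.1 i i else 0)) *: v.
  move=> iN; under eq_bigr do rewrite bilinE scalerBr.
  rewrite sumrB; congr (_ - _); rewrite (bigD1_seq i) ?win_uniq //= eqxx /=.
  rewrite big1 ?addr0; last first.
    by move=> j /negbTE; rewrite eq_sym => ->; rewrite mulr0 scale0r scaler0.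
  by case: ifP => _; rewrite ?mulr1 ?mulr0 ?scale0r ?scaler0 // scalerA mulrC.
rewrite /act_win /quad_win [in LHS]big_seq; under eq_bigr do rewrite H //.
rewrite -big_seq sumrB scalerBr -addrA; congr (_ + _).
rewrite -scaler_suml -mulr_sumr -big_mkcond /= scalerA -scaleNr -scalerDl.
by congr (_ *: _); rewrite natrD natrM; field.
Qed.

Lemma quad_win_linear N A : linear (quad_win N A).
Proof.
move=> c x y; rewrite /quad_win scalerA mulrC -scalerA -scalerDr; congr (_ *: _).
rewrite scaler_sumr -big_split; apply: eq_bigr => i _.
rewrite scaler_sumr -big_split; apply: eq_bigr => j _ /=.
rewrite scalerA mulrC -scalerA -scalerDr; congr (_ *: _).
rewrite scaler_sumr -big_split; apply: eq_bigr => a _ /=.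
by rewrite (linearP (fmode F (bar a) (1 - j))) (linearP (fmode F a i)).
Qed.

Lemma bilin_sum_u N A a (n : int) v : antisym A -> n \in win N ->
  \sum_(i <- win N) \sum_(j <- win N) A i j *: bilin i j (fmode F a n v) =
  fmode F a n (\sum_(i <- win N) \sum_(j <- win N) A i j *: bilin i j v) +
  2 *: \sum_(i <- win N) A i n *: fmode F a i v.
Proof.
move=> aA nN; have n'N : 1 - n \in win N by move: nN; rewrite !mem_win; lia.
have -> : 2 *: (\sum_(i <- win N) A i n *: fmode F a i v) =
    \sum_(i <- win N) \sum_(j <- win N) A i j *:
      ((j == n)%:R *: fmode F a i v - (i == 1 - n)%:R *: fmode F a (1 - j) v).
  under [RHS]eq_bigr => i _ do under eq_bigr => j _ do
    rewrite scalerBr !scalerA ![A i j * _]mulrC -!scalerA.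
  under [RHS]eq_bigr => i _ do rewrite sumrB sum_win_delta // -scaler_sumr.
  rewrite sumrB sum_win_delta // scaler_nat mulr2n; congr (_ + _).
  rewrite -sumrN [RHS]sum_win_refl; apply: eq_bigr => j _.
  by rewrite subKr [A j n]aA scaleNr.
rewrite linear_sum -big_split; apply: eq_bigr => i _ /=.
rewrite linear_sum -big_split; apply: eq_bigr => j _ /=.
rewrite linearZ_LR -scalerDr bilin_u [n == j]eq_sym.
by have -> : (i + n == 1) = (i == 1 - n) by lia.
Qed.

Lemma quad_win_bilin N A w : quad_win N A w =
  2^-1 *: (\sum_(i <- win N) \sum_(j <- win N) A i j *: bilin i j w)
  + ((\sum_(i <- win N | i <= 0) A i i) * (l%:R + 2^-1)) *: w.
Proof.
have := act_winE N (A, 0) w; rewrite /act_win mul0r scale0r addr0 /= => ->.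
by rewrite -addrA -scalerDl sub0r mulNr addNr scale0r addr0.
Qed.

Lemma quad_win_u N A a (n : int) v : antisym A -> n \in win N ->
  quad_win N A (fmode F a n v) = fmode F a n (quad_win N A v) +
    \sum_(i <- win N) A i n *: fmode F a i v.
Proof.
move=> aA nN; rewrite !quad_win_bilin bilin_sum_u // (linearD
  (fmode F a n)) !(linearZ_LR (fmode F a n)) /=.
by rewrite scalerDr scalerA mulVf ?pnatr_eq0 // scale1r addrAC.
Qed.

(** By [quad_win_u] the operator of [A] acts as a derivation on the two fermions of each term for
    [B]. Antisymmetry of [A] turns its action on the second one, of index [1 - j], into right
    multiplication. *)
Lemma quad_win_comm N A B v : antisym A -> antisym B ->
  quad_win N A (quad_win N B v) - quad_win N B (quad_win N A v) =
  quad_win N (fun i j => \sum_(k <- win N) (A i k * B k j - B i k * A k j)) v.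
Proof.
move=> aA aB; apply/eqP; rewrite subr_eq addrC; apply/eqP.
have linA := quad_win_linear N A.
rewrite [quad_win N B v]/quad_win (lfunZ linA) [quad_win N B _]/quad_win [X in _ =
  _ + X]/quad_win -scalerDr.
congr (_ *: _); rewrite (lfun_sum linA).
transitivity (\sum_(i <- win N) \sum_(j <- win N) B i j *: \sum_a
  (fmode F a i (fmode F (bar a) (1 - j) (quad_win N A v)) +
   (\sum_(k <- win N) A k i *: fmode F a k (fmode F (bar a) (1 - j) v)) -
   \sum_(k <- win N) A j k *: fmode F a i (fmode F (bar a) (1 - k) v))).
  rewrite big_seq [RHS]big_seq; apply: eq_bigr => i iN.
  rewrite (lfun_sum linA) big_seq [RHS]big_seq; apply: eq_bigr => j jN.
  rewrite (lfunZ linA) (lfun_sum linA); congr (_ *: _); apply: eq_bigr => a _.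
  have j'N : 1 - j \in win N by move: jN; rewrite !mem_win; lia.
  rewrite !quad_win_u // linearD addrAC; congr (_ + _ + _).
  rewrite sum_win_refl linear_sum -sumrN; apply: eq_bigr => k _ /=.
  by rewrite linearZ_LR /= [A j k]aA scaleNr opprK.
under eq_bigr => i _ do under eq_bigr => j _ do
  rewrite sumrB big_split /= scalerBr scalerDr.
under eq_bigr => i _ do rewrite sumrB big_split /=.
rewrite sumrB big_split /= -addrA; congr (_ + _).
pose t i j := \sum_a fmode F a i (fmode F (bar a) (1 - j) v).
under [RHS]eq_bigr => i _ do under eq_bigr => j _ do rewrite -/(t i j).
transitivity (\sum_(i <- win N) \sum_(j <- win N) \sum_(k <- win N)
  (A i k * B k j) *: t i j -
  \sum_(i <- win N) \sum_(j <- win N) \sum_(k <- win N) (B i k * A k j) *: t i j);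
    last first.
  rewrite -sumrB; apply: eq_bigr => i _; rewrite -sumrB; apply: eq_bigr => j _.
  by rewrite scaler_suml -sumrB; apply: eq_bigr => k _; rewrite scalerBl.
congr (_ - _).
  transitivity (\sum_(i <- win N) \sum_(j <- win N) \sum_(k <- win N)
    (A k i * B i j) *: t k j).
    apply: eq_bigr => i _; apply: eq_bigr => j _.
    rewrite exchange_big scaler_sumr; apply: eq_bigr => k _ /=.
    by rewrite -scaler_sumr scalerA mulrC.
  rewrite exchange_big [RHS]exchange_big; apply: eq_bigr => j _ /=.
  by rewrite exchange_big.
apply: eq_bigr => i _.
transitivity (\sum_(j <- win N) \sum_(k <- win N) (B i j * A j k) *: t i k).
  apply: eq_bigr => j _; rewrite exchange_big scaler_sumr; apply: eq_bigr => k _ /=.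
  by rewrite -scaler_sumr scalerA.
by rewrite exchange_big.
Qed.

Lemma fock_act_bracket X Y v : dinf X -> dinf Y ->
  fock_act (dinf_bracket X Y) v = fock_act X (fock_act Y v) - fock_act Y (fock_act X v).
Proof.
move=> dX dY; have dXY := dinf_comm (cocycle X.1 Y.1) dX dY.
have [[bx bX] aX] := dX; have [[by_ bY] aY] := dY.
have bXY := banded_comm bX bY.
have [N vN] := ex_below v; have [N1 XN1] := ex_below (fock_act X v).
have [N2 YN2] := ex_below (fock_act Y v).
pose M := (N + N1 + N2 + bx + by_ + 3)%N.
rewrite (fock_actE bX YN2 (M := M)) ?(fock_actE bY XN1 (M := M)); try by rewrite /M; lia.
rewrite (fock_actE bX vN (M := M)) ?(fock_actE bY vN (M := M)); try by rewrite /M; lia.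
rewrite (fock_actE (X := dinf_bracket X Y) bXY vN (M := M)); last by rewrite /M; lia.
rewrite !act_winE /=; set cX := (X.2 - _) * _; set cY := (Y.2 - _) * _.
have -> : quad_win M X.1 (quad_win M Y.1 v + cY *: v) + cX *: (quad_win M Y.1 v +
  cY *: v) -
    (quad_win M Y.1 (quad_win M X.1 v + cX *: v) + cY *: (quad_win M X.1 v + cX *: v)) =
    quad_win M X.1 (quad_win M Y.1 v) - quad_win M Y.1 (quad_win M X.1 v).
  rewrite !(lfunD (quad_win_linear _ _)) !(lfunZ
    (quad_win_linear _ _)) !scalerDr !scalerA.
  rewrite [cY * cX]mulrC.
  by rewrite [X in _ - X]addrACA opprD addrACA subrr addr0 opprD addrACA subrr addr0.
rewrite quad_win_comm // !quad_win_bilin -addrA -scalerDl; congr (_ *: _ + _ *: _).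
  rewrite big_seq [RHS]big_seq; apply: eq_bigr => i iM.
  rewrite big_seq [RHS]big_seq; apply: eq_bigr => j jM.
  (* The window commutator agrees with the true one except near the border. There [bilin i j] kills
     [v]; elsewhere the bands keep every contributing [k] inside the window. *)
  have [H|H] := boolP ((N%:Z < j) || (i <= - N%:Z)).
    by rewrite (bilin_eq0 vN H) !scaler0.
  congr (_ *: _); rewrite /zmat_comm !fctE sumrB /zmat_mul.
  congr (_ - _); apply: fsum_win => k; rewrite mem_win => kM.
    have [ik|ik] := ltnP bx `|i - k|; first by rewrite bX ?mul0r.
    by rewrite bY ?mulr0 //; lia.
  have [ik|ik] := ltnP by_ `|i - k|; first by rewrite bY ?mul0r.
  by rewrite bX ?mulr0 //; lia.
(* On the left, undoing and redoing the normal ordering cancel and leave the cocycle; on the right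
   stands the trace of the window commutator over [i <= 0]. *)
rewrite -mulrDl addrC subrK; congr (_ * _).
by apply: (cocycleE _ bX); rewrite /M; lia.
Qed.

End Fock.

(** * The operators of so(2l+1), the energy and alpha *)

Lemma fsum_seq (T : choiceType) (V : nmodType) (D : set T) (r : seq T) (f : T -> V) :
  uniq r -> {in r, forall i, D i} -> (forall i, D i -> i \notin r -> f i = 0) ->
  \sum_(i \in D) f i = \sum_(i <- r) f i.
Proof.
move=> ur rD f0; rewrite (fsbigE r) // big_seq_cond [RHS]big_seq; apply: eq_bigl => i.
by case ir : (i \in r) => //=; rewrite mem_set //; apply: rD.
Qed.

Section Module.
Variables (K : numFieldType) (l : nat) (F : fock_space K l).

(** A module needs a linear map for every pair [X], while [fock_act] is shown to be linear for
    banded matrices; zero is the default value elsewhere. *)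
Definition fock_dact (X : zmat K * K) : {linear F -> F} :=
  if pselect (gl_band X.1) is left bX then to_linear (fock_act_linear
    (F := F) bX) else \0.

Lemma fock_dactE X v : dinf X -> fock_dact X v = fock_act X v.
Proof. by rewrite /fock_dact => -[bX _]; case: pselect. Qed.

Lemma dinf_dinf_lincomb (a : K) X Y : dinf X -> dinf Y -> dinf (dinf_lincomb a X Y).
Proof.
move=> [[b bX] aX] [[c cY] aY]; split.
  by exists (b + c)%N => i j ij /=; rewrite bX ?cY ?mulr0 ?addr0 //; lia.
by move=> i j /=; rewrite aX aY mulrN opprD.
Qed.

Lemma fock_dact_linear (a : K) (X Y : zmat K * K) v : dinf X -> dinf Y ->
  fock_dact (dinf_lincomb a X Y) v = a *: fock_dact X v + fock_dact Y v.
Proof.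
move=> dX dY; rewrite !fock_dactE //; last exact: dinf_dinf_lincomb.
by apply: fock_act_lincomb; [case: dX|case: dY].
Qed.

Lemma fock_dact_bracket (X Y : zmat K * K) v : dinf X -> dinf Y ->
  fock_dact (dinf_bracket X Y) v =
  fock_dact X (fock_dact Y v) - fock_dact Y (fock_dact X v).
Proof.
move=> dX dY; rewrite !fock_dactE ?fock_act_bracket //; exact: dinf_comm.
Qed.

Definition fock_module : dinf_module K :=
  @DinfModule K F fock_dact fock_dact_linear fock_dact_bracket.

End Module.

Section Operators.
Variables (K : numFieldType) (l : nat) (F : fock_space K l).
Local Notation A := (option (bool * 'I_l)).
Local Notation u := (fmode F).
Local Notation bilin := (@bilin K l F).
Local Notation bar := (@bar l).
Implicit Types (a b e : A) (i j n : int) (v w : F) (X : zmat K * K).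

Definition nprod a b i v : F :=
  u a i (u (bar b) (1 - i) v) - ((a == b) && (i <= 0))%:R *: v.

Lemma nprod_swap a b i v : i <= 0 -> nprod a b i v = - u (bar b) (1 - i) (u a i v).
Proof.
move=> i0; rewrite /nprod uuC i0 andbT bar_eq barK eq_sym.
have -> : (i + (1 - i) == 1) by lia.
by rewrite andbT addrAC subrr add0r.
Qed.

Lemma nprod_eq0 N a b i v : below N v -> i \notin win N -> nprod a b i v = 0.
Proof.
move=> vN; rewrite mem_win => iN; have [i0|i0] := leP i 0.
  by rewrite nprod_swap // vN ?linear0 ?oppr0 //; lia.
rewrite /nprod vN ?linear0; last lia.
have -> : (i <= 0) = false by lia.
by rewrite andbF scale0r subr0.
Qed.

(** The image of [E_(a,b) - E_(bar b,bar a)] acting on the species: the counterpart of [bilin] with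
    the roles of species and modes exchanged. *)
Definition so_op a b v : F := \sum_(i \in [set: int]) nprod a b i v.

Lemma so_opE N a b v : below N v -> forall M, (N <= M)%N ->
  so_op a b v = \sum_(i <- win M) nprod a b i v.
Proof.
by move=> vN M NM; apply: fsum_win => i iM; apply: nprod_eq0 (below_le NM vN) iM.
Qed.

Lemma ex_so_op a b v : exists N, forall M, (N <= M)%N ->
  so_op a b v = \sum_(i <- win M) nprod a b i v.
Proof. by have [N vN] := ex_below v; exists N; apply: so_opE. Qed.

Lemma nprod_linear a b i : linear (nprod a b i).
Proof.
move=> c x y; rewrite /nprod (linearP (u (bar b) (1 - i))) (linearP (u a i)).
by rewrite scalerBr scalerDr opprD !scalerA [c * _]mulrC addrACA.
Qed.

Lemma so_op_linear a b : linear (so_op a b).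
Proof.
move=> c x y; have [N1 H1] := ex_so_op a b x; have [N2 H2] := ex_so_op a b y.
have [N3 H3] := ex_so_op a b (c *: x + y).
rewrite (H1 (N1 + N2 + N3)%N) ?(H2 (N1 + N2 + N3)%N) ?(H3 (N1 + N2 + N3)%N); try lia.
rewrite scaler_sumr -big_split; apply: eq_bigr => i _; exact: nprod_linear.
Qed.

Lemma nprod_u a b e i j v : nprod a b i (u e j v) = u e j (nprod a b i v) +
  ((i == j)%:R *: ((e == b)%:R *: u a j v) -
   (i == 1 - j)%:R *: ((e == bar a)%:R *: u (bar b) j v)).
Proof.
rewrite /nprod linearB uZ /= [RHS]addrAC; congr (_ - _).
rewrite (uuC (bar b) e) linearB uZ /= barK (uuC a e _ j) opprB.
rewrite addrCA; congr (_ + _); rewrite !scalerA -!natrM !mulnb.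
have -> : (1 - i + j == 1) = (i == j) by lia.
have -> : (i + j == 1) = (i == 1 - j) by lia.
rewrite [_ && (i == j)]andbC [_ && (i == 1 - j)]andbC; congr (_ - _).
  by case: eqP => [->|] //=; rewrite !scale0r.
by case: eqP => [->|] //=; rewrite ?scale0r // subKr.
Qed.

Lemma so_op_u a b e j v : so_op a b (u e j v) = u e j (so_op a b v) +
  ((e == b)%:R *: u a j v - (e == bar a)%:R *: u (bar b) j v).
Proof.
have [N1 H1] := ex_so_op a b v; have [N2 H2] := ex_so_op a b (u e j v).
pose M := (N1 + N2 + `|j| + 2)%N.
rewrite (H1 M) ?(H2 M); try by rewrite /M; lia.
rewrite linear_sum; under eq_bigr do rewrite nprod_u.
rewrite big_split sumrB /=; congr (_ + (_ - _)); apply: sum_win_delta.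
  by rewrite mem_win /M; lia.
by rewrite mem_win /M; lia.
Qed.

(** [bilin] contracts the species with the form preserved by so(2l+1). Of the four commutator terms,
    [A1] cancels with [A4] and [A2] with [A3]. *)
Lemma so_op_bilin a b i j v : so_op a b (bilin i j v) = bilin i j (so_op a b v).
Proof.
have lX := so_op_linear a b.
rewrite !bilinE (lfunB lX) (lfunZ lX) (lfun_sum lX); congr (_ - _).
under eq_bigr => e _ do rewrite so_op_u so_op_u linearD linearB !uZ /= -addrA.
rewrite big_split /= -[RHS]addr0; congr (_ + _).
pose A1 e := (e == b)%:R *: u a i (u (bar e) (1 - j) v).
pose A2 e := (e == bar a)%:R *: u (bar b) i (u (bar e) (1 - j) v).
pose A3 e := (bar e == b)%:R *: u e i (u a (1 - j) v).
pose A4 e := (bar e == bar a)%:R *: u e i (u (bar b) (1 - j) v).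
transitivity (\sum_e ((A3 e - A4 e) + (A1 e - A2 e))); first by [].
have D (f : A -> F) c : \sum_e (e == c)%:R *: f e = f c.
  rewrite (bigD1 c) //= eqxx scale1r big1 ?addr0 // => e /negbTE ->.
  by rewrite scale0r.
rewrite big_split !sumrB /= /A1 /A2 /A3 /A4.
under [X in X - _ + _]eq_bigr do rewrite bar_eq.
under [X in _ - X + _]eq_bigr do rewrite bar_eq barK.
by rewrite !D barK addrC subrKA subrr.
Qed.

Lemma so_op_fock_act a b X v : gl_band X.1 -> so_op a b (fock_act X v) =
  fock_act X (so_op a b v).
Proof.
move=> bX; have lX := so_op_linear a b.
have [N1 H1] := ex_act_win v bX; have [N2 H2] := ex_act_win (so_op a b v) bX.
pose M := (N1 + N2).+1.
rewrite (H1 M) ?(H2 M); try by rewrite /M; lia.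
rewrite /act_win (lfunD lX) !(lfunZ lX) (lfun_sum lX); congr (_ *: _ + _).
apply: eq_bigr => i _; rewrite (lfun_sum lX); apply: eq_bigr => j _.
by rewrite (lfunZ lX) so_op_bilin.
Qed.

Lemma nord_nprod a b (f g : int -> F -> F) n v :
  (forall m w, f m w = u a (- m) w) -> (forall m w, g m w = u (bar b) (- m) w) ->
  nord f g n (hopp n) v = nprod a b (- n) v.
Proof.
have E : - (- n - 1) = 1 - - n by lia.
move=> fE gE; rewrite /nord /hopp fE !gE E; have [n0|n0] := leP 0 n.
  by rewrite nprod_swap ?oppr_le0 // fE.
rewrite fE /nprod.
have -> : (- n <= 0) = false by lia.
by rewrite andbF scale0r subr0.
Qed.

Lemma nord_sum_so_op a b (f g : int -> F -> F) v :
  (forall m w, f m w = u a (- m) w) -> (forall m w, g m w = u (bar b) (- m) w) ->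
  nord_sum f g v = so_op a b v.
Proof.
move=> fE gE; have [N vN] := ex_below v; rewrite (so_opE _ _ vN (leqnn N)).
rewrite /nord_sum (@fsum_seq _ _ _ [seq - i | i <- win N]).
- rewrite big_map; apply: eq_bigr => i _.
  by rewrite (nord_nprod (a := a) (b := b)) // opprK.
- by rewrite map_inj_uniq ?win_uniq //; apply: oppr_inj.
- by [].
move=> n _ nN; rewrite (nord_nprod (a := a) (b := b)) //.
apply: nprod_eq0 vN _; apply: contraNN nN => nN.
by apply/mapP; exists (- n); rewrite ?opprK.
Qed.

Lemma so_eE p q v : so_e p q v = so_op (Some (true, p)) (Some (true, q)) v.
Proof. by apply: nord_sum_so_op => m w /=; rewrite opprK. Qed.

Lemma so_e2E p q v : so_e2 true p q v = so_op (Some (true, p)) (Some (false, q)) v.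
Proof. by apply: nord_sum_so_op => m w /=; rewrite opprK. Qed.

Lemma so_e1E p v : so_e1 true p v = so_op (Some (true, p)) None v.
Proof. by apply: nord_sum_so_op => m w /=; rewrite opprK. Qed.

Lemma sum_species (V : nmodType) (f : A -> V) :
  \sum_a f a = f None + \sum_p (f (Some (true, p)) + f (Some (false, p))).
Proof.
rewrite (bigD1 None) //=; congr (_ + _).
rewrite (reindex_omap Some id) /=; last by case.
rewrite (eq_bigl xpredT) => [|x]; last by rewrite eqxx.
transitivity (\sum_(s : bool) \sum_(p < l) f (Some (s, p))).
  by rewrite pair_bigA; apply: eq_bigr => -[].
by rewrite big_bool big_split.
Qed.

Lemma fock_act_u N d X a n v : banded d X.1 -> antisym X.1 -> below N v ->
  forall M, (N + d + `|n| + 2 <= M)%N ->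
  fock_act X (u a n v) = u a n (fock_act X v) + \sum_(i <- win M) X.1 i n *: u a i v.
Proof.
move=> bX aX vN M NM; have nM : n \in win M by rewrite mem_win; lia.
have vM : below (N + `|n| + 1) (u a n v).
  move=> e i iN; rewrite uuC vN ?linear0; last lia.
  have -> : (i + n == 1) = false by lia.
  by rewrite andbF scale0r addr0.
rewrite (fock_actE bX vM (M := M)) ?(fock_actE bX vN (M := M)); try lia.
rewrite /act_win bilin_sum_u // scalerDr scalerA mulVf ?pnatr_eq0 // scale1r.
by rewrite linearD !uZ /= addrAC.
Qed.

Lemma fock_act_diag_u X a n v : dinf_cartan X ->
  fock_act X (u a n v) = u a n (fock_act X v) + X.1 n n *: u a n v.
Proof.
move=> [[[b bX] aX] dX]; have [N vN] := ex_below v.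
rewrite (fock_act_u a bX aX vN (leqnn _)); congr (_ + _).
rewrite (bigD1_seq n) ?win_uniq ?mem_win //=; last lia.
by rewrite big1 ?addr0 // => i /dX ->; rewrite scale0r.
Qed.

Lemma bilin_diag i v : bilin i i v = \sum_a nprod a a i v.
Proof. by apply: eq_bigr => a _; rewrite /nprod !eqxx. Qed.

Lemma fock_act_diag_vac X : dinf_cartan X ->
  fock_act X (vac F) = (X.2 * (l%:R + 2^-1)) *: vac F.
Proof.
move=> [[[b bX] aX] dX].
have v0 : below 0 (vac F) by move=> a i i0; apply: u_vac; lia.
rewrite (fock_actE bX v0 (M := b.+1)) // /act_win big1 ?scaler0 ?add0r // => i _.
apply: big1 => j _; have [->|/dX ->] := eqVneq i j; last by rewrite scale0r.
by rewrite bilin_diag big1 ?scaler0 // => a _; apply: nprod_eq0 v0 _.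
Qed.

Lemma denergy_cartan : dinf_cartan (denergy K).
Proof.
split; first split.
- by exists 0%N => i j ij /=; case: eqP => // E; move: ij; rewrite E; lia.
- move=> i j /=; rewrite [1 - j == _](_ : _ = (i == j)); last by lia.
  case: eqP => [->|]; rewrite ?oppr0 //.
  by rewrite opprB rmorphB /=; field.
- by move=> i j /= /negbTE ->.
Qed.

Lemma nprod_opp a b i v : nprod (bar b) (bar a) (1 - i) v = - nprod a b i v.
Proof.
rewrite /nprod !barK subKr uuC barK (inj_eq (inv_inj (@barK l))) opprB addrAC -scalerBl.
rewrite [b == a]eq_sym; congr (_ *: v - _).
have -> : (1 - i + i == 1) by lia.
have -> : (1 - i <= 0) = (0 < i) by lia.
by case: eqP; case: ltP; rewrite ?subrr ?subr0.
Qed.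

Lemma hoppK : involutive hopp. Proof. by move=> n; rewrite /hopp; lia. Qed.

Lemma phi_nprod k v :
  phi F (hopp (Posz k)) (phi F (Posz k) v) = nprod None None (Posz k.+1) v.
Proof.
rewrite /nprod /= scale0r subr0 -[hopp _]/(- Posz k - 1).
by congr (phi F _ (phi F _ v)); lia.
Qed.

(** In the sum over all species and modes each term of the energy appears twice: the coefficient and
    the normally ordered product both change sign under [i -> 1 - i] with [a -> bar a]. This pairs
    [psi^+] with [psi^-], and for [phi] the creation modes with the annihilation modes; the factor
    1/2 compensates. *)
Lemma fock_L0E v : fock_L0 v = fock_act (denergy K) v.
Proof.
have [N vN] := ex_below v; have [[_ _] dE] := denergy_cartan.
have b0 : banded 0 (denergy K).1.
  by move=> i j ij /=; case: eqP => // E; move: ij; rewrite E; lia.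
have NM : (N + 0 < N.+1)%N by lia.
rewrite (fock_actE b0 vN NM) /act_win mul0r scale0r addr0.
have vM := below_le (leqnSn N) vN; move: (N.+1) vM => M vM {NM vN}.
pose c (i : int) : K := i%:~R - 2^-1.
transitivity (2^-1 *: \sum_a \sum_(i <- win M) c i *: nprod a a i v); last first.
  rewrite exchange_big /= big_seq [in RHS]big_seq; congr (_ *: _).
  apply: eq_bigr => i iM; rewrite (bigD1_seq i) ?win_uniq //= eqxx bilin_diag.
  rewrite scaler_sumr [X in _ = _ + X]big1 ?addr0 // => j /negbTE.
  by rewrite eq_sym => ->; rewrite scale0r.
pose f a := \sum_(i <- win M) c i *: nprod a a i v.
have f_bar a : f (bar a) = f a.
  rewrite /f sum_win_refl; apply: eq_bigr => i _.
  rewrite nprod_opp scalerN -scaleNr; congr (_ *: _).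
  by rewrite /c rmorphB /=; field.
have f_None : f None = 2 *: \sum_(k < M) hval K (Posz k) *: nprod None None (Posz k.+1) v.
  rewrite /f sum_winE scaler_sumr; apply: eq_bigr => k _.
  have -> : nprod None None (- Posz k) v = - nprod None None (Posz k.+1) v.
    by rewrite -[in RHS](nprod_opp None None) /=; congr nprod; lia.
  rewrite scalerN -scaleNr -scalerDl scalerA; congr (_ *: _).
  by rewrite /c /hval intS rmorphN rmorphD /=; field.
rewrite -[\sum_a _]/(\sum_a f a) sum_species scalerDr addrC f_None.
rewrite scalerA mulVf ?pnatr_eq0 // scale1r /fock_L0; congr (_ + _).
  under [in RHS]eq_bigr => p _ do rewrite (f_bar (Some (true, p))) -mulr2n -scaler_nat.
  rewrite -scaler_sumr scalerA mulVf ?pnatr_eq0 // scale1r; apply: eq_bigr => p _.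
  have nE n : nord (psi F true p) (psi F false p) (hopp n) n v =
      nprod (Some (true, p)) (Some (true, p)) (n + 1) v.
    have := @nord_nprod (Some (true, p)) (Some (true, p))
      (psi F true p) (psi F false p) (hopp n) v.
    rewrite hoppK => ->; try by move=> m w /=; rewrite opprK.
    by congr nprod; rewrite /hopp; lia.
  rewrite (@fsum_seq _ _ _ [seq i - 1 | i <- win M]) ?map_inj_uniq ?win_uniq //.
  - rewrite big_map; apply: eq_bigr => i _; rewrite nE subrK; congr (_ *: _).
    by rewrite /hval /c rmorphB /=; field.
  - exact: addIr.
  move=> n _ nM; rewrite nE (@nprod_eq0 M) ?scaler0 //.
  by apply: contraNN nM => nM; apply/mapP; exists (n + 1); rewrite ?addrK.
rewrite (@fsum_seq _ _ _ [seq Posz k | k <- iota 0 M]) ?map_inj_uniq ?iota_uniq //.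
- rewrite big_map -(big_mkord xpredT (fun k => hval K k *:
    nprod None None (Posz k.+1) v)).
  by rewrite /index_iota subn0; apply: eq_bigr => k _; rewrite phi_nprod.
- by move=> x y [].
- by move=> n /mapP[k _ ->].
move=> [k|//] _ kM; rewrite phi_nprod (@nprod_eq0 M) ?scaler0 //.
apply: contraNN kM; rewrite mem_win => kM; apply/mapP; exists k => //.
by rewrite mem_iota; lia.
Qed.

Lemma fock_alphaE N v : below N v ->
  fock_alpha v = \sum_(k < N) nprod None None (Posz k.+1) v.
Proof.
move=> vN; rewrite /fock_alpha.
rewrite (@fsum_seq _ _ _ [seq Posz k | k <- iota 0 N]) ?map_inj_uniq ?iota_uniq //.
- rewrite big_map -(big_mkord xpredT (fun k => nprod None None (Posz k.+1) v)).
  by rewrite /index_iota subn0; apply: eq_bigr => k _; rewrite phi_nprod.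
- by move=> x y [].
- by move=> n /mapP[k _ ->].
move=> [k|//] _ kN; rewrite phi_nprod (@nprod_eq0 N) ?scaler0 //.
apply: contraNN kN; rewrite mem_win => kN; apply/mapP; exists k => //.
by rewrite mem_iota; lia.
Qed.

Lemma fock_alpha_linear : linear (@fock_alpha K l F).
Proof.
move=> c x y; have [N1 xN] := ex_below x; have [N2 yN] := ex_below y.
have [N3 zN] := ex_below (c *: x + y).
have H w N : below N w -> (N <= N1 + N2 + N3)%N ->
    fock_alpha w = \sum_(k < N1 + N2 + N3) nprod None None (Posz k.+1) w.
  by move=> wN NN; apply: fock_alphaE (below_le NN wN).
rewrite (H _ _ xN) ?(H _ _ yN) ?(H _ _ zN); try lia.
rewrite scaler_sumr -big_split; apply: eq_bigr => k _; exact: nprod_linear.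
Qed.

Lemma fock_alpha_u a j v : 0 < j ->
  fock_alpha (u a j v) = u a j (fock_alpha v) + (a == None)%:R *: u a j v.
Proof.
move=> j0; have [N1 vN] := ex_below v; have [N2 jN] := ex_below (u a j v).
pose M := (N1 + N2 + `|j|)%N.
rewrite (@fock_alphaE M v); last by apply: below_le vN; rewrite /M; lia.
rewrite (@fock_alphaE M); last by apply: below_le jN; rewrite /M; lia.
rewrite linear_sum; under eq_bigr do rewrite nprod_u.
rewrite big_split /=; congr (_ + _).
have jM : (`|j|.-1 < M)%N by rewrite /M; lia.
rewrite (bigD1 (Ordinal jM)) //= big1 ?addr0; last first.
  move=> k; rewrite -val_eqE /= => kj.
  have -> : (Posz k.+1 == j) = false by lia.
  have -> : (Posz k.+1 == 1 - j) = false by lia.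
  by rewrite !scale0r subrr.
have -> : (Posz `|j|.-1.+1 == j) by lia.
have -> : (Posz `|j|.-1.+1 == 1 - j) = false by lia.
rewrite scale1r scale0r subr0; by case: eqP => [->|]; rewrite ?scale0r.
Qed.

End Operators.

(** * Monomials *)

Lemma sum_by_value (V : nmodType) (I : eqType) (r : seq I) (g : I -> nat) (f : I -> V) N :
  {in r, forall i, (g i < N)%N} ->
  \sum_(i <- r) f i = \sum_(m < N) \sum_(i <- r | g i == m) f i.
Proof.
move=> gN; rewrite (exchange_big_dep xpredT) //= big_seq [RHS]big_seq.
apply: eq_bigr => i ir; by rewrite (big_pred1 (Ordinal (gN i ir))).
Qed.

Lemma ex_value_bound (I : eqType) (r : seq I) (g : I -> nat) :
  exists N, {in r, forall i, (g i < N)%N}.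
Proof.
exists (\max_(i <- r) g i).+1 => i ir; rewrite ltnS.
exact: (leq_bigmax_seq i).
Qed.

Section Monomials.
Variables (K : numFieldType) (l : nat) (F : fock_space K l).
Local Notation A := (option (bool * 'I_l)).
Local Notation mode := (A * nat)%type.
Local Notation u := (fmode F).
Local Notation bilin := (@bilin K l F).
Local Notation so_op := (@so_op K l F).
Local Notation bar := (@bar l).
Implicit Types (a b e : A) (i j : int) (v w : F) (X : zmat K * K) (x : mode)
  (s t : seq mode).

Definition cr x : {linear F -> F} := u x.1 (Posz x.2.+1).
Definition an x : {linear F -> F} := u (bar x.1) (- Posz x.2).

Lemma an_cr x y v : an x (cr y v) = (x == y)%:R *: v - cr y (an x v).
Proof.
rewrite /an /cr uuC barK; case: x y => a k [b m] /=.
have -> : (- Posz k + Posz m.+1 == 1) = (k == m) by lia.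
by rewrite xpair_eqE eq_sym.
Qed.

Lemma cr_cr x y v : cr x (cr y v) = - cr y (cr x v).
Proof.
rewrite /cr uuC; have -> : (Posz x.2.+1 + Posz y.2.+1 == 1) = false by lia.
by rewrite andbF scale0r sub0r.
Qed.

Lemma an_an x y v : an x (an y v) = - an y (an x v).
Proof.
rewrite /an uuC; have -> : (- Posz x.2 + - Posz y.2 == 1) = false by lia.
by rewrite andbF scale0r sub0r.
Qed.

Lemma cr_crxx x v : cr x (cr x v) = 0.
Proof.
have /eqP := cr_cr x x v; rewrite -subr_eq0 opprK -mulr2n -scaler_nat.
by rewrite scaler_eq0 pnatr_eq0 => /eqP.
Qed.

Definition mono s : F := foldr cr (vac F) s.

Lemma an_vac x : an x (vac F) = 0. Proof. by apply: u_vac; lia. Qed.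

Lemma an_mono_notin x s : x \notin s -> an x (mono s) = 0.
Proof.
elim: s => [|y s IH] /=; first by rewrite an_vac.
rewrite inE negb_or => /andP[/negbTE xy xs].
by rewrite an_cr xy IH // (linear0 (cr y)) scale0r subr0.
Qed.

Lemma mono_neq0 s : uniq s -> mono s != 0.
Proof.
elim: s => [_|x s IH /= /andP[xs us]]; first exact: vac_neq0.
apply: contraNneq (IH us) => s0; have := congr1 (an x) s0.
by rewrite an_cr eqxx scale1r an_mono_notin // (linear0 (cr x)) (linear0
  (an x)) subr0 => ->.
Qed.

Lemma cr_mono_in x s : x \in s -> cr x (mono s) = 0.
Proof.
elim: s => // y s IH; rewrite inE /= => /orP[/eqP ->|xs]; first exact: cr_crxx.
by rewrite cr_cr IH // (linear0 (cr y)) oppr0.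
Qed.

Lemma mono_not_uniq s : ~~ uniq s -> mono s = 0.
Proof.
elim: s => // x s IH /=; rewrite negb_and negbK => /orP[/cr_mono_in //|/IH ->].
by rewrite linear0.
Qed.

Lemma foldr_cr s x v : foldr cr (cr x v) s = (-1) ^+ size s *: cr x (foldr cr v s).
Proof.
elim: s => [|y s IH] /=; first by rewrite scale1r.
by rewrite IH (linearZ_LR (cr y)) cr_cr scalerN exprS mulN1r scaleNr.
Qed.

Lemma foldr_cr_swap s t v : foldr cr (foldr cr v t) s =
  (-1) ^+ (size s * size t) *: foldr cr (foldr cr v s) t.
Proof.
elim: t => [|x t IH] /=; first by rewrite muln0 scale1r.
by rewrite foldr_cr IH (linearZ_LR (cr x)) scalerA mulnS exprD.
Qed.

(** [catCA_perm_ind] reduces a permutation to exchanges of adjacent blocks, each of which costs a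
    sign. *)
Lemma mono_perm s t : perm_eq s t -> exists c : K, mono s = c *: mono t.
Proof.
move=> st; apply: (catCA_perm_ind (P := fun s => exists c : K, mono s = c *: mono t) _
  (s1 := t) (s2 := s)).
- move=> s1 s2 s3 [c E]; exists ((-1) ^+ (size s2 * size s1) * c).
  rewrite -scalerA -E /mono !foldr_cat.
  by rewrite foldr_cr_swap.
- by rewrite perm_sym.
- by exists 1; rewrite scale1r.
Qed.

(** Repeated and proportional monomials are allowed. They are told apart only by eigenvalues, by
    means of [eigen_sieve]. *)
Definition spanned (P : pred (seq mode)) : set F := [set v |
  exists L : seq (K * seq mode), all (fun y => P y.2) L /\
    v = \sum_(y <- L) y.1 *: mono y.2].

Lemma spanned_subspace (P : pred (seq mode)) : subspace (spanned P).
Proof.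
split; first by exists [::]; rewrite big_nil.
move=> c _ _ [L1 [P1 ->]] [L2 [P2 ->]].
exists ([seq (c * y.1, y.2) | y <- L1] ++ L2); split.
  by rewrite all_cat P2 andbT all_map.
rewrite big_cat big_map scaler_sumr; congr (_ + _).
by apply: eq_bigr => y _; rewrite scalerA.
Qed.

Lemma spanned_mono (P : pred (seq mode)) s : P s -> spanned P (mono s).
Proof.
by move=> Ps; exists [:: (1, s)]; rewrite /= Ps big_seq1 scale1r.
Qed.

Lemma spannedT v : spanned (fun s => uniq s) v.
Proof.
suff E : spanned xpredT = setT.
  have : [set: F] v by [].
  rewrite -E => -[L [_ ->]].
  apply: (subspace_sumT (spanned_subspace _)) => y.
  apply: (subspaceZ (spanned_subspace _)).
  have [us|nus] := boolP (uniq y.2); first exact: spanned_mono.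
  by rewrite mono_not_uniq //; exact: (spanned_subspace _).1.
have sT := spanned_subspace xpredT.
have cr_sp x v' : spanned xpredT v' -> spanned xpredT (cr x v').
  move=> [L [_ ->]]; rewrite linear_sum; apply: (subspace_sumT sT) => y.
  by rewrite linearZ_LR; apply: (subspaceZ sT); apply: (@spanned_mono _ (x :: y.2)).
have an_sp x s : spanned xpredT (an x (mono s)).
  elim: s => [|y s IH] /=; first by rewrite an_vac; exact: sT.1.
  rewrite an_cr; apply: (subspaceB sT); last exact: cr_sp.
  by apply: (subspaceZ sT); apply: spanned_mono.
apply: u_generates => //; first exact: (@spanned_mono _ [::]).
move=> a i v' v'S; have [i0|i0] := leP i 0.
  have -> : u a i = an (bar a, `|i|%N) by rewrite /an /= barK; congr u; lia.
  case: v'S => L [_ ->]; rewrite linear_sum; apply: (subspace_sumT sT) => y.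
  by rewrite linearZ_LR; apply: (subspaceZ sT).
have -> : u a i = cr (a, `|i|.-1%N) by rewrite /cr /=; congr u; lia.
exact: cr_sp.
Qed.

Lemma spanned_sieve (P : pred (seq mode)) (T : F -> F) (tau : seq mode ->
  K) c v : linear T ->
  (forall s, P s -> T (mono s) = tau s *: mono s) -> T v = c *: v ->
  spanned P v -> spanned (fun s => P s && (tau s == c)) v.
Proof.
move=> linT Tm Tv [L [PL vE]].
exists [seq y <- L | tau y.2 == c]; split.
  apply/allP => y; rewrite mem_filter => /andP[yc yL].
  by rewrite yc andbT (allP PL).
rewrite big_filter; apply: (eigen_sieve (tau := fun y => tau y.2) linT _ vE Tv).
by move=> y yL; rewrite (lfunZ linT) Tm ?(allP PL) // !scalerA mulrC.
Qed.

Lemma spanned_sub (P Q : pred (seq mode)) v : (forall s, P s -> Q s) ->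
  spanned P v -> spanned Q v.
Proof.
by move=> PQ [L [PL ->]]; exists L; split => //; apply/allP => y /(allP PL) /PQ.
Qed.

End Monomials.

(** * Eigenvalues on monomials and the operator (-1)^alpha *)

Section Eigenvalues.
Variables (K : numFieldType) (l : nat) (F : fock_space K l).
Local Notation A := (option (bool * 'I_l)).
Local Notation mode := (A * nat)%type.
Local Notation u := (fmode F).
Local Notation bilin := (@bilin K l F).
Local Notation so_op := (@so_op K l F).
Local Notation bar := (@bar l).
Local Notation cr := (cr F).
Local Notation an := (an F).
Local Notation mono := (mono F).
Implicit Types (a b e : A) (i j : int) (v w : F) (X : zmat K * K) (x : mode)
  (s t : seq mode).

Lemma below_vac : below 0 (vac F).
Proof. by move=> a i i0; apply: u_vac; lia. Qed.

Lemma fock_act_diag_mono X s : dinf_cartan X -> fock_act X (mono s) =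
  (\sum_(x <- s) X.1 (Posz x.2.+1) (Posz x.2.+1) + X.2 * (l%:R + 2^-1)) *: mono s.
Proof.
move=> cX; elim: s => [|x s IH] /=; first by rewrite big_nil add0r fock_act_diag_vac.
rewrite fock_act_diag_u // IH (linearZ_LR (u x.1 _)) -scalerDl big_cons.
by rewrite addrC addrA.
Qed.

Definition energy2 s : nat := (\sum_(x <- s) (2 * x.2 + 1))%N.

Lemma fock_L0_mono s : fock_L0 (mono s) = ((energy2 s)%:R / 2) *: mono s.
Proof.
rewrite fock_L0E fock_act_diag_mono; last exact: denergy_cartan.
congr (_ *: _); rewrite /= mul0r addr0 /energy2 natr_sum mulr_suml.
apply: eq_bigr => x _; rewrite eqxx natrD natrM intS rmorphD /=.
by rewrite -[x.2%:~R]/(x.2%:R); field.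
Qed.

Definition phi_count s := count (fun x => x.1 == None) s.

Lemma fock_alpha_mono s : fock_alpha (mono s) = (phi_count s)%:R *: mono s.
Proof.
elim: s => [|x s IH] /=; first by rewrite (fock_alphaE below_vac) big_ord0 scale0r.
rewrite fock_alpha_u // IH (linearZ_LR (u x.1 _)) -scalerDl -natrD /phi_count /=.
by rewrite addnC.
Qed.

Lemma so_op_vac a b : so_op a b (vac F) = 0.
Proof. by rewrite (so_opE _ _ below_vac (leqnn _)) big_nil. Qed.

Lemma so_op_diag_mono a s : so_op a a (mono s) =
  ((count (fun x => x.1 == a) s)%:R - (count (fun x => x.1 == bar a) s)%:R) *: mono s.
Proof.
elim: s => [|x s IH] /=; first by rewrite so_op_vac subrr scale0r.
rewrite so_op_u IH (linearZ_LR (u x.1 _)).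
have -> : (x.1 == a)%:R *: u a (Posz x.2.+1) (mono s) = (x.1 == a)%:R *: cr x (mono s).
  by rewrite /cr; case: eqP => [->|]; rewrite ?scale0r.
have -> : (x.1 == bar a)%:R *: u (bar a) (Posz x.2.+1) (mono s) =
    (x.1 == bar a)%:R *: cr x (mono s).
  by rewrite /cr; case: eqP => [->|]; rewrite ?scale0r.
rewrite -scalerBl -scalerDl !natrD; congr (_ *: _); ring.
Qed.

Lemma fock_L0_linear : linear (@fock_L0 K l F).
Proof.
have [[b _] _] := denergy_cartan K.
by move=> c x y; rewrite !fock_L0E fock_act_linear.
Qed.

(* (-1)^alpha exists: its value at a combination of monomials does not depend on
   the combination, since the alpha-components of a vector do not. *)
Definition sgn_rel v w := exists L : seq (K * seq mode),
  v = \sum_(y <- L) y.1 *: mono y.2 /\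
  w = \sum_(y <- L) (-1) ^+ phi_count y.2 *: (y.1 *: mono y.2).

Lemma sgn_rel_linear c v w v' w' : sgn_rel v w -> sgn_rel v' w' ->
  sgn_rel (c *: v + v') (c *: w + w').
Proof.
move=> [L1 [-> ->]] [L2 [-> ->]]; exists ([seq (c * y.1, y.2) | y <- L1] ++ L2).
rewrite !big_cat !big_map !scaler_sumr; split; congr (_ + _).
  by apply: eq_bigr => y _; rewrite scalerA.
by apply: eq_bigr => y _; rewrite /= !scalerA; congr (_ *: _); ring.
Qed.

(** The monomials of the combination may have several values of alpha, but by [eigen_sieve_all] the
    part of value [p] is [v] for [p = m] and 0 otherwise. *)
Lemma sgn_rel_eigen v w m : fock_alpha v = m%:R *: v -> sgn_rel v w ->
  w = (-1) ^+ m *: v.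
Proof.
move=> av [L [vE ->]]; have [N LN] := ex_value_bound L (fun y => phi_count y.2).
have eigL y : y \in L ->
    fock_alpha (y.1 *: mono y.2) = (phi_count y.2)%:R *: (y.1 *: mono y.2).
  move=> _; rewrite (lfunZ (@fock_alpha_linear K l F)) fock_alpha_mono.
  by rewrite !scalerA mulrC.
have comp p : \sum_(y <- L | phi_count y.2 == p) y.1 *: mono y.2 = (p == m)%:R *: v.
  rewrite -(eqr_nat K) -(eigen_sieve_all (@fock_alpha_linear K l F) _ eigL vE av).
  by apply: eq_bigl => y; rewrite eqr_nat.
have LN' : {in L, forall y, (phi_count y.2 < N + m.+1)%N}.
  by move=> y /LN yN; apply: ltn_addr.
have mN : (m < N + m.+1)%N by rewrite addnS ltnS leq_addl.
rewrite (sum_by_value _ LN') (bigD1 (Ordinal mN)) //= [X in _ + X]big1 ?addr0.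
  under eq_bigr => y /eqP -> do [].
  by rewrite -scaler_sumr comp eqxx scale1r.
move=> p; rewrite -val_eqE /= => /negbTE pm; under eq_bigr => y /eqP -> do [].
by rewrite -scaler_sumr comp pm scale0r scaler0.
Qed.

Lemma ex_sgn_rel v : exists w, sgn_rel v w.
Proof.
have [L [_ ->]] := spannedT v.
by exists (\sum_(y <- L) (-1) ^+ phi_count y.2 *: (y.1 *: mono y.2)), L.
Qed.

Lemma sgn_rel_uniq v w w' : sgn_rel v w -> sgn_rel v w' -> w = w'.
Proof.
move=> vw vw'; apply/eqP; rewrite -subr_eq0.
have := sgn_rel_linear (-1) vw' vw; rewrite !scaleN1r addNr addrC.
(* The difference is related to the vector 0, which satisfies the eigenvector equation of alpha for
   the eigenvalue 0. *)
move=> /(@sgn_rel_eigen 0 _ 0%N) ->; first by rewrite scaler0.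
by rewrite (lfun0 (@fock_alpha_linear K l F)) scaler0.
Qed.

Local Notation sgn := (sign_pow (@fock_alpha K l F)).

Lemma sgnP : is_sign_pow (@fock_alpha K l F) sgn.
Proof.
suff: exists S, is_sign_pow (@fock_alpha K l F) S.
  by rewrite /sign_pow; case: pselect => // ex _; case: (cid ex).
have [S SP] := choice ex_sgn_rel; exists S; split.
  by move=> c v w; apply: (sgn_rel_uniq (SP _)); apply: sgn_rel_linear.
by move=> m v av; apply: sgn_rel_eigen av (SP v).
Qed.

Lemma sgn_linear : linear sgn. Proof. by case: sgnP. Qed.

Lemma sgn_mono s : sgn (mono s) = (-1) ^+ phi_count s *: mono s.
Proof. by apply: sgnP.2; apply: fock_alpha_mono. Qed.

Definition phi_sign a : K := (-1) ^+ (a == None).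

Lemma phi_sign_bar a : phi_sign (bar a) = phi_sign a.
Proof. by case: a => [[]|]. Qed.

Lemma sgn_cr x v : sgn (cr x v) = phi_sign x.1 *: cr x (sgn v).
Proof.
have [L [_ ->]] := spannedT v.
rewrite linear_sum !(lfun_sum sgn_linear) linear_sum scaler_sumr.
apply: eq_bigr => y _; rewrite (linearZ_LR (cr x)) !(lfunZ sgn_linear).
rewrite (linearZ_LR (cr x)) sgn_mono -[cr x (mono y.2)]/(mono (x :: y.2)).
rewrite sgn_mono (linearZ_LR (cr x)) /= /phi_count /= exprD -/(phi_sign _).
by rewrite !scalerA; congr (_ *: _); ring.
Qed.

Lemma sgn_an x v : sgn (an x v) = phi_sign x.1 *: an x (sgn v).
Proof.
have [L [_ ->]] := spannedT v.
rewrite linear_sum !(lfun_sum sgn_linear) linear_sum scaler_sumr.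
apply: eq_bigr => z _; rewrite (linearZ_LR (an x)) !(lfunZ sgn_linear).
rewrite (linearZ_LR (an x)) scalerA mulrC -scalerA; congr (_ *: _).
elim: {z}z.2 => [|y s IH].
  by rewrite sgn_mono (linearZ_LR (an x)) an_vac !scaler0 (lfun0 sgn_linear).
rewrite sgn_mono (linearZ_LR (an x)) /= !an_cr (lfunB sgn_linear) (lfunZ sgn_linear).
rewrite sgn_cr IH sgn_mono (linearZ_LR (an x)) (linearZ_LR (cr y)) (linearZ_LR (cr y)).
rewrite !scalerBr !scalerA /phi_count /= exprD -!/(phi_sign _).
congr (_ *: _ - _ *: _); last by ring.
case: eqP => [->|_]; last by rewrite mul0r mulr0.
have : phi_sign y.1 * phi_sign y.1 = 1 by rewrite /phi_sign; case: eqP => _ /=; ring.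
by move=> E; rewrite mul1r mulr1 mulrA E mul1r.
Qed.

Lemma sgn_u a i v : sgn (u a i v) = phi_sign a *: u a i (sgn v).
Proof.
have [i0|i0] := leP i 0.
  have -> : u a i = an (bar a, `|i|%N) by rewrite /an /= barK; congr (fmode F); lia.
  by rewrite sgn_an /= phi_sign_bar.
have -> : u a i = cr (a, `|i|.-1%N) by rewrite /cr /=; congr (fmode F); lia.
by rewrite sgn_cr.
Qed.

Lemma phi_signK a : phi_sign a * phi_sign a = 1.
Proof. by rewrite /phi_sign; case: eqP => _ /=; ring. Qed.

Lemma sgn_bilin i j v : sgn (bilin i j v) = bilin i j (sgn v).
Proof.
rewrite !bilinE (lfunB sgn_linear) (lfunZ sgn_linear) (lfun_sum sgn_linear);
  congr (_ - _).
apply: eq_bigr => a _; rewrite !sgn_u phi_sign_bar (linearZ_LR (u a i)) scalerA.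
by rewrite phi_signK scale1r.
Qed.

Lemma sgn_fock_act X v : gl_band X.1 -> sgn (fock_act X v) = fock_act X (sgn v).
Proof.
move=> bX; have lX := sgn_linear.
have [N1 H1] := ex_act_win v bX; have [N2 H2] := ex_act_win (sgn v) bX.
pose M := (N1 + N2).+1.
rewrite (H1 M) ?(H2 M); try by rewrite /M; lia.
rewrite /act_win (lfunD lX) !(lfunZ lX) (lfun_sum lX); congr (_ *: _ + _).
apply: eq_bigr => i _; rewrite (lfun_sum lX); apply: eq_bigr => j _.
by rewrite (lfunZ lX) sgn_bilin.
Qed.

Lemma sgn_so_op a b v : sgn (so_op a b v) = (phi_sign a * phi_sign b) *:
  so_op a b (sgn v).
Proof.
have lX := sgn_linear.
have [N1 H1] := ex_so_op a b v; have [N2 H2] := ex_so_op a b (sgn v).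
pose M := (N1 + N2)%N.
rewrite (H1 M) ?(H2 M); try by rewrite /M; lia.
rewrite (lfun_sum lX) scaler_sumr; apply: eq_bigr => i _.
rewrite /nprod (lfunB lX) (lfunZ lX) !sgn_u phi_sign_bar (linearZ_LR (u a i)).
rewrite scalerBr !scalerA; congr (_ - _ *: _).
by case: eqP => [->|_]; rewrite ?mulr0 // phi_signK mul1r.
Qed.

Lemma energy_components (U : set F) v : subspace U ->
  (forall w, U w -> U (fock_L0 w)) -> U v ->
  exists N (w : nat -> F),
    (forall n, eigen_in U (@fock_L0 K l F) (n%:R / 2) (w n)) /\ v = \sum_(n < N) w n.
Proof.
move=> sU LU Uv; have [L [_ vE]] := spannedT v.
have lL := fock_L0_linear.
have eigL y : y \in L ->
    fock_L0 (y.1 *: mono y.2) = ((energy2 y.2)%:R / 2) *: (y.1 *: mono y.2).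
  by move=> _; rewrite (lfunZ lL) fock_L0_mono !scalerA mulrC.
have [N LN] := ex_value_bound L (fun y => energy2 y.2).
exists N, (fun n => \sum_(y <- L | energy2 y.2 == n) y.1 *: mono y.2); split.
  move=> n; split.
    rewrite (eq_bigl (fun y => (energy2 y.2)%:R / 2 == n%:R / 2 :> K)); last first.
      by move=> y; rewrite (inj_eq (mulIf _)) ?eqr_nat // invr_neq0 ?pnatr_eq0.
    have := eigen_component lL (n%:R / 2) eigL sU LU.
    by rewrite -vE; apply.
  rewrite (lfun_sum lL) scaler_sumr big_seq_cond [RHS]big_seq_cond.
  by apply: eq_bigr => y /andP[yL /eqP <-]; apply: eigL.
by rewrite vE; apply: sum_by_value.
Qed.

(** If no monomial in an expansion of [v] had the eigenvalue [c], the sieve would leave an empty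
    sum. *)
Lemma energy_nat c v : fock_L0 v = c *: v -> v != 0 -> exists n : nat, c = n%:R / 2.
Proof.
move=> Lv v0; have [L [_ vE]] := spannedT v.
have lL := fock_L0_linear.
have eigL y : y \in L ->
    fock_L0 (y.1 *: mono y.2) = ((energy2 y.2)%:R / 2) *: (y.1 *: mono y.2).
  by move=> _; rewrite (lfunZ lL) fock_L0_mono !scalerA mulrC.
have [/hasP[y _ /eqP E]|none] := boolP (has (fun y => (energy2 y.2)%:R / 2 == c) L).
  by exists (energy2 y.2).
move: v0; rewrite (eigen_sieve lL eigL vE Lv) big1_seq ?eqxx // => y /andP[yc yL].
by move/hasPn: none => /(_ y yL); rewrite yc.
Qed.

End Eigenvalues.

(** * The Casimir identity *)

Lemma sum_pairs_split (V : nmodType) (I : finType) (r : I -> nat) (f : I -> I -> V) :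
  injective r -> \sum_i \sum_j f i j =
  \sum_i f i i + \sum_i \sum_(j | (r i < r j)%N) (f i j + f j i).
Proof.
move=> injr.
have -> : \sum_i \sum_j f i j = \sum_i (f i i + (\sum_(j | (r i < r j)%N) f i j +
    \sum_(j | (r j < r i)%N) f i j)).
  apply: eq_bigr => i _; rewrite (bigD1 i) //= (bigID (fun j => (r i < r j)%N)) /=.
  congr (_ + (_ + _)); apply: eq_bigl => j.
    by case: eqP => [->|] //=; rewrite ltnn.
  rewrite -leqNgt leq_eqVlt (inj_eq injr).
  by have [->|] := eqVneq j i; rewrite ?ltnn //= => _.
rewrite !big_split /=; congr (_ + _).
under [RHS]eq_bigr do rewrite big_split /=.
rewrite big_split /=; congr (_ + _).
by rewrite (exchange_big_dep xpredT).
Qed.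

Lemma exchange_pairs (V : nmodType) (I J : finType) (P : rel I) (Q : rel J)
    (f : I -> I -> J -> J -> V) :
  \sum_i \sum_(i' | P i i') \sum_j \sum_(j' | Q j j') f i i' j j' =
  \sum_j \sum_(j' | Q j j') \sum_i \sum_(i' | P i i') f i i' j j'.
Proof.
rewrite pair_big_dep [RHS]pair_big_dep /=.
under eq_bigr do rewrite pair_big_dep.
under [RHS]eq_bigr do rewrite pair_big_dep.
exact: exchange_big.
Qed.

Section Rank.
Variable l : nat.
Local Notation A := (option (bool * 'I_l)).
Local Notation bar := (@bar l).

(* The chain +1 > .. > +l > 0 > -l > .. > -1 of weights of the defining
   representation of so(2l+1), listed from the highest weight down. *)
Definition rk (a : A) : nat :=
  match a with
  | Some (true, p) => p
  | None => l
  | Some (false, p) => (2 * l - p)%N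
  end.

Lemma rk_bar a : rk (bar a) = (2 * l - rk a)%N.
Proof. by case: a => [[[] p]|] /=; try (have := ltn_ord p); lia. Qed.

Lemma rk_le a : (rk a <= 2 * l)%N.
Proof. by case: a => [[[] p]|] /=; try (have := ltn_ord p); lia. Qed.

Lemma rk_inj : injective rk.
Proof.
move=> [[[] p]|] [[[] q]|] //= E; try (have := ltn_ord p); try (have := ltn_ord q);
  try by lia.
- by move=> _ _; congr (Some (_, _)); apply: val_inj.
- by move=> lq lp; congr (Some (_, _)); apply: val_inj => /=; lia.
Qed.

Lemma rk_bar_lt a b : (rk (bar b) < rk (bar a))%N = (rk a < rk b)%N.
Proof. by rewrite !rk_bar; have := rk_le a; have := rk_le b; lia. Qed.

End Rank.

Section Identity.
Variables (K : numFieldType) (l : nat) (F : fock_space K l).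
Local Notation A := (option (bool * 'I_l)).
Local Notation mode := (A * nat)%type.
Local Notation u := (fmode F).
Local Notation bilin := (@bilin K l F).
Local Notation so_op := (@so_op K l F).
Local Notation bar := (@bar l).
Local Notation cr := (cr F).
Local Notation an := (an F).
Local Notation mono := (mono F).
Local Notation rk := (@rk l).
Implicit Types (a b : A) (v w : F) (x y z : mode) (s : seq mode).

Definition num x v : F := cr x (an x v).

Lemma bilin_pp (k m : nat) v :
  bilin (Posz k.+1) (Posz m.+1) v = \sum_a cr (a, k) (an (a, m) v).
Proof.
apply: eq_bigr => a _; rewrite andbF scale0r subr0 /cr /an /=.
by congr (fmode F _ _ (fmode F _ _ v)); lia.
Qed.

Lemma bilin_pn (k m : nat) v :
  bilin (Posz k.+1) (- Posz m) v = \sum_a cr (a, k) (cr (bar a, m) v).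
Proof.
apply: eq_bigr => a _; have -> : (Posz k.+1 == - Posz m) = false by lia.
rewrite scale0r subr0 /cr /=; congr (fmode F _ _ (fmode F _ _ v)); lia.
Qed.

Lemma bilin_np (k m : nat) v :
  bilin (- Posz k) (Posz m.+1) v = \sum_a an (bar a, k) (an (a, m) v).
Proof.
apply: eq_bigr => a _; rewrite andbF scale0r subr0 /an /= barK.
by congr (fmode F _ _ (fmode F _ _ v)); lia.
Qed.

Lemma so_op_modes N a b v : below N v -> so_op a b v =
  \sum_(k < N) (cr (a, val k) (an (b, val k) v) -
    cr (bar b, val k) (an (bar a, val k) v)).
Proof.
move=> vN; rewrite (so_opE _ _ vN (leqnn N)) sum_winE; apply: eq_bigr => k _.
congr (_ + _).
  rewrite /nprod andbF scale0r subr0 /cr /an /=.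
  by congr (fmode F _ _ (fmode F _ _ v)); lia.
rewrite nprod_swap; last lia.
rewrite /cr /an /= barK; congr (- fmode F _ _ (fmode F _ _ v)); lia.
Qed.

Lemma cr_an_cr x y z w : y != z -> y != x ->
  cr x (an y (cr z w)) = - cr z (an y (cr x w)).
Proof.
move=> /negbTE yz /negbTE yx; rewrite !an_cr yz yx !scale0r !sub0r.
by rewrite (linearN (cr x)) (linearN (cr z)) opprK cr_cr opprK.
Qed.

Lemma an_cr_an y z x v : y != z -> x != z ->
  an y (cr z (an x v)) = - an x (cr z (an y v)).
Proof.
move=> /negbTE yz /negbTE xz; rewrite !an_cr yz xz !scale0r !sub0r.
by rewrite opprK an_an (linearN (cr z)) opprK.
Qed.

Lemma cr_an x y v : cr x (an y v) = (y == x)%:R *: v - an y (cr x v).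
Proof. by rewrite an_cr opprB addrC subrK. Qed.

Section Window.
Variables (N : nat) (v : F).
Implicit Types k m : 'I_N.

(** The matrix unit [E_(a,b)] of gl(2l+1) acting on the species, cut to [N] creation modes. On
    vectors below [N], [so_op a b] is [glO a b - glO (bar b) (bar a)]. *)
Definition glO a b (w : F) : F := \sum_(k < N) cr (a, val k) (an (b, val k) w).

(* The off-diagonal terms of the two sums on the left cancel in pairs. *)
Lemma gl_gl_identity :
  \sum_a \sum_(b | (rk a < rk b)%N) glO b a (glO a b v) +
  \sum_(k < N) \sum_(m < N | (k < m)%N) bilin (Posz m.+1) (Posz k.+1) (bilin
    (Posz k.+1) (Posz m.+1) v) =
  \sum_a \sum_(b | (rk a < rk b)%N) \sum_(k < N) num (b, val k) (v - num (a, val k) v) +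
  \sum_(k < N) \sum_(m < N | (k < m)%N) \sum_a num (a, val m) (v - num (a, val k) v).
Proof.
(* For distinct species and distinct modes both products remove [(b, m)] and [(a, k)] and create
   [(a, m)] and [(b, k)]: [G] by hops at fixed mode, [H] by hops at fixed species. They differ by
   the order of the two creators, hence by a sign. *)
pose G a b (k m : 'I_N) := cr (b, val k) (an (a, val k) (cr (a, val m) (an
  (b, val m) v))).
pose H a b (k m : 'I_N) := cr (a, val m) (an (a, val k) (cr (b, val k) (an
  (b, val m) v))).
have GG a b : glO b a (glO a b v) = \sum_k \sum_m G a b k m.
  by apply: eq_bigr => k _; rewrite !linear_sum.
have HH (k m : 'I_N) : bilin (Posz m.+1) (Posz k.+1) (bilin (Posz k.+1) (Posz m.+1) v) =
    \sum_a \sum_b H a b k m.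
  by rewrite !bilin_pp; apply: eq_bigr => a _; rewrite !linear_sum.
(* The terms with [k = m] in the first sum and [a = b] in the second are a hop from [x] to [y] and
   back; it detects that [x] is filled and [y] is empty. *)
have hole x y w : x != y -> cr x (an y (cr y (an x w))) = num x (w - num y w).
  move=> xy; rewrite /num !linearB /= an_cr eqxx scale1r (linearB (cr x)).
  congr (_ - _); congr (cr x _); rewrite an_cr (negbTE xy) scale0r sub0r.
  by rewrite an_an (linearN (cr y)).
under eq_bigr => a _ do under eq_bigr => b _ do
  rewrite GG (sum_pairs_split _ (@val_inj _ _ _)).
under eq_bigr => a _ do rewrite big_split /=.
under [X in _ + X]eq_bigr => k _ do under eq_bigr => m _ do
  rewrite HH (sum_pairs_split _ (@rk_inj l)).
under [X in _ + X]eq_bigr => k _ do rewrite big_split /=.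
rewrite !big_split /= addrACA exchange_pairs -big_split [X in _ + X]big1 ?addr0.
  congr (_ + _).
    apply: eq_bigr => a _; apply: eq_bigr => b ab; apply: eq_bigr => k _.
    by apply: hole; apply: contraTneq ab => -[->]; rewrite ltnn.
  apply: eq_bigr => k _; apply: eq_bigr => m km; apply: eq_bigr => a _.
  by apply: hole; apply: contraTneq km => -[->]; rewrite ltnn.
move=> k _; rewrite -big_split big1 // => m km.
rewrite -big_split big1 // => a _; rewrite -big_split big1 // => b ab /=.
have neq c d : (c, val k) != (d, val m).
  by apply: contraTneq km => -[_ ->]; rewrite ltnn.
have neq' c d : (c, val m) != (d, val k) by rewrite eq_sym.
have neqab n : (a, n) != (b, n).
  by apply: contraTneq ab => -[->]; rewrite ltnn.
have neqba n : (b, n) != (a, n) by rewrite eq_sym.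
rewrite /G /H (@cr_an_cr (b, val k)) // [X in _ + X + _](_ : _ = - H b a k m).
  by rewrite /H addrACA addNr add0r addNr.
by rewrite /H (@an_cr_an (a, val m)) ?neq' ?neqba //; exact: linearN.
Qed.

Lemma sum_bar (V : nmodType) (f : A -> V) : \sum_a f a = \sum_a f (bar a).
Proof. exact: (reindex_inj (inv_inj (@barK l))). Qed.

(** Moving the creators to the left turns both sums into sums of [S a b]. The symmetry of [S] under
    [bar], which reverses [rk], shows that the pairs with [rk a < rk b] carry half of all
    off-diagonal terms, so these cancel. What survives is [S a a] and the anticommutators at
    [a = bar b]. *)
Lemma so_so_identity :
  2^-1 *: (\sum_(k < N) \sum_(m < N)
     bilin (Posz m.+1) (- Posz k) (bilin (- Posz k) (Posz m.+1) v)) -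
  \sum_a \sum_(b | (rk a < rk b)%N) glO b a (glO (bar b) (bar a) v) =
  2^-1 *: (\sum_a \sum_(k < N) \sum_(m < N) num (a, val k) (num (bar a, val m) v)) -
  2^-1 *: (\sum_(a | a == bar a) \sum_(k < N) num (a, val k) v) -
  \sum_(b | (rk (bar b) < rk b)%N) \sum_(k < N) num (b, val k) v.
Proof.
pose B a b (k m : 'I_N) :=
  cr (b, val k) (cr (bar b, val m) (an (a, val k) (an (bar a, val m) v))).
pose S a b := \sum_(k < N) \sum_(m < N) B a b k m.
have E1 a b : glO b a (glO (bar b) (bar a) v) =
    (a == bar b)%:R *: (\sum_(k < N) num (b, val k) v) - S a b.
  rewrite /glO scaler_sumr -sumrB; apply: eq_bigr => k _; rewrite !linear_sum.
  have -> : (a == bar b)%:R *: num (b, val k) v = \sum_(m < N) (m == k)%:R *: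
      ((a == bar b)%:R *: num (b, val k) v).
    rewrite (bigD1 k) //= eqxx scale1r big1 ?addr0 // => m /negbTE ->.
    by rewrite scale0r.
  rewrite -big_split; apply: eq_bigr => m _ /=.
  rewrite an_cr (linearB (cr (b, val k))); congr (_ - _).
  rewrite (linearZ_LR (cr (b, val k))) xpair_eqE /= scalerA -natrM mulnb andbC.
  rewrite [m == k]eq_sym val_eqE; case: eqP => [<-|_] /=; last by rewrite !scale0r.
  by case: eqP => [->|_]; rewrite ?barK // !scale0r.
have E2 (k m : 'I_N) : bilin (Posz m.+1) (- Posz k) (bilin (- Posz k) (Posz m.+1) v) =
    - \sum_a \sum_b B a b k m.
  rewrite bilin_np bilin_pn sum_bar exchange_big -sumrN; apply: eq_bigr => b _.
  rewrite barK !linear_sum sum_bar; apply: eq_bigr => a _ /=.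
  by rewrite barK cr_cr.
have E3 a b : S (bar a) (bar b) = S a b.
  rewrite /S exchange_big; apply: eq_bigr => k _; apply: eq_bigr => m _.
  by rewrite /B !barK cr_cr an_an !linearN opprK.
have E4 a : S a a = (a == bar a)%:R *: (\sum_(k < N) num (a, val k) v) -
    \sum_(k < N) \sum_(m < N) num (a, val k) (num (bar a, val m) v).
  rewrite scaler_sumr -sumrB; apply: eq_bigr => k _.
  have -> : (a == bar a)%:R *: num (a, val k) v = \sum_(m < N) (m == k)%:R *:
      ((a == bar a)%:R *: num (a, val k) v).
    rewrite (bigD1 k) //= eqxx scale1r big1 ?addr0 // => m /negbTE ->.
    by rewrite scale0r.
  rewrite -sumrB; apply: eq_bigr => m _ /=; rewrite /B /num cr_an.
  rewrite (linearB (cr (a, val k))); congr (_ - _).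
  rewrite (linearZ_LR (cr (a, val k))) xpair_eqE /= scalerA -natrM mulnb andbC.
  rewrite [m == k]eq_sym val_eqE; case: eqP => [<-|_] /=; last by rewrite !scale0r.
  by case: eqP => [<-|_] //; rewrite !scale0r.
under [X in _ - X = _]eq_bigr => a _ do under eq_bigr => b _ do rewrite E1.
under [X in _ - X = _]eq_bigr => a _ do rewrite sumrB.
rewrite sumrB; set P := \sum_a \sum_(b | _) _ *: _; set Q := \sum_a \sum_(b | _) S a b.
have PE : P = \sum_(b | (rk (bar b) < rk b)%N) \sum_(k < N) num (b, val k) v.
  rewrite /P (exchange_big_dep xpredT) //= [RHS]big_mkcond /=; apply: eq_bigr => b _.
  rewrite big_mkcond (bigD1 (bar b)) //= eqxx scale1r [X in _ +
    X]big1 ?addr0 // => a /negbTE ->.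
  by rewrite scale0r if_same.
have QE : \sum_a \sum_b S a b = \sum_a S a a + 2 *: Q.
  rewrite (sum_pairs_split _ (@rk_inj l)); congr (_ + _).
  under eq_bigr => a _ do rewrite big_split /=.
  rewrite big_split /= scaler_nat mulr2n; congr (_ + _).
  symmetry; rewrite (exchange_big_dep xpredT) //= sum_bar; apply: eq_bigr => b _.
  rewrite (reindex_inj (inv_inj (@barK l))) /=; apply: eq_big => a.
    by rewrite -(rk_bar_lt b) barK.
  by rewrite -(E3 b) barK.
have -> : \sum_(k < N) \sum_(m < N)
     bilin (Posz m.+1) (- Posz k) (bilin (- Posz k) (Posz m.+1) v) =
       - (\sum_a \sum_b S a b).
  rewrite /S; under eq_bigr => k _ do under eq_bigr => m _ do rewrite E2.
  under eq_bigr do rewrite sumrN; rewrite sumrN; congr (- _).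
  rewrite (@exchange_pairs _ _ _ (fun _ _ => true) (fun _ _ => true)).
  by [].
rewrite PE QE scalerN scalerDr scalerA mulVf ?pnatr_eq0 // scale1r.
rewrite opprB opprD addrA subrK; congr (_ - _).
have -> : \sum_a S a a = (\sum_(a | a == bar a) \sum_(k < N) num (a, val k) v) -
    \sum_a \sum_(k < N) \sum_(m < N) num (a, val k) (num (bar a, val m) v).
  under eq_bigr do rewrite E4.
  rewrite sumrB; congr (_ - _); rewrite [RHS]big_mkcond /=; apply: eq_bigr => a _.
  by case: eqP => _; rewrite ?scale1r ?scale0r.
by rewrite scalerBr opprB.
Qed.

End Window.
End Identity.

(** * The diagonal operator and the zeros of its eigenvalue *)

Section LinearCombinations.
Variables (K : numFieldType) (V W : lmodType K).
Implicit Types f g : V -> W.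

Lemma linear_add f g : linear f -> linear g -> linear (fun v => f v + g v).
Proof. by move=> lf lg c x y; rewrite lf lg scalerDr addrACA. Qed.

Lemma linear_opp f : linear f -> linear (fun v => - f v).
Proof. by move=> lf c x y; rewrite lf opprD scalerN. Qed.

Lemma linear_scale a f : linear f -> linear (fun v => a *: f v).
Proof. by move=> lf c x y; rewrite lf scalerDr !scalerA mulrC. Qed.

Lemma linear_bigsum (I : Type) (r : seq I) (P : pred I) (f : I -> V -> W) :
  (forall i, linear (f i)) -> linear (fun v => \sum_(i <- r | P i) f i v).
Proof.
move=> lf c x y; rewrite scaler_sumr -big_split /=.
by apply: eq_bigr => i _; apply: lf.
Qed.

End LinearCombinations.

Lemma sum3_eq0P (R : numDomainType) (I J L : finType) (P : I -> pred J)
    (Q : I -> J -> pred L) (f : I -> J -> L -> R) : (forall i j k, 0 <= f i j k) ->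
  \sum_i \sum_(j | P i j) \sum_(k | Q i j k) f i j k = 0 ->
  forall i j k, P i j -> Q i j k -> f i j k = 0.
Proof.
move=> f0 s0 i j k Pij Qijk.
have s1 : \sum_(j | P i j) \sum_(k | Q i j k) f i j k = 0.
  by apply: (psumr_eq0P _ s0 isT) => *; do 2![apply: sumr_ge0 => ? _].
have s2 : \sum_(k | Q i j k) f i j k = 0.
  by apply: (psumr_eq0P _ s1 Pij) => *; apply: sumr_ge0.
by apply: (psumr_eq0P _ s2 Qijk).
Qed.

Section Diagonal.
Variables (K : numFieldType) (l : nat) (F : fock_space K l).
Local Notation A := (option (bool * 'I_l)).
Local Notation mode := (A * nat)%type.
Local Notation u := (fmode F).
Local Notation bilin := (@bilin K l F).
Local Notation so_op := (@so_op K l F).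
Local Notation bar := (@bar l).
Local Notation cr := (cr F).
Local Notation an := (an F).
Local Notation mono := (mono F).
Local Notation num := (@num K l F).
Local Notation glO := (@glO K l F).
Local Notation rk := (@rk l).
Implicit Types (a b : A) (v w : F) (x y z : mode) (s : seq mode).

Lemma num_linear x : linear (num x).
Proof. by move=> c v w; rewrite /num (linearP (an x)) (linearP (cr x)). Qed.

Lemma num_mono x s : uniq s -> num x (mono s) = (x \in s)%:R *: mono s.
Proof.
move=> us; rewrite -(count_uniq_mem x us); elim: s {us} => [|y s IH] /=.
  by rewrite /num an_vac (linear0 (cr x)) scale0r.
rewrite natrD scalerDl /num an_cr (linearB (cr x)) (linearZ_LR (cr x)) -/(cr x _).
rewrite cr_cr opprK -/(num x (mono s)) IH (linearZ_LR (cr y)) eq_sym; congr (_ + _).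
by case: eqP => [->|]; rewrite ?scale0r.
Qed.

(* The part of the quadratic Casimir of d_infinity that involves the raising
   operators of the first N modes. *)
Definition casimir_d N v : F :=
  \sum_(k < N) \sum_(m < N | (k < m)%N)
    bilin (Posz m.+1) (Posz k.+1) (bilin (Posz k.+1) (Posz m.+1) v) +
  2^-1 *: (\sum_(k < N) \sum_(m < N)
    bilin (Posz m.+1) (- Posz k) (bilin (- Posz k) (Posz m.+1) v)).

Definition diag_op N v : F :=
  (\sum_a \sum_(b | (rk a < rk b)%N) \sum_(k < N) num (b, val k) (v - num (a, val k) v) +
   \sum_(k < N) \sum_(m < N | (k < m)%N) \sum_a num (a, val m) (v - num (a, val k) v)) +
  (2^-1 *: (\sum_a \sum_(k < N) \sum_(m < N) num (a, val k) (num (bar a, val m) v)) -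
   2^-1 *: (\sum_(a | a == bar a) \sum_(k < N) num (a, val k) v) -
   \sum_(b | (rk (bar b) < rk b)%N) \sum_(k < N) num (b, val k) v).

Lemma diag_op_linear N : linear (diag_op N).
Proof.
have l2 x y : linear (fun v => num x (num y v)).
  by move=> c v w; rewrite (num_linear y) (num_linear x).
have l3 x y : linear (fun v => num x (v - num y v)).
  move=> c v w; rewrite (num_linear y) opprD addrACA -scalerBr; exact: num_linear.
do ?[exact: l2|exact: l3|exact: num_linear|apply: linear_add|apply: linear_opp|
     apply: linear_scale|apply: linear_bigsum => ?].
Qed.

Definition hw_killed v := forall a b, (rk a < rk b)%N -> so_op a b v = 0.

(** On a vector killed by the raising operators [glO a b] and [glO (bar b) (bar a)] agree, so adding
    the two identities cancels their so(2l+1)-terms. *)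
Lemma casimir_dE N v : below N v -> hw_killed v -> casimir_d N v = diag_op N v.
Proof.
move=> vN vK; rewrite /diag_op -gl_gl_identity -so_so_identity /casimir_d.
have -> : \sum_a \sum_(b | (rk a < rk b)%N) glO N b a (glO N a b v) =
    \sum_a \sum_(b | (rk a < rk b)%N) glO N b a (glO N (bar b) (bar a) v).
  apply: eq_bigr => a _; apply: eq_bigr => b ab; congr glO.
  apply/eqP; rewrite -subr_eq0 /glO -sumrB; apply/eqP.
  by rewrite -(so_op_modes a b vN) vK.
by rewrite [RHS]addrC subrKA addrC.
Qed.

Definition occ s a (k : nat) : K := ((a, k) \in s)%:R.

Definition diag_val N s : K :=
  (\sum_a \sum_(b | (rk a < rk b)%N) \sum_(k < N) occ s b k * (1 - occ s a k) +
   \sum_(k < N) \sum_(m < N | (k < m)%N) \sum_a occ s a m * (1 - occ s a k)) +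
  (2^-1 * (\sum_a \sum_(k < N) \sum_(m < N) occ s a k * occ s (bar a) m) -
   2^-1 * (\sum_(a | a == bar a) \sum_(k < N) occ s a k) -
   \sum_(b | (rk (bar b) < rk b)%N) \sum_(k < N) occ s b k).

Lemma diag_op_mono N s : uniq s -> diag_op N (mono s) = diag_val N s *: mono s.
Proof.
move=> us; rewrite /diag_op /diag_val /occ !scalerDl !scaleNr -!scalerA !scaler_suml.
have E2 x y : num x (num y (mono s)) = ((x \in s)%:R * (y \in s)%:R) *: mono s.
  by rewrite num_mono // (lfunZ (num_linear x)) num_mono // scalerA mulrC.
have E3 x y : num x (mono s - num y (mono s)) =
    ((x \in s)%:R * (1 - (y \in s)%:R)) *: mono s.
  by rewrite (lfunB (num_linear x)) E2 num_mono // -scalerBl mulrBr mulr1.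
congr (_ + _ + (_ *: _ - _ *: _ - _)); apply: eq_bigr => i _; rewrite scaler_suml;
  apply: eq_bigr => j _; rewrite ?scaler_suml ?E3 ?E2 ?num_mono //.
- by apply: eq_bigr => k _; rewrite E3.
- by apply: eq_bigr => k _; rewrite E3.
- by apply: eq_bigr => k _; rewrite E2.
Qed.

Lemma sum_bar_sym (f : A -> K) : (forall a, f (bar a) = f a) ->
  \sum_a f a = \sum_(a | a == bar a) f a + 2 * \sum_(a | (rk (bar a) < rk a)%N) f a.
Proof.
move=> fbar; rewrite (bigID (fun a => a == bar a)) /=; congr (_ + _).
rewrite (bigID (fun a => (rk (bar a) < rk a)%N)) /= mulr_natl mulr2n; congr (_ + _).
  apply: eq_bigl => a; have [E|//] := eqVneq a (bar a).
  by rewrite -[in RHS]E ltnn.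
rewrite (reindex_inj (inv_inj (@barK l))); apply: eq_big => [a|a _]; last exact: fbar.
rewrite barK -leqNgt leq_eqVlt (inj_eq (@rk_inj l)).
by have [->|] := eqVneq (bar a) a; rewrite ?eqxx ?ltnn //= => /negbTE;
  rewrite eq_sym => ->.
Qed.

(* The eigenvalue of diag_op as a sum of non-negative terms, each of which
   tests for one term of one raising operator that does not kill the monomial. *)
Lemma diag_valE N s : diag_val N s =
  \sum_a \sum_(b | (rk a < rk b)%N && (a != bar b)) \sum_(k < N) occ s b k * (1 -
    occ s a k) +
  \sum_(k < N) \sum_(m < N | (k < m)%N) \sum_a occ s a m * (1 - occ s a k) +
  2^-1 * \sum_a \sum_(k < N) \sum_(m < N | k != m) occ s a k * occ s (bar a) m.
Proof.
rewrite /diag_val.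
have nn a (k : 'I_N) : occ s a k * occ s a k = occ s a k by rewrite /occ -natrM mulnb
  andbb.
(* The negative terms of [diag_val] are compensated by the pairs [a = bar b] of the first sum and
   the diagonal [k = m] of the third; [g] is what these two have in common. *)
pose g a := \sum_(k < N) occ s a k * occ s (bar a) k.
have gbar a : g (bar a) = g a.
  by apply: eq_bigr => k _; rewrite barK mulrC.
have E1 : \sum_a \sum_(b | (rk a < rk b)%N) \sum_(k < N) occ s b k * (1 - occ s a k) =
    \sum_a \sum_(b | (rk a < rk b)%N && (a != bar b)) \sum_(k < N) occ s b k * (1 -
      occ s a k) +
    (\sum_(b | (rk (bar b) < rk b)%N) \sum_(k < N) occ s b k -
     \sum_(b | (rk (bar b) < rk b)%N) g b).
  under eq_bigr => a _ do rewrite (bigID (fun b => a == bar b)) /=.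
  rewrite big_split /= addrC; congr (_ + _).
  rewrite (exchange_big_dep xpredT) //= -sumrB [RHS]big_mkcond /=.
  apply: eq_bigr => b _; rewrite big_mkcond (bigD1 (bar b)) //= eqxx andbT.
  rewrite [X in _ + X]big1 ?addr0 => [|a /negbTE ->]; last by rewrite andbF.
  case: ifP => // _; rewrite /g -sumrB; apply: eq_bigr => k _.
  by rewrite mulrBr mulr1.
have E2 : \sum_a \sum_(k < N) \sum_(m < N) occ s a k * occ s (bar a) m =
    \sum_a \sum_(k < N) \sum_(m < N | k != m) occ s a k * occ s (bar a) m + \sum_a g a.
  rewrite -big_split; apply: eq_bigr => a _; rewrite -big_split; apply: eq_bigr => k _ /=.
  by rewrite (bigD1 k) //= addrC; congr (_ + _); apply: eq_bigl => m; rewrite eq_sym.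
have E3 : \sum_(a | a == bar a) g a = \sum_(a | a == bar a) \sum_(k < N) occ s a k.
  by apply: eq_bigr => a /eqP E; rewrite /g -E; apply: eq_bigr => k _; rewrite nn.
by rewrite E1 E2 (sum_bar_sym gbar) E3; field.
Qed.

(* The monomials killed by all the raising operators of so(2l+1) and d_infinity. *)
Definition hw_closed s := [/\
  forall a b k, (rk a < rk b)%N -> a != bar b -> (b, k) \in s -> (a, k) \in s,
  forall a k m, (k < m)%N -> (a, m) \in s -> (a, k) \in s &
  forall a k m, k != m -> (a, k) \in s -> (bar a, m) \notin s].

Lemma diag_val_eq0 N s : {in s, forall x, (x.2 < N)%N} -> diag_val N s = 0 -> hw_closed s.
Proof.
move=> sN; rewrite diag_valE.
have n0 a (k : 'I_N) : 0 <= occ s a k by rewrite ler0n.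
have n1 a (k : 'I_N) : 0 <= 1 - occ s a k by rewrite subr_ge0 /occ lern1 leq_b1.
set V1 := \sum_a _; set V2 := \sum_(k < N) _; set V3 := \sum_a _.
have V1_ge0 : 0 <= V1.
  by do 3!(apply: sumr_ge0 => ? _); apply: mulr_ge0.
have V2_ge0 : 0 <= V2.
  by do 3!(apply: sumr_ge0 => ? _); apply: mulr_ge0.
have V3_ge0 : 0 <= V3.
  by do 3!(apply: sumr_ge0 => ? _); apply: mulr_ge0.
move/eqP; rewrite !paddr_eq0 ?addr_ge0 ?mulr_ge0 ?invr_ge0 ?ler0n //.
rewrite mulf_eq0 invr_eq0 pnatr_eq0 /= => /andP[/andP[/eqP V1_0 /eqP V2_0] /eqP V3_0].
have p1 a b (k m : 'I_N) : 0 <= occ s b m * (1 - occ s a k) by apply: mulr_ge0.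
have p2 a b (k m : 'I_N) : 0 <= occ s a k * occ s b m by apply: mulr_ge0.
have mem_occ a b k m : occ s b m * (1 - occ s a k) = 0 -> (b, m) \in s -> (a, k) \in s.
  rewrite /occ => + bm; rewrite bm mul1r => /eqP; rewrite subr_eq0.
  by case: (_ \in s) => //; rewrite oner_eq0.
have z1 a b (k : 'I_N) : (rk a < rk b)%N && (a != bar b) ->
    occ s b k * (1 - occ s a k) = 0.
  by move=> ab; apply: (sum3_eq0P (fun a b k => p1 a b k k) V1_0 ab).
have z2 a (k m : 'I_N) : (k < m)%N -> occ s a m * (1 - occ s a k) = 0.
  by move=> km; apply: (sum3_eq0P (fun k m a => p1 a a k m) V2_0 km).
have z3 a (k m : 'I_N) : k != m -> occ s a k * occ s (bar a) m = 0.
  by move=> km; apply: (sum3_eq0P (fun a k m => p2 a (bar a) k m) V3_0 _ km).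
split.
- move=> a b k ab abar bk; have /= kN := sN _ bk.
  by apply: (mem_occ a b k k) bk; apply: (z1 _ _ (Ordinal kN)); rewrite ab.
- move=> a k m km am; have /= mN := sN _ am; have kN := ltn_trans km mN.
  by apply: (mem_occ a a k m) am; apply: (z2 _ (Ordinal kN) (Ordinal mN)).
- move=> a k m km ak; apply/negP => am; have /= mN := sN _ am; have /= kN := sN _ ak.
  have := z3 a (Ordinal kN) (Ordinal mN) km.
  by rewrite /occ /= ak am mulr1 => /eqP; rewrite oner_eq0.
Qed.

Lemma down_closed_count a s : uniq s ->
  (forall k m, (k < m)%N -> (a, m) \in s -> (a, k) \in s) ->
  forall k, ((a, k) \in s) = (k < count (fun x => x.1 == a) s)%N.
Proof.
move=> us down k; pose T := [seq x.2 | x <- s & x.1 == a].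
have memT m : (m \in T) = ((a, m) \in s).
  apply/mapP/idP => [[[b n]]|ams].
    by rewrite mem_filter /= => /andP[/eqP -> bn] ->.
  by exists (a, m); rewrite ?mem_filter ?eqxx.
have bilin : uniq T.
  rewrite map_inj_in_uniq ?filter_uniq // => -[b m] [c n].
  by rewrite !mem_filter /= => /andP[/eqP -> _] /andP[/eqP -> _] ->.
have -> : count (fun x => x.1 == a) s = size T by rewrite size_map size_filter.
rewrite -memT; apply/idP/idP => kT.
  have sub : {subset iota 0 k.+1 <= T}.
    move=> m; rewrite mem_iota add0n /= ltnS leq_eqVlt => /orP[/eqP ->//|mk].
    by rewrite memT (down _ _ mk) // -memT.
  by have := uniq_leq_size (iota_uniq _ _) sub; rewrite size_iota.
apply: contraTT kT => kT; rewrite -leqNgt -[leqRHS](size_iota 0).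
apply: uniq_leq_size => // m mT; rewrite mem_iota add0n /=.
rewrite ltnNge leq_eqVlt; apply: contra kT => /orP[/eqP ->//|km].
by rewrite memT (down _ _ km) // -memT.
Qed.

Variable lam : l.-tuple nat.

(* The modes filled in the joint highest weight vector of weight lam, on which
   the reflection (-1)^alpha acts by (-1)^eps. *)
Definition hw_mode (eps : bool) x : bool :=
  match x.1 with
  | Some (true, p) => (x.2 < tnth lam p)%N || (eps && (x.2 == 0%N))
  | None => eps && (x.2 == 0%N)
  | Some (false, p) => [&& eps, x.2 == 0%N & tnth lam p == 0%N]
  end.

(** As [None] is its own [bar], the third condition confines [phi] to mode 0, and parity decides
    whether it is filled. The minus species come after [None] in [rk], so they too are confined to
    mode 0 and need [phi] there. If [phi] is filled, so is mode 0 of every plus species, and the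
    weight then fills the minus partner exactly when the part is 0. *)
Lemma closed_hw_mode eps s : uniq s -> hw_closed s ->
  (forall p : 'I_l, (count (fun x => x.1 == Some (true, p)) s =
     tnth lam p + count (fun x => x.1 == Some (false, p)) s)%N) ->
  odd (phi_count s) = eps -> s =i hw_mode eps.
Proof.
move=> us [c1 c2 c3] wt par.
have phi_pos k : (None, k.+1) \notin s.
  apply/negP => ks; have k0 := c2 None 0%N k.+1 isT ks.
  by have := c3 None 0%N k.+1 isT k0; rewrite /= ks.
have phi0 : ((None, 0%N) \in s) = eps.
  rewrite -par -(oddb (_ \in s)) -(count_uniq_mem (None, 0%N) us); congr odd.
  apply: eq_in_count => -[a [|k]] ks /=; first by rewrite xpair_eqE andbT.
  rewrite xpair_eqE andbF; case: eqP => //= E.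
  by have := phi_pos k; rewrite -E ks.
have minus_pos p k : (Some (false, p), k.+1) \notin s.
  apply/negP => ks; have /negP := phi_pos k; apply.
  by apply: (c1 None _ _ _ _ ks) => //=; have := ltn_ord p; lia.
have minusE p : count (fun x => x.1 == Some (false, p)) s =
  ((Some (false, p), 0%N) \in s).
  rewrite -(count_uniq_mem _ us).
  apply: eq_in_count => -[a [|k]] ks /=; first by rewrite xpair_eqE andbT.
  rewrite xpair_eqE andbF; case: eqP => //= E.
  by have := minus_pos p k; rewrite -E ks.
have plusE p := down_closed_count us (c2 (Some (true, p))).
have minus0 p : ((Some (false, p), 0%N) \in s) = eps && (tnth lam p == 0%N).
  rewrite -phi0; have [phi_s|phi_s] := boolP ((None, 0%N) \in s); last first.
    apply: contraNF phi_s => ks.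
    by apply: (c1 None _ _ _ _ ks) => //=; have := ltn_ord p; lia.
  have plus0 : (Some (true, p), 0%N) \in s.
    by apply: (c1 _ _ _ _ _ phi_s) => //=; apply: ltn_ord.
  apply/idP/eqP => [ks|lp].
    have : (Some (true, p), 1%N) \notin s.
      by apply: (c3 (Some (false, p)) 0%N 1%N).
    by rewrite plusE wt minusE ks; lia.
  by move: plus0; rewrite plusE wt minusE lp; case: (_ \in s).
case=> [[[[] p]|] k]; rewrite [RHS]unfold_in /hw_mode /=.
- rewrite plusE wt minusE minus0; case: eps {par phi0} minus0 => minus0 /=; last lia.
  by case: (tnth lam p) => [|m] /=; lia.
- by case: k => [|k]; rewrite ?minus0 ?andbT ?eqxx //= (negbTE (minus_pos p k)) andbF.
- by case: k => [|k]; rewrite ?phi0 ?andbT //= (negbTE (phi_pos k)) andbF.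
Qed.

End Diagonal.

(** * Joint highest weight vectors *)

Lemma ltn_ext m n : (forall k, (k < m)%N = (k < n)%N) -> m = n.
Proof. by move=> E; have := E m; have := E n; lia. Qed.

Section HighestWeightVectors.
Variables (K : numFieldType) (l : nat) (F : fock_space K l).
Variable lam : l.-tuple nat.
Local Notation A := (option (bool * 'I_l)).
Local Notation mode := (A * nat)%type.
Local Notation u := (fmode F).
Local Notation bilin := (@bilin K l F).
Local Notation so_op := (@so_op K l F).
Local Notation bar := (@bar l).
Local Notation cr := (cr F).
Local Notation an := (an F).
Local Notation mono := (mono F).
Local Notation rk := (@rk l).
Local Notation L0 := (@fock_L0 K l F).
Local Notation sgn := (sign_pow (@fock_alpha K l F)).
Local Notation diag_op := (@diag_op K l F).
Local Notation casimir_d := (@casimir_d K l F).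
Implicit Types (a b : A) (i j : int) (v w : F) (x y z : mode) (s : seq mode) (eps : bool).

Lemma so_op_opp a b v : so_op (bar b) (bar a) v = - so_op a b v.
Proof.
have [N vN] := ex_below v; rewrite !(so_opE _ _ vN (leqnn N)) sum_win_refl -sumrN.
by apply: eq_bigr => i _; rewrite nprod_opp.
Qed.

Lemma so_op_bar a v : so_op a (bar a) v = 0.
Proof.
have := so_op_opp a (bar a) v; rewrite barK => /eqP.
by rewrite -subr_eq0 opprK -mulr2n -scaler_nat scaler_eq0 pnatr_eq0 => /eqP.
Qed.

Lemma so_hw_spaceE v : so_hw_space lam v <-> hw_killed v /\
  forall p, so_op (Some (true, p)) (Some (true, p)) v = (tnth lam p)%:R *: v.
Proof.
split=> [[wt X1 X2 X3]|[kill wt]]; split.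
- move=> [[[] p]|] [[[] q]|] /= rkab.
  + by rewrite -so_eE X1.
  + have [<-|pq] := eqVneq p q; first exact: (so_op_bar (Some (true, p))).
    by rewrite -so_e2E X2.
  + by rewrite -so_e1E X3.
  + by have := ltn_ord p; have := ltn_ord q; lia.
  + have := so_op_opp (Some (true, q)) (Some (true, p)) v; rewrite /= => ->.
    by rewrite -so_eE X1 ?oppr0 //; have := ltn_ord p; have := ltn_ord q; lia.
  + by have := ltn_ord p; lia.
  + by have := ltn_ord q; lia.
  + have := so_op_opp (Some (true, q)) None v; rewrite /= => ->.
    by rewrite -so_e1E X3 oppr0.
  + by rewrite ltnn in rkab.
- by move=> p; rewrite -so_eE wt.
- by move=> p; rewrite so_eE wt.
- by move=> p q pq; rewrite so_eE kill.
- move=> p q pq; rewrite so_e2E kill //=.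
  by have := ltn_ord p; have := ltn_ord q; lia.
- by move=> p; rewrite so_e1E kill //=.
Qed.

Definition hw_half eps : set F :=
  [set v | so_hw_space lam v /\ sgn v = (-1) ^+ eps *: v].

Lemma so_hw_space_subspace : subspace (so_hw_space (F := F) lam).
Proof.
split.
  apply/so_hw_spaceE; split=> [a b _|p]; first exact: (lfun0 (so_op_linear _ _)).
  by rewrite (lfun0 (so_op_linear _ _)) scaler0.
move=> c v w /so_hw_spaceE[kv wv] /so_hw_spaceE[kw ww]; apply/so_hw_spaceE.
split=> [a b ab|p]; first by rewrite so_op_linear kv // kw // scaler0 addr0.
by rewrite so_op_linear wv ww scalerDr !scalerA mulrC.
Qed.

Lemma hw_half_subspace eps : subspace (hw_half eps).
Proof. exact: (eigen_subspace (@sgn_linear K l F) _ so_hw_space_subspace). Qed.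

Lemma so_hw_space_fock_act X v : dinf X -> so_hw_space lam v ->
  so_hw_space lam (fock_act X v).
Proof.
move=> [bX aX] /so_hw_spaceE[kv wv]; apply/so_hw_spaceE.
have lX := fock_act_linear (F := F) bX.
split=> [a b ab|p]; first by rewrite so_op_fock_act // kv // (lfun0 lX).
by rewrite so_op_fock_act // wv (lfunZ lX).
Qed.

Lemma hw_half_fock_act eps X v : dinf X -> hw_half eps v -> hw_half eps (fock_act X v).
Proof.
move=> dX [Wv sv]; split; first exact: so_hw_space_fock_act.
by case: dX => bX _; rewrite sgn_fock_act // sv (lfunZ (fock_act_linear bX)).
Qed.

Lemma so_hw_space_sgn v : so_hw_space lam v -> so_hw_space lam (sgn v).
Proof.
have E a b w : so_op a b (sgn w) = (phi_sign K a * phi_sign K b) *: sgn (so_op a b w).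
  by rewrite sgn_so_op scalerA mulrACA !phi_signK mulr1 scale1r.
move=> /so_hw_spaceE[kv wv]; apply/so_hw_spaceE; split=> [a b ab|p].
  by rewrite E kv // (lfun0 (@sgn_linear K l F)) scaler0.
by rewrite E wv phi_signK scale1r (lfunZ (@sgn_linear K l F)).
Qed.

Lemma sgnK v : sgn (sgn v) = v.
Proof.
have [L [_ ->]] := spannedT v; have lS := @sgn_linear K l F.
rewrite !(lfun_sum lS); apply: eq_bigr => y _.
rewrite !(lfunZ lS) sgn_mono (lfunZ lS) sgn_mono; congr (_ *: _).
by rewrite scalerA -expr2 sqrr_sign scale1r.
Qed.

(** For [eps = true] these are the rows of the diagram obtained from lambda, with [j] non-zero
    parts, by lengthening the first column from [j] to [2l+1-j]: Weyl's label for the twist by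
    det. *)
Definition row_len eps a : nat :=
  match a with
  | Some (true, p) => tnth lam p + (eps && (tnth lam p == 0%N))
  | None => eps
  | Some (false, p) => eps && (tnth lam p == 0%N)
  end.

Lemma hw_modeE eps a k : hw_mode lam eps (a, k) = (k < row_len eps a)%N.
Proof.
case: a => [[[] p]|]; rewrite /hw_mode /=; case: eps => /=.
- by case: (tnth lam p) => [|m] /=; lia.
- by lia.
- by case: (tnth lam p) => [|m] /=; lia.
- by lia.
- by lia.
- by lia.
Qed.

(** The successor in the range keeps mode 0 when lambda is zero, since [eps = true] still fills
    it. *)
Definition hw_seq eps : seq mode :=
  [seq x <- [seq (a, k) | a <- enum {: A}, k <- iota 0 (\max_(p < l) tnth lam p).+1] |
    hw_mode lam eps x].

Lemma hw_seq_uniq eps : uniq (hw_seq eps).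
Proof.
rewrite filter_uniq // allpairs_uniq ?enum_uniq ?iota_uniq //.
by move=> [a k] [b m] _ _ [-> ->].
Qed.

Lemma mem_hw_seq eps : hw_seq eps =i hw_mode lam eps.
Proof.
move=> [a k]; rewrite mem_filter [RHS]unfold_in andb_idr // hw_modeE => H.
apply/allpairsP; exists (a, k); rewrite mem_enum mem_iota /= add0n ltnS; split=> //.
case: a H => [[[] p]|] /= H.
- apply: (@leq_trans (tnth lam p)); last exact: (leq_bigmax p).
  by move: H; case: eps; case: (tnth lam p) => [|m] /=; lia.
- by move: H; case: eps => //=; case: eqP => //= _; lia.
- by move: H; case: eps => //=; lia.
Qed.

Lemma in_hw_seq eps a k : ((a, k) \in hw_seq eps) = (k < row_len eps a)%N.
Proof. by rewrite mem_hw_seq -hw_modeE. Qed.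

Lemma tnth_sorted (p q : 'I_l) : sorted geq lam ->
  (p <= q)%N -> (tnth lam q <= tnth lam p)%N.
Proof.
move=> lam_sorted pq; rewrite !(tnth_nth 0%N).
have geqT : transitive geq by move=> y x z /= yx zy; apply: leq_trans yx.
have geqR : reflexive geq by move=> x /=.
by apply: (sorted_leq_nth geqT geqR 0%N lam_sorted); rewrite ?inE ?size_tuple.
Qed.

Lemma closed_hw_seq eps : sorted geq lam -> hw_closed (hw_seq eps).
Proof.
move=> lam_sorted.
have row a b : (rk a < rk b)%N -> a != bar b -> (row_len eps b <= row_len eps a)%N.
  case: a b => [[[] p]|] [[[] q]|] //= pq pbar; rewrite ?pbar //;
    try (have lp := ltn_ord p); try (have lq := ltn_ord q); try by lia.
  - have := tnth_sorted lam_sorted (ltnW pq).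
    by case: eps; case: (tnth lam q) => [|m]; case: (tnth lam p) => [|n] //=;
      rewrite ?addn0 ?addn1 // => mn; lia.
  - have qp : (q <= p)%N by lia.
    have := tnth_sorted lam_sorted qp; case: eps => //=.
    by case: (tnth lam q) => [|m]; case: (tnth lam p) => [|n].
split=> a.
- move=> b k ab abar; rewrite !in_hw_seq.
  by move/leq_trans; apply; apply: row.
- move=> k m km; rewrite !in_hw_seq.
  exact: ltn_trans.
- move=> k m; rewrite !in_hw_seq {row}.
  by case: a => [[[] p]|] /=; case: eps => /=; lia.
Qed.

Lemma count_row s a : uniq s -> hw_closed s -> forall c,
  (forall k, ((a, k) \in s) = (k < c)%N) -> count (fun x => x.1 == a) s = c.
Proof.
move=> us [_ c2 _] c H; apply: ltn_ext => k.
by rewrite -H (down_closed_count us (c2 a)).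
Qed.

Lemma count_hw_seq eps a : sorted geq lam -> count (fun x => x.1 == a) (hw_seq eps) =
  row_len eps a.
Proof.
move=> ls; apply: count_row; [exact: hw_seq_uniq|exact: closed_hw_seq|move=> k].
exact: in_hw_seq.
Qed.

Lemma below_mono N s : {in s, forall x, (x.2 < N)%N} -> below N (mono s).
Proof.
move=> sN a i iN.
have -> : u a i = an (bar a, `|i|%N) by rewrite /an /= barK; congr (fmode F); lia.
by apply: an_mono_notin; apply/negP => /sN /=; lia.
Qed.

Lemma closed_killed s a b : uniq s -> hw_closed s -> (rk a < rk b)%N ->
  so_op a b (mono s) = 0.
Proof.
move=> us [c1 _ _] ab; have [->|abar] := eqVneq a (bar b).
  by have := so_op_bar (bar b) (mono s); rewrite barK.
have [N sN] := ex_below (mono s); rewrite (so_op_modes _ _ sN) big1 // => k _.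
have H c d m : (rk c < rk d)%N -> c != bar d -> cr (c, m) (an (d, m) (mono s)) = 0.
  move=> cd cbar; have [ds|ds] := boolP ((d, m) \in s); last first.
    by rewrite an_mono_notin // (linear0 (cr (c, m))).
  rewrite cr_an xpair_eqE (_ : d == c = false) ?scale0r ?sub0r; last first.
    by apply: contraTF cd => /eqP ->; rewrite ltnn.
  rewrite cr_mono_in; first by rewrite (linear0 (an (d, m))) oppr0.
  exact: c1 ds.
rewrite !H ?subrr ?rk_bar_lt //.
by apply: contraNneq abar => ->; rewrite !barK.
Qed.

Lemma closed_bilin s i j : uniq s -> hw_closed s -> i < j -> bilin i j (mono s) = 0.
Proof.
move=> us [_ c2 c3] ij.
have pp k m : (k < m)%N -> bilin (Posz k.+1) (Posz m.+1) (mono s) = 0.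
  move=> km; rewrite bilin_pp big1 // => a _.
  have [ms|ms] := boolP ((a, m) \in s); last first.
    by rewrite an_mono_notin // (linear0 (cr (a, k))).
  rewrite cr_an xpair_eqE eqxx (_ : m == k = false) ?scale0r ?sub0r; last by lia.
  rewrite cr_mono_in; first by rewrite (linear0 (an (a, m))) oppr0.
  exact: c2 ms.
have [j0|j0] := leP j 0.
  have -> : i = 1 - (1 - i) by lia.
  have -> : j = 1 - (1 - j) by lia.
  rewrite bilin_anti.
  have -> : 1 - i = Posz `|i|.+1 by lia.
  have -> : 1 - j = Posz `|j|.+1 by lia.
  by rewrite pp ?oppr0 //; lia.
have [i0|i0] := leP i 0; last first.
  have -> : i = Posz (`|i|.-1).+1 by lia.
  have -> : j = Posz (`|j|.-1).+1 by lia.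
  by rewrite pp //; lia.
(* Here [i <= 0 < j]. If [i = 1 - j], which the closure condition [c3] does not cover, antisymmetry
   makes the operator its own negative. *)
have [km|km] := eqVneq `|i|%N (`|j|.-1)%N.
  apply/eqP; have /eqP := bilin_anti i j (mono s).
  have -> : 1 - j = i by lia.
  have -> : 1 - i = j by lia.
  by rewrite -subr_eq0 opprK -mulr2n -scaler_nat scaler_eq0 pnatr_eq0.
have -> : i = - Posz `|i| by lia.
have -> : j = Posz (`|j|.-1).+1 by lia.
rewrite bilin_np big1 // => a _.
have [as_|as_] := boolP ((a, `|j|.-1%N) \in s).
  rewrite an_an an_mono_notin; first by rewrite (linear0 (an _)) oppr0.
  by apply: c3 as_; rewrite eq_sym.
by rewrite (an_mono_notin F as_) (linear0 (an _)).
Qed.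

Lemma hw_seq_half eps : sorted geq lam -> hw_half eps (mono (hw_seq eps)).
Proof.
move=> ls; split; last first.
  by rewrite sgn_mono /phi_count (count_hw_seq eps None).
apply/so_hw_spaceE; split=> [a b ab|p].
  by apply: closed_killed => //; [exact: hw_seq_uniq|exact: closed_hw_seq].
by rewrite so_op_diag_mono !count_hw_seq //= natrD addrK.
Qed.

(** A fermion in mode [k] contributes [2k+1] to twice the energy, so energy [n/2] forces [k < n].
    This is why the Casimir is truncated at [n] on this eigenspace. *)
Lemma spanned_energy n v : L0 v = (n%:R / 2) *: v ->
  spanned (fun s => uniq s && all (fun x => x.2 < n)%N s) v.
Proof.
move=> Lv; have := spanned_sieve (P := fun s => uniq s) (@fock_L0_linear K l F)
  (fun s _ => @fock_L0_mono K l F s) Lv (spannedT v).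
apply: spanned_sub => s /andP[-> ] /=.
rewrite (inj_eq (mulIf _)) ?invr_neq0 ?pnatr_eq0 // eqr_nat => /eqP <-.
apply/allP => x xs; rewrite /energy2 (big_rem x) //=; lia.
Qed.

Lemma below_subspace N : subspace (@below K l F N).
Proof.
split; first by move=> a i _; rewrite (linear0 (u a i)).
by move=> c v w vN wN a i iN; rewrite linearP vN // wN // scaler0 addr0.
Qed.

Lemma below_energy n v : L0 v = (n%:R / 2) *: v -> below n v.
Proof.
move=> /spanned_energy[L [PL ->]]; rewrite big_seq.
apply: (subspace_sum (below_subspace n)) => y yL _.
apply: (subspaceZ (below_subspace n)); apply: below_mono => x xs.
by have /andP[_ /allP /(_ x xs)] := allP PL y yL.
Qed.

(** The expansion of [v] is sieved by energy, by the eigenvalue 0 of [diag_op], by sign and by the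
    [l] weights. Each surviving monomial fills exactly the modes of [hw_seq eps], so it is a
    multiple of one vector. *)
Lemma hw_half_unique eps n v : hw_half eps v -> L0 v = (n%:R / 2) *: v ->
  diag_op n v = 0 -> exists c, v = c *: mono (hw_seq eps).
Proof.
move=> [/so_hw_spaceE[kv wv] sv] Lv Dv.
pose P s := uniq s && all (fun x => x.2 < n)%N s.
pose wt p s : K := (count (fun x => x.1 == Some (true, p)) s)%:R -
  (count (fun x => x.1 == Some (false, p)) s)%:R.
have S1 : spanned (fun s => P s && (diag_val K n s == 0)) v.
  apply: (spanned_sieve (@diag_op_linear K l F n) _ _ (spanned_energy Lv)).
    by move=> s /andP[us _]; apply: diag_op_mono.
  by rewrite scale0r.
have S2 : spanned (fun s => (P s && (diag_val K n s == 0)) &&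
    ((-1) ^+ phi_count s == (-1) ^+ eps :> K)) v.
  by apply: (spanned_sieve (@sgn_linear K l F) _ sv S1) => s _; apply: sgn_mono.
have S3 : spanned (fun s => [&& (P s && (diag_val K n s == 0)),
    ((-1) ^+ phi_count s == (-1) ^+ eps :> K) &
    all (fun p => wt p s == (tnth lam p)%:R) (enum 'I_l)]) v.
  elim: (enum 'I_l) => [|p ps IH] /=.
    by apply: spanned_sub S2 => s; rewrite andbT.
  have := spanned_sieve (so_op_linear _ _) (fun s _ =>
    so_op_diag_mono F (Some (true, p)) s) (wv p) IH.
  apply: spanned_sub => s /andP[/and3P[-> -> ->] E]; rewrite /= andbT.
  exact: E.
have [L [PL ->]] := S3.
have /choice[c cE] : forall y : K * seq mode, exists c : K, y \in L -> mono y.2 =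
  c *: mono (hw_seq eps).
  move=> y; have [yL|_] := boolP (y \in L); last by exists 0.
  have /and3P[/andP[/andP[us sn] /eqP D0] /eqP par /allP wts] := allP PL y yL.
  have [|c E] := @mono_perm K l F y.2 (hw_seq eps); last by exists c.
  apply: uniq_perm => //; first exact: hw_seq_uniq.
  move=> x; rewrite mem_hw_seq; move: x; apply: closed_hw_mode => //.
  - by apply: (diag_val_eq0 (K := K) (N := n)) => // x xs; apply: (allP sn).
  - move=> p; have := wts p (mem_enum _ p).
    by rewrite /wt subr_eq -natrD eqr_nat => /eqP.
  - move: par; rewrite -signr_odd; case: (odd _); case: (eps) => //.
      by move=> /eqP; rewrite expr0 expr1 -subr_eq0 -opprD oppr_eq0 (pnatr_eq0 _ 2).
    by move=> /eqP; rewrite expr0 expr1 eq_sym -subr_eq0 -opprD oppr_eq0 (pnatr_eq0 _ 2).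
exists (\sum_(y <- L) y.1 * c y); rewrite scaler_suml big_seq [RHS]big_seq.
by apply: eq_bigr => y yL; rewrite cE // scalerA.
Qed.

End HighestWeightVectors.

(** * Irreducibility *)

Section Generators.
Variables (K : numFieldType) (l : nat) (F : fock_space K l).
Local Notation bilin := (@bilin K l F).
Local Notation L0 := (@fock_L0 K l F).
Implicit Types (i j : int) (v w : F).

Definition dgen i j : zmat K * K :=
  (zmat_unit K i j - zmat_unit K (1 - j) (1 - i), 0).

Lemma dinf_dgen i j : dinf (dgen i j).
Proof.
split.
  exists `|i - j|%N => p q pq; rewrite /= !fctE /zmat_unit.
  have -> : (p == i) && (q == j) = false by lia.
  have -> : (p == 1 - j) && (q == 1 - i) = false by lia.
  by rewrite subrr.
move=> p q; rewrite /= !fctE /zmat_unit opprB.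
have -> : (1 - q == i) && (1 - p == j) = (p == 1 - j) && (q == 1 - i) by lia.
by have -> : (1 - q == 1 - j) && (1 - p == 1 - i) = (p == i) && (q == j) by lia.
Qed.

Lemma fock_act_dgen i j v : fock_act (dgen i j) v = bilin i j v.
Proof.
have [[b bX] _] := dinf_dgen i j; have [N vN] := ex_below v.
pose M := (N + b + `|i| + `|j| + 2)%N.
rewrite (fock_actE bX vN (M := M)); last by rewrite /M; lia.
rewrite /act_win mul0r scale0r addr0.
have unitE p q : p \in win M -> q \in win M ->
    \sum_(i0 <- win M) \sum_(j0 <- win M) zmat_unit K p q i0 j0 *: bilin i0 j0 v =
      bilin p q v.
  move=> pM qM; under eq_bigr => i0 _ do under eq_bigr => j0 _ do
    rewrite /zmat_unit -mulnb natrM -scalerA.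
  under eq_bigr do rewrite -scaler_sumr sum_win_delta //.
  exact: sum_win_delta.
have -> : \sum_(i0 <- win M) \sum_(j0 <- win M) (dgen i j).1 i0 j0 *: bilin i0 j0 v =
    bilin i j v - bilin (1 - j) (1 - i) v.
  rewrite -(unitE i j) ?mem_win; try by rewrite /M; lia.
  rewrite -(unitE (1 - j) (1 - i)) ?mem_win; try by rewrite /M; lia.
  rewrite -sumrB; apply: eq_bigr => i0 _; rewrite -sumrB; apply: eq_bigr => j0 _.
  by rewrite -scalerBl.
by rewrite bilin_anti opprK -mulr2n -scaler_nat scalerA mulVf ?pnatr_eq0 // scale1r.
Qed.

Lemma fock_L0_bilin c i j v : L0 v = c *: v ->
  L0 (bilin i j v) = (c + i%:~R - j%:~R) *: bilin i j v.
Proof.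
move=> Lv; have cX := @denergy_cartan K; have lX := @fock_L0_linear K l F.
(* The index [p] stands for the mode [1/2 - p], so [u a p] raises the energy by [p - 1/2]; the two
   halves give the -1. *)
have L0_uu a p q : L0 (fmode F a p (fmode F (bar a) q v)) =
    (c + p%:~R + q%:~R - 1) *: fmode F a p (fmode F (bar a) q v).
  rewrite !fock_L0E !fock_act_diag_u // linearD uZ -fock_L0E Lv uZ uZ -!scalerDl.
  by congr (_ *: _); rewrite /= !eqxx; field.
rewrite /bilin (lfun_sum lX) scaler_sumr; apply: eq_bigr => a _.
rewrite (lfunB lX) (lfunZ lX) L0_uu Lv scalerBr !scalerA; congr (_ *: _ - _ *: _).
  by rewrite rmorphB /=; ring.
by case: eqP => [->|_]; rewrite ?mulr0 ?mul0r // [_ * c]mulrC addrK.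
Qed.

Lemma bilin_lowers n i j v : i < j -> L0 v = (n%:R / 2) *: v -> bilin i j v != 0 ->
  exists2 m : nat, (m < n)%N & L0 (bilin i j v) = (m%:R / 2) *: bilin i j v.
Proof.
move=> ij Lv nz; have LT := fock_L0_bilin i j Lv.
have [m mE] := energy_nat LT nz; exists m; last by rewrite LT mE.
have E : (n%:Z + 2 * i - 2 * j)%:~R = m%:Z%:~R :> K.
  have -> : m%:Z%:~R = 2 * (m%:R / 2) :> K by rewrite mulrC divfK ?pnatr_eq0.
  by rewrite -mE !rmorphD rmorphN !rmorphM /= -[n%:~R]/(n%:R); field.
by have /eqP := E; rewrite eqr_int => /eqP; lia.
Qed.

Lemma fock_act_raising X v : dinf_raising X -> (forall i j, i < j -> bilin i j v = 0) ->
  fock_act X v = 0.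
Proof.
move=> [[bX _] X2 Xr] v0; have [N H] := ex_act_win v bX.
rewrite (H N.+1) // /act_win X2 mul0r scale0r addr0 big1 ?scaler0 // => i _.
rewrite big1 // => j _; have [ij|ij] := boolP (i < j); first by rewrite v0 ?scaler0.
by rewrite Xr // scale0r.
Qed.

End Generators.

Section ShiftProd.
Variables (K : numFieldType) (V : lmodType K) (T : V -> V).
Hypothesis linT : linear T.

(** Modulo the [T]-stable subspace [U] the vector [T v] is zero, so each factor [T - t] acts on the
    class of [v] as [- t]. *)
Lemma shift_prod_mod U r v : subspace U -> (forall w, U w -> U (T w)) -> U (T v) ->
  U (shift_prod T r v - (\prod_(t <- r) - t) *: v).
Proof.
move=> sU TU UTv; elim: r => [|t r IH] /=.
  by rewrite big_nil scale1r subrr; exact: sU.1.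
rewrite -/(shift_prod T r v) big_cons; set p := \prod_(_ <- _) _ in IH *.
set w := shift_prod T r v in IH *.
have -> : T w - t *: w - (- t * p) *: v = T (w - p *: v) - t *: (w - p *: v) + p *: T v.
  rewrite (lfunB linT) (lfunZ linT) scalerBr scalerA [RHS]addrAC subrK opprB.
  by rewrite mulNr scaleNr opprK [RHS]addrA addrAC.
apply: (subspaceD sU); last exact: (subspaceZ sU).
by apply: (subspaceB sU); [apply: TU|apply: (subspaceZ sU)].
Qed.

End ShiftProd.

Section Irreducibility.
Variables (K : numFieldType) (l : nat) (F : fock_space K l).
Variables (lam : l.-tuple nat) (eps : bool).
Local Notation bilin := (@bilin K l F).
Local Notation L0 := (@fock_L0 K l F).
Local Notation diag_op := (@diag_op K l F).
Local Notation casimir_d := (@casimir_d K l F).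
Local Notation W := (@hw_half K l F lam eps).
Local Notation w0 := (mono F (hw_seq lam eps)).
Implicit Types (i j : int) (v w z : F).

Let lL := @fock_L0_linear K l F.

Lemma hw_half_bilin i j v : W v -> W (bilin i j v).
Proof. by rewrite -fock_act_dgen; apply: hw_half_fock_act; apply: dinf_dgen. Qed.

Lemma casimir_energy n c v : L0 v = c *: v -> L0 (casimir_d n v) = c *: casimir_d n v.
Proof.
move=> Lv; have sE : subspace (eigen_in setT L0 c) by apply: eigen_subspace.
suff [] : eigen_in setT L0 c (casimir_d n v) by [].
have H i j : eigen_in setT L0 c (bilin i j (bilin j i v)).
  by split=> //; rewrite (fock_L0_bilin _ _ (fock_L0_bilin _ _ Lv)); congr (_ *: _); ring.
apply: (subspaceD sE).
  by apply: (subspace_sumT sE) => k; apply: (subspace_sum sE) => m _ _; apply: H.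
by apply: (subspaceZ sE); do 2![apply: (subspace_sumT sE) => ?]; apply: H.
Qed.

Variable Z : set F.
Hypotheses (sZ : subspace Z) (ZW : Z `<=` W).
Hypothesis ZT : forall i j v, Z v -> Z (bilin i j v).

Lemma casimir_closed n v : (forall i j, i < j -> Z (bilin i j v)) -> Z (casimir_d n v).
Proof.
move=> vT; apply: (subspaceD sZ).
  apply: (subspace_sumT sZ) => k; apply: (subspace_sum sZ) => m _ km.
  by apply/ZT/vT.
apply: (subspaceZ sZ); do 2![apply: (subspace_sumT sZ) => ?].
by apply/ZT/vT; lia.
Qed.

(** Descent on the energy: a raising operator that does not kill [z] produces a non-zero vector of
    [Z] of lower energy. If all of them kill [z], the Casimir and hence [diag_op] kill it too, and
    [z] is a multiple of [w0]. *)
Lemma hw_vector_in n z : Z z -> L0 z = (n%:R / 2) *: z -> z != 0 -> Z w0.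
Proof.
elim/ltn_ind: n z => n IH z Zz Lz z0.
have [[i [j [ij Tz]]]|noT] := pselect (exists i j, i < j /\ bilin i j z != 0).
  have [m mn LT] := bilin_lowers ij Lz Tz.
  by apply: (IH m mn _ _ LT Tz); apply: ZT.
have Tz i j : i < j -> bilin i j z = 0.
  by move=> ij; apply: contrapT => /eqP Tz; apply: noT; exists i, j.
have [Wz _] := ZW Zz; have /so_hw_spaceE[kz _] := Wz.
have := casimir_dE (below_energy Lz) kz.
rewrite /casimir_d big1 => [|k _]; last first.
  by rewrite big1 // => m km; rewrite Tz // (lfun0 (bilin_linear _ _)).
rewrite big1 => [|k _]; last first.
  by rewrite big1 // => m _; rewrite Tz ?(lfun0 (bilin_linear _ _)) //; lia.
rewrite scaler0 add0r => /esym Dz.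
have [c zE] := hw_half_unique (ZW Zz) Lz Dz.
have c0 : c != 0 by apply: contraNneq z0 => c0; rewrite zE c0 scale0r.
have -> : w0 = c^-1 *: z by rewrite zE scalerA mulVf // scale1r.
exact: (subspaceZ sZ).
Qed.

Lemma energy_in n v : Z w0 -> W v -> L0 v = (n%:R / 2) *: v -> Z v.
Proof.
move=> Zw; elim/ltn_ind: n v => n IH v Wv Lv.
have vT i j : i < j -> Z (bilin i j v).
  move=> ij; have [->|Tv] := eqVneq (bilin i j v) 0; first exact: sZ.1.
  have [m mn LT] := bilin_lowers ij Lv Tv.
  by apply: (IH m mn) => //; apply: hw_half_bilin.
pose U := eigen_in Z L0 (n%:R / 2).
have sU : subspace U by apply: eigen_subspace.
have DE w : W w -> L0 w = (n%:R / 2) *: w -> diag_op n w = casimir_d n w.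
  by move=> [/so_hw_spaceE[kw _] _] Lw; rewrite (casimir_dE (below_energy Lw)).
have UD w : U w -> U (diag_op n w).
  move=> [Zw' Lw]; rewrite DE //; last exact: ZW.
  by split; [apply: casimir_closed => i j _; apply: ZT|apply: casimir_energy].
have UDv : U (diag_op n v).
  by rewrite DE //; split; [apply: casimir_closed|apply: casimir_energy].
have [L [PL vE]] := spanned_energy Lv.
have linD := @diag_op_linear K l F n.
have eigL y : y \in L ->
    diag_op n (y.1 *: mono F y.2) = diag_val K n y.2 *: (y.1 *: mono F y.2).
  move=> yL; have /andP[us _] := allP PL y yL.
  by rewrite (lfunZ linD) diag_op_mono // !scalerA mulrC.
(* The polynomial with roots [q] sends [v] to [c *: v0], with [v0] the kernel part. Since
   [diag_op n v] lies in [U], it also sends [v] to [c *: v] modulo [U]. As [c != 0], the difference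
   [v - v0] lies in [U]. *)
pose q := [seq diag_val K n y.2 | y <- L & diag_val K n y.2 != 0].
pose v0 := \sum_(y <- L | diag_val K n y.2 == 0) y.1 *: mono F y.2.
have qE := shift_prod_sum linD 0 eigL; have q0 := shift_prod_neq0 L (fun y =>
  diag_val K n y.2) 0.
have Uq := shift_prod_mod linD q sU UD UDv.
move: qE q0 Uq; rewrite -/q -/v0 -vE => ->.
have -> : \prod_(s <- q) (0 - s) = \prod_(t <- q) - t.
  by apply: eq_bigr => t _; rewrite sub0r.
set c := \prod_(t <- q) - t => c0; rewrite -scalerBr => Uc.
have {Uc} Uv : U (v - v0).
  have := subspaceZ sU (- c^-1) Uc.
  by rewrite scalerA mulNr mulVf // scaleN1r opprB.
have v0E : v0 = v - (v - v0) by rewrite opprB addrC subrK.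
have Wv0 : W v0 by rewrite v0E; apply: (subspaceB (hw_half_subspace _ _ _)) => //;
  apply: ZW; case: Uv.
have Lv0 : L0 v0 = (n%:R / 2) *: v0.
  by have [_ Luv] := Uv; rewrite [in LHS]v0E (lfunB lL) Lv Luv -scalerBr -v0E.
have Dv0 : diag_op n v0 = 0.
  rewrite (lfun_sum linD) big_seq_cond big1 // => y /andP[yL /eqP y0].
  by rewrite eigL // y0 scale0r.
have [d v0w] := hw_half_unique Wv0 Lv0 Dv0.
rewrite -(subrK v0 v); apply: (subspaceD sZ); first by case: Uv.
by rewrite v0w; apply: (subspaceZ sZ).
Qed.

End Irreducibility.

Section Irreducible.
Variables (K : numFieldType) (l : nat) (F : fock_space K l).
Variables (lam : l.-tuple nat) (eps : bool).

Lemma hw_half_irreducible (Z : set F) : subspace Z -> Z `<=` hw_half lam eps ->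
  (forall X v, dinf X -> Z v -> Z (fock_act X v)) -> (exists2 z, Z z & z != 0) ->
  Z = hw_half lam eps.
Proof.
move=> sZ ZW ZX [z Zz z0].
have ZT i j v : Z v -> Z (bilin i j v).
  by rewrite -fock_act_dgen; apply: ZX; apply: dinf_dgen.
have dE : dinf (denergy K) by case: (denergy_cartan K).
have [N [w [wE zE]]] := energy_components sZ
  (fun w Zw => eq_ind_r Z (ZX _ w dE Zw) (fock_L0E w)) Zz.
have Zw : Z (mono F (hw_seq lam eps)).
  have [n wn0] : exists n, w n != 0.
    apply: contrapT => w0; move/eqP: z0; apply; rewrite zE big1 // => n _.
    by apply: contrapT => /eqP wn; apply: w0; exists n.
  by have [Zwn Lwn] := wE n; apply: (hw_vector_in sZ ZW ZT Zwn Lwn).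
apply/seteqP; split=> // v Wv.
have [N' [v' [v'E ->]]] := energy_components (hw_half_subspace F lam eps)
  (fun w Ww => eq_ind_r _ (hw_half_fock_act dE Ww) (fock_L0E w)) Wv.
apply: (subspace_sumT sZ) => n; have [Wvn Lvn] := v'E n.
exact: (energy_in sZ ZW ZT Zw Wvn Lvn).
Qed.

End Irreducible.

(** * The d_infinity-weights of the joint highest weight vectors *)

Section Partitions.
Implicit Types s : seq nat.

Lemma take_count_sorted k s : sorted geq s ->
  take (count (fun m => (k < m)%N) s) s = [seq m <- s | (k < m)%N].
Proof.
have geqT : transitive geq by move=> y x z /= yx zy; apply: leq_trans yx.
elim: s => //= m s IH; rewrite path_sortedE // => /andP[/allP ms ss].
have [km|mk] := ltnP; first by rewrite /= IH.
rewrite add0n -IH // (_ : count _ s = 0%N) ?take0 //.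
apply/eqP; rewrite -leqn0 leqNgt -has_count; apply/hasPn => n /ms /= nm.
by rewrite -leqNgt (leq_trans nm).
Qed.

Lemma sum_partition (R : comNzRingType) (G : nat -> R) s : G 0%N = 0 ->
  \sum_(m <- s) G m = \sum_(m <- s | (1 < m)%N) G m +
  ((count (fun m => (0 < m)%N) s)%:R - (count (fun m => (1 < m)%N) s)%:R) * G 1%N.
Proof.
move=> G0; elim: s => [|m s IH]; first by rewrite !big_nil /= subrr mul0r addr0.
rewrite !big_cons IH /=; case: m => [|[|m]] /=.
- by rewrite G0 !add0r.
- by rewrite !natrD; ring.
- by rewrite !natrD; ring.
Qed.

End Partitions.

Section Weights.
Variables (K : numFieldType) (l : nat) (F : fock_space K l) (lam : l.-tuple nat).
Hypothesis lam_sorted : sorted geq lam.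
Local Notation A := (option (bool * 'I_l)).
Implicit Types (X : zmat K * K) (eps : bool) (a : A).

Lemma sum_hw_seq eps (g : nat -> K) :
  \sum_(x <- hw_seq lam eps) g x.2 = \sum_a \sum_(0 <= k < row_len lam eps a) g k.
Proof.
rewrite (partition_big (fun x => x.1) xpredT) //=; apply: eq_bigr => a _.
rewrite -big_filter -[RHS](big_map (pair a) xpredT (fun x => g x.2)).
apply: perm_big; apply: uniq_perm.
- by rewrite filter_uniq // hw_seq_uniq.
- by rewrite map_inj_uniq ?iota_uniq // => k m [].
move=> [b k]; rewrite mem_filter in_hw_seq /=; apply/andP/mapP => [[/eqP -> ka]|[m]].
  by exists k; rewrite ?mem_index_iota.
by rewrite mem_index_iota => /andP[_ ma] [-> ->].
Qed.

Lemma fundwtE i X : fundwt i X = (if (i < 2)%N then X.2 / 2 else X.2) +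
  \sum_(0 <= k < i) X.1 (Posz k.+1) (Posz k.+1).
Proof. by rewrite /fundwt big_add1. Qed.

Lemma fundwt0 X : fundwt 0 X = X.2 / 2.
Proof. by rewrite fundwtE /= big_geq ?addr0. Qed.

Lemma fundwt1 X : fundwt 1 X = X.2 / 2 + X.1 (Posz 1) (Posz 1).
Proof. by rewrite fundwtE /= big_nat1. Qed.

Let i := count (fun m => (1 < m)%N) lam.
Let j := count (fun m => (0 < m)%N) lam.

Lemma sum_fundwt X : \sum_(m <- take i lam) fundwt m X = i%:R * X.2 +
  \sum_(m <- lam | (1 < m)%N) \sum_(0 <= k < m) X.1 (Posz k.+1) (Posz k.+1).
Proof.
rewrite take_count_sorted // big_filter.
have -> : i%:R * X.2 = \sum_(m <- lam | (1 < m)%N) X.2.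
  by rewrite big_const_seq iter_addr_0 mulr_natl.
rewrite -big_split; apply: eq_bigr => m m1 /=.
by rewrite fundwtE ltnNge m1.
Qed.

(** For [eps = true], [phi] contributes one copy of [X.1 1 1] and each of the [l - j] zero parts
    contributes two. With the [j - i] parts equal to 1 this makes [2l+1-i-j], the coefficient of
    [fundwt 1] in [Lambda_det]. *)
Lemma hw_weight eps X : dinf_cartan X -> fock_act X (mono F (hw_seq lam eps)) =
  (if eps then Lambda_det lam X else Lambda lam X) *: mono F (hw_seq lam eps).
Proof.
move=> cX; rewrite fock_act_diag_mono //; congr (_ *: _).
rewrite (sum_hw_seq eps (fun k => X.1 (Posz k.+1) (Posz k.+1))).
set g := fun k : nat => X.1 (Posz k.+1) (Posz k.+1).
pose G (m : nat) := \sum_(0 <= k < m) g k.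
have G0 : G 0%N = 0 by rewrite /G big_geq.
have G1 : G 1%N = g 0%N by rewrite /G big_nat1.
have EG : \sum_(m <- lam) G m =
    \sum_(m <- lam | (1 < m)%N) G m + (j%:R - i%:R) * G 1%N := sum_partition lam G0.
rewrite sum_species /=.
have Emm : \sum_(p < l) G (tnth lam p) = \sum_(m <- lam) G m by rewrite big_tuple.
case: eps => /=.
  rewrite /Lambda_det -/i -/j sum_fundwt fundwt0 fundwt1.
  have -> : \sum_(p < l) (\sum_(0 <= k < tnth lam p + (tnth lam p == 0%N)) g k +
      \sum_(0 <= k < (tnth lam p == 0%N)) g k) =
      \sum_(p < l) (G (tnth lam p) + (tnth lam p == 0%N)%:R * (2 * g 0%N)).
    apply: eq_bigr => p _; case: eqP => [->|_] /=.
      by rewrite -/(G _) G1 G0; ring.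
    by rewrite addn0 -/(G _) -/(G _) G0; ring.
  rewrite big_split -mulr_suml /= Emm EG.
  have -> : \sum_(p < l) (tnth lam p == 0%N)%:R = l%:R - j%:R :> K.
    rewrite -[X in X%:R - _](size_tuple lam) -(count_predC (fun m => 0 < m)%N) natrD.
    rewrite -/j addrC addKr -sum1_count natr_sum big_tuple [RHS]big_mkcond /=.
    by apply: eq_bigr => p _; rewrite -leqNgt leqn0; case: (_ == _).
  rewrite big_nat1 G1 -[X.1 1 1]/(g 0%N) natrD natrM.
  rewrite -/(\sum_(m <- lam | (1 < m)%N) G m).
  by set S := \sum_(_ <- _ | _) _; field.
rewrite /Lambda -/i -/j sum_fundwt fundwt0 fundwt1.
have -> : \sum_(p < l) (\sum_(0 <= k < tnth lam p + 0) g k + \sum_(0 <= k < 0) g k) =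
    \sum_(p < l) G (tnth lam p).
  by apply: eq_bigr => p _; rewrite addn0 -/(G 0%N) G0 addr0.
rewrite -/(G 0%N) G0 add0r.
rewrite Emm EG G1 -[X.1 1 1]/(g 0%N) natrD natrM.
rewrite -/(\sum_(m <- lam | (1 < m)%N) G m).
by set S := \sum_(_ <- _ | _) _; field.
Qed.

End Weights.

(** * Uniqueness of irreducible highest weight modules *)

Section Triangular.
Variable K : numFieldType.
Implicit Types (X Y : zmat K * K) (A : zmat K).

(** A banded matrix is a finite sum of its diagonals but not of matrix units, so whole diagonals
    [i - j = d] serve as the homogeneous elements; [d > 0] is lowering. *)
Definition restr (P : pred int) A : zmat K := fun i j => if P (i - j) then A i j else 0.

Lemma dinf_restr P X c : dinf X -> dinf (restr P X.1, c).
Proof.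
move=> [[b bX] aX]; split.
  by exists b => i j ij; rewrite /= /restr bX // if_same.
move=> i j; rewrite /= /restr (_ : 1 - j - (1 - i) = i - j); last by ring.
by case: ifP => _; rewrite ?oppr0.
Qed.

Lemma dinf_split X : X = dinf_lincomb 1 (restr (fun d => d < 0) X.1, 0)
  (dinf_lincomb 1 (restr (fun d => d == 0) X.1, X.2) (restr (fun d => 0 < d) X.1, 0)).
Proof.
case: X => A c; rewrite /dinf_lincomb /=; congr (_, _);
  last by rewrite mulr0 add0r mul1r addr0.
apply/funext => i; apply/funext => j; rewrite /restr !mul1r.
by case: ltgtP => _; rewrite ?add0r ?addr0.
Qed.

Lemma restr_lowerS n A : (restr (fun d => 0 < d <= n.+1%:Z) A, 0) =
  dinf_lincomb 1 (restr (pred1 n.+1%:Z) A, 0) (restr (fun d => 0 < d <= n%:Z) A, 0).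
Proof.
rewrite /dinf_lincomb /=; congr (_, _); last by rewrite mulr0 addr0.
apply/funext => i; apply/funext => j; rewrite /restr /= mul1r.
have [->|ne] := eqVneq (i - j) n.+1%:Z.
  have -> : (0 < n.+1%:Z <= n.+1%:Z) by lia.
  have -> : (0 < n.+1%:Z <= n%:Z) = false by lia.
  by rewrite addr0.
have -> : (0 < i - j <= n.+1%:Z) = (0 < i - j <= n%:Z) by lia.
by rewrite add0r.
Qed.

Lemma restr_lower_band b A : banded b A ->
  restr (fun d => 0 < d <= b%:Z) A = restr (fun d => 0 < d) A.
Proof.
move=> bA; apply/funext => i; apply/funext => j; rewrite /restr.
have [->|ne] := eqVneq (A i j) 0; first by rewrite !if_same.
have ij : (`|i - j| <= b)%N by rewrite leqNgt; apply: contraNN ne => /bA ->.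
by have -> : (0 < i - j <= b%:Z) = (0 < i - j) by lia.
Qed.

Lemma dinf_denergy : dinf (denergy K).
Proof. by case: (denergy_cartan K). Qed.

(** The energy element is diagonal and commutes with [J], so no central term arises. [restr pred0 A]
    is the zero matrix, which puts the right-hand side in the form that [dact_linear] accepts. *)
Lemma denergy_bracket (d : nat) A :
  dinf_bracket (denergy K) (restr (pred1 d%:Z) A, 0) =
  dinf_lincomb d%:R (restr (pred1 d%:Z) A, 0) (restr pred0 A, 0).
Proof.
have [_ diagD] := denergy_cartan K.
rewrite /dinf_bracket /dinf_lincomb; congr (_, _).
  apply/funext => i; apply/funext => j; rewrite (zmat_comm_diag _ _ _ diagD) /= !eqxx.
  rewrite /restr /= addr0; case: eqP => [E|]; last by rewrite !mulr0.
  by rewrite -[d%:R]/(d%:Z%:~R) -E rmorphB /=; congr (_ * _); ring.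
rewrite /= mulr0 addr0 /cocycle /zmat_tr fsbig1 // => i _.
rewrite /zmat_mul fsbig1 // => j _.
rewrite (zmat_comm_diag _ _ _ (@zmat_J_diag K)) /=.
case: eqP => [->|_]; last by rewrite mulr0 mul0r.
by rewrite subrr !mul0r.
Qed.

End Triangular.

Section Cyclic.
Variables (K : numFieldType) (V : dinf_module K) (L : zmat K * K -> K) (v0 : V).
Hypothesis raising_v0 : forall X, dinf_raising X -> dact V X v0 = 0.
Hypothesis cartan_v0 : forall X, dinf_cartan X -> dact V X v0 = L X *: v0.
Implicit Types (X Y : zmat K * K) (z : V).

Definition lower_closed (Z : set V) := forall X (d : nat) z,
  dinf X -> (0 < d)%N -> Z z -> Z (dact V (restr (pred1 d%:Z) X.1, 0) z).

(** The orbit of [v0] under products of lowering operators, defined as an intersection so that an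
    induction is an application to a suitable [Z]. *)
Definition hw_span : set V := [set z | forall Z : set V,
  subspace Z -> Z v0 -> lower_closed Z -> Z z].

Lemma hw_span_subspace : subspace hw_span.
Proof.
split; first by move=> Z [].
by move=> a u v Hu Hv Z sZ Zv0 ZL; apply: sZ.2; [apply: Hu|apply: Hv].
Qed.

Lemma hw_span_v0 : hw_span v0. Proof. by move=> Z. Qed.

Lemma hw_span_lower : lower_closed hw_span.
Proof. by move=> X d z dX d0 Hz Z sZ Zv0 ZL; apply: (ZL) => //; apply: Hz. Qed.

Lemma dact_zero X z : dinf X -> dact V (restr pred0 X.1, 0) z = 0.
Proof.
move=> dX; have d0 := dinf_restr pred0 0 dX.
have E : (restr pred0 X.1, 0) =
    dinf_lincomb 1 (restr pred0 X.1, 0) (restr pred0 X.1, 0) :> zmat K * K.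
  rewrite /dinf_lincomb /=; congr (_, _); last by rewrite mulr0 addr0.
  by apply/funext => i; apply/funext => j; rewrite /restr /= mulr0 addr0.
have := dact_linear (d := V) 1 z d0 d0; rewrite -E scale1r => /esym/eqP.
by rewrite -subr_eq0 addrK => /eqP.
Qed.

Lemma hw_span_dact X z : dinf X -> hw_span z -> hw_span (dact V X z).
Proof.
(* The induction quantifies over all of d_infinity, because moving an element past a lowering
   operator creates the new element given by their bracket. *)
move=> dX zS; pose Z := [set z | hw_span z /\ forall X, dinf X -> hw_span (dact V X z)].
suff [_ ] : Z z by apply.
have sS := hw_span_subspace; apply: zS.
- split; first by split; [exact: sS.1|move=> Y _; rewrite linear0; exact: sS.1].
  move=> a x y [Sx Hx] [Sy Hy]; split; first exact: sS.2.
  by move=> Y dY; rewrite linearP; apply: sS.2; [apply: Hx|apply: Hy].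
- split=> [|Y dY]; first exact: hw_span_v0.
  have dm := dinf_restr (fun d => d < 0) 0 dY.
  have d0 := dinf_restr (fun d => d == 0) Y.2 dY.
  have dp := dinf_restr (fun d => 0 < d) 0 dY.
  rewrite [Y]dinf_split dact_linear //; last exact: dinf_dinf_lincomb.
  rewrite raising_v0; last first.
    by split=> // i j ij; rewrite /= /restr subr_lt0 (negbTE ij).
  rewrite scaler0 add0r dact_linear // cartan_v0; last first.
    by split=> // i j ij; rewrite /= /restr subr_eq0 (negbTE ij).
  rewrite scale1r; apply: (subspaceD sS).
    by apply: (subspaceZ sS); exact: hw_span_v0.
  have [[b bY] _] := dY; rewrite -(restr_lower_band bY).
  elim: b {bY} => [|n IH].
    rewrite (_ : restr _ _ = restr pred0 Y.1).
      by rewrite dact_zero //; exact: sS.1.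
    apply/funext => i; apply/funext => j; rewrite /restr /=.
    by have -> : (0 < i - j <= 0) = false by lia.
  rewrite restr_lowerS dact_linear; try exact: dinf_restr.
  rewrite scale1r; apply: (subspaceD sS) => //.
  by apply: hw_span_lower => //; exact: hw_span_v0.
move=> Y d x dY d0 [Sx Hx]; split; first exact: hw_span_lower.
move=> X' dX'; have dYd := dinf_restr (pred1 d%:Z) 0 dY.
have := dact_bracket (d := V) x dX' dYd => /eqP; rewrite eq_sym subr_eq => /eqP ->.
apply: (subspaceD sS); first by apply: Hx; apply: dinf_comm.
by apply: hw_span_lower => //; apply: Hx.
Qed.

Definition energy_graded : set V := [set z | exists a (s : seq (nat * V)),
  (forall y, y \in s -> dact V (denergy K) y.2 = (L (denergy K) + y.1.+1%:R) *: y.2) /\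
  z = a *: v0 + \sum_(y <- s) y.2].

Lemma energy_graded_subspace : subspace energy_graded.
Proof.
split; first by exists 0, [::]; rewrite big_nil scale0r addr0.
move=> c _ _ [a [s [Hs ->]]] [b [t [Ht ->]]].
exists (c * a + b), ([seq (y.1, c *: y.2) | y <- s] ++ t); split.
  move=> y; rewrite mem_cat => /orP[/mapP[x xs ->]|/Ht //] /=.
  by rewrite linearZ_LR Hs //= !scalerA mulrC.
rewrite big_cat big_map scalerDr scalerDl !scalerA -scaler_sumr.
by rewrite addrACA.
Qed.

Lemma dact_lower_energy X (d : nat) z e : dinf X ->
  dact V (denergy K) z = e *: z ->
  let Y := (restr (pred1 d%:Z) X.1, 0) in
  dact V (denergy K) (dact V Y z) = (e + d%:R) *: dact V Y z.
Proof.
move=> dX Ez Y; have dY : dinf Y := dinf_restr (pred1 d%:Z) 0 dX.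
have := dact_bracket (d := V) z (dinf_denergy K) dY.
rewrite denergy_bracket dact_linear //; last exact: dinf_restr.
rewrite dact_zero // addr0 Ez linearZ_LR /= => /eqP; rewrite eq_sym subr_eq => /eqP ->.
by rewrite -scalerDl addrC.
Qed.

Lemma hw_span_graded : hw_span `<=` energy_graded.
Proof.
move=> z; apply; first exact: energy_graded_subspace.
  by exists 1, [::]; rewrite big_nil scale1r addr0.
move=> X d _ dX d0 [a [s [Hs ->]]]; set Y := (_, _).
have E0 := cartan_v0 (denergy_cartan K).
exists 0, ((d.-1, a *: dact V Y v0) :: [seq ((y.1 + d)%N, dact V Y y.2) | y <- s]).
split; last first.
  rewrite scale0r add0r big_cons big_map linearD linear_sum /=.
  by rewrite linearZ_LR.
move=> y; rewrite inE => /orP[/eqP ->|/mapP[x xs ->]] /=.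
  rewrite linearZ_LR /= (dact_lower_energy d dX E0) prednK //.
  by rewrite !scalerA mulrC.
rewrite (dact_lower_energy d dX (Hs x xs)); congr (_ *: _).
by rewrite -addrA -natrD addSn.
Qed.

(** Lowering by [d > 0] adds [d] to the energy, so apart from the multiple of [v0] every component
    exceeds the energy of [v0] by a positive integer and is removed by the sieve. *)
Lemma hw_span_energy z : hw_span z ->
  dact V (denergy K) z = L (denergy K) *: z -> exists a, z = a *: v0.
Proof.
move=> /hw_span_graded[a [s [Hs zE]]] Ez; exists a.
have E0 := cartan_v0 (denergy_cartan K).
have linE : linear (dact V (denergy K)) by exact: linearP.
have xE : z - a *: v0 = \sum_(y <- s) y.2 by rewrite zE addrC addKr.
have Ex : dact V (denergy K) (z - a *: v0) = L (denergy K) *: (z - a *: v0).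
  by rewrite (lfunB linE) (lfunZ linE) Ez E0 scalerBr !scalerA mulrC.
have := eigen_sieve linE (tau := fun y => L (denergy K) + y.1.+1%:R) Hs xE Ex.
rewrite big_pred0 => [/eqP|y]; first by rewrite subr_eq0 => /eqP.
by rewrite -subr_eq0 addrC addKr pnatr_eq0.
Qed.

End Cyclic.

Section Product.
Variables (K : numFieldType) (M N : dinf_module K).

Definition pair_act (X : zmat K * K) (p : M * N) : M * N :=
  (dact M X p.1, dact N X p.2).

Lemma pair_act_is_linear X : linear (pair_act X).
Proof. by move=> a [m n] [m' n']; rewrite /pair_act /= !linearP. Qed.

Lemma pair_act_linear a X Y p : dinf X -> dinf Y ->
  to_linear (pair_act_is_linear (dinf_lincomb a X Y)) p =
  a *: to_linear (pair_act_is_linear X) p + to_linear (pair_act_is_linear Y) p.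
Proof.
by move=> dX dY; case: p => m n; rewrite /= /pair_act /= !dact_linear.
Qed.

Lemma pair_act_bracket X Y p : dinf X -> dinf Y ->
  to_linear (pair_act_is_linear (dinf_bracket X Y)) p =
  to_linear (pair_act_is_linear X) (to_linear (pair_act_is_linear Y) p) -
  to_linear (pair_act_is_linear Y) (to_linear (pair_act_is_linear X) p).
Proof.
by move=> dX dY; case: p => m n; rewrite /= /pair_act /= !dact_bracket.
Qed.

Definition pair_module : dinf_module K :=
  @DinfModule K (M * N)%type (fun X => to_linear (pair_act_is_linear X))
    pair_act_linear pair_act_bracket.

End Product.

Section Uniqueness.
Variables (K : numFieldType) (M N : dinf_module K) (L : zmat K * K -> K).
Variables (U : set N) (w : N).
Hypotheses (irrM : is_irr_hw_module M L) (subU : dsubmodule U) (Uw : U w) (w0 : w != 0).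
Hypothesis raising_w : forall X, dinf_raising X -> dact N X w = 0.
Hypothesis cartan_w : forall X, dinf_cartan X -> dact N X w = L X *: w.
Hypothesis irrU : forall Z : set N, dsubmodule Z -> Z `<=` U ->
  (exists2 z, Z z & z != 0) -> Z = U.

(* The submodule of M x N generated by the pair of highest weight vectors is the
   graph of an isomorphism from M onto U. *)
Lemma irr_hw_module_iso : exists g : M -> N, [/\ linear g, injective g,
  forall m, U (g m), forall n, U n -> exists m, g m = n &
  forall X m, dinf X -> g (dact M X m) = dact N X (g m)].
Proof.
have [[_ irr] [v [v_neq0 raising_v cartan_v gen_v]]] := irrM.
pose P := pair_module M N; pose S : set P := hw_span (V := P) (v, w).
have raising_vw X : dinf_raising X -> dact P X (v, w) = 0.
  by move=> rX; rewrite /= /pair_act /= raising_v // raising_w.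
have cartan_vw X : dinf_cartan X -> dact P X (v, w) = L X *: ((v, w) : P).
  by move=> cX; rewrite /= /pair_act /= cartan_v // cartan_w.
have sS : subspace S := @hw_span_subspace K P (v, w).
have Svw : S (v, w) := @hw_span_v0 K P (v, w).
have SX X m n : dinf X -> S (m, n) -> S (dact M X m, dact N X n).
  by move=> dX Smn; apply: (hw_span_dact raising_vw cartan_vw dX Smn).
have SU m n : S (m, n) -> U n.
  move=> /(_ [set p | U p.2]); apply=> //.
    by split; [exact: subU.1.1|move=> a [m1 n1] [m2 n2]; exact: subU.1.2].
  by move=> X d [m1 n1] dX d0; apply: subU.2; apply: dinf_restr.
(* [(0, w)] has the same energy as [(v, w)], so in [S] it would be a multiple of it; its first
   component then makes the factor 0. *)
have S0w : ~ S (0, w).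
  move=> S0w; have [|a [v0 wE]] := hw_span_energy cartan_vw S0w.
    have E := cartan_w (denergy_cartan K).
    by apply: (congr2 pair) => //=; rewrite linear0 scaler0.
  move/esym/eqP: v0; rewrite scaler_eq0 (negbTE v_neq0) orbF => /eqP a0.
  by move/eqP: w0; apply; rewrite wE a0 scale0r.
have Sv0 : ~ S (v, 0).
  move=> Sv0; apply: S0w.
  have -> : (0, w) = ((v, w) : P) - (v, 0) by rewrite -[RHS]/(v - v, w - 0) subrr subr0.
  exact: (subspaceB sS).
(* The second components of the elements [(0, n)] of [S] form a submodule of [U]; if non-zero it is
   [U] and contains [w], against [S0w]. The other kernel is treated alike with [Sv0]. *)
have ker_r n : S (0, n) -> n = 0.
  pose Z := [set n | S (0, n)].
  have subZ : dsubmodule Z.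
    split; first split; first exact: sS.1.
      move=> a n1 n2 Z1 Z2; have := sS.2 a _ _ Z1 Z2.
      by rewrite -[_ + _]/(a *: 0 + 0, a *: n1 + n2) scaler0 addr0.
    by move=> X n1 dX Z1; have := SX X _ _ dX Z1; rewrite linear0.
  move=> Zn; apply: contrapT => /eqP n0; apply: S0w.
  have ZE := irrU subZ (fun n => @SU 0 n) (ex_intro2 _ _ n Zn n0).
  by have : Z w by rewrite ZE.
have ker_l m : S (m, 0) -> m = 0.
  pose Z := [set m | S (m, 0)].
  have subZ : dsubmodule Z.
    split; first split; first exact: sS.1.
      move=> a n1 n2 Z1 Z2; have := sS.2 a _ _ Z1 Z2.
      by rewrite -[_ + _]/(a *: n1 + n2, a *: 0 + 0) scaler0 addr0.
    by move=> X n1 dX Z1; have := SX X _ _ dX Z1; rewrite linear0.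
  move=> Zm; have [ZE|ZE] := irr Z subZ; last by case: Sv0; have : Z v by rewrite ZE.
  by have : [set 0] m by rewrite -ZE.
have total m : exists n, S (m, n).
  have subZ : dsubmodule [set m | exists n, S (m, n)].
    split; first split; first by exists 0; exact: sS.1.
      move=> a m1 m2 [n1 S1] [n2 S2]; exists (a *: n1 + n2).
      exact: sS.2 a _ _ S1 S2.
    by move=> X m1 dX [n1 S1]; exists (dact N X n1); apply: SX.
  have : [set m | exists n, S (m, n)] = setT by apply: gen_v => //; exists w.
  by move=> E; have : [set: M] m by []; rewrite -E.
have [g gS] := choice total.
have gE m n : S (m, n) -> g m = n.
  move=> Smn; apply/eqP; rewrite -subr_eq0; apply/eqP; apply: ker_r.
  have := subspaceB sS (gS m) Smn.
  by rewrite -[_ - _]/(m - m, g m - n) subrr.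
exists g; split.
- by move=> a m1 m2; apply: gE; exact: sS.2 a _ _ (gS m1) (gS m2).
- move=> m1 m2 E; apply/eqP; rewrite -subr_eq0; apply/eqP; apply: ker_l.
  have := subspaceB sS (gS m1) (gS m2).
  by rewrite -[_ - _]/(m1 - m2, g m1 - g m2) E subrr.
- by move=> m; apply: SU (gS m).
- move=> n Un; have subZ : dsubmodule [set n | exists m, S (m, n)].
    split; first split; first by exists 0; exact: sS.1.
      move=> a n1 n2 [m1 S1] [m2 S2]; exists (a *: m1 + m2).
      exact: sS.2 a _ _ S1 S2.
    by move=> X n1 dX [m1 S1]; exists (dact M X m1); apply: SX.
  have ZU : [set n | exists m, S (m, n)] `<=` U by move=> n1 [m1]; apply: SU.
  have ZE := irrU subZ ZU (ex_intro2 _ _ w (ex_intro _ v Svw) w0).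
  have [m Smn] : [set n | exists m, S (m, n)] n by rewrite ZE.
  by exists m; apply: gE.
- by move=> X m dX; apply: gE; apply: SX.
Qed.

End Uniqueness.

(** * Traces *)

Section Traces.
Variables (K : numFieldType) (l : nat) (F : fock_space K l).
Variables (lam : l.-tuple nat) (lam_sorted : sorted geq lam).
Local Notation A := (option (bool * 'I_l)).
Local Notation L0 := (@fock_L0 K l F).
Local Notation sgn := (sign_pow (@fock_alpha K l F)).
Local Notation slice U n := (eigen_in U L0 (n%:R / 2)).
Implicit Types (v : F) (eps : bool) (n : nat).

Let lL := @fock_L0_linear K l F.
Let lS := @sgn_linear K l F.

(** Up to sign, monomials in modes below [n] correspond to subsets of [A * 'I_n], of which there are
    finitely many. *)
Lemma slice_finite_dim n (U : set F) : subspace U -> finite_dim (slice U n).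
Proof.
move=> sU; pose I := {set A * 'I_n}.
pose b (T : I) := mono F [seq (y.1, val y.2) | y <- enum T].
pose B := [set v | exists c : I -> K, v = \sum_T c T *: b T].
have sB : subspace B.
  split; first by exists (fun=> 0); rewrite big1 // => T _; rewrite scale0r.
  move=> a _ _ [c ->] [d ->]; exists (fun T => a * c T + d T).
  rewrite scaler_sumr -big_split; apply: eq_bigr => T _.
  by rewrite scalerDl scalerA.
have Bb T : B (b T).
  exists (fun T' => (T' == T)%:R); rewrite (bigD1 T) //= eqxx scale1r big1 ?addr0 //.
  by move=> T' /negbTE ->; rewrite scale0r.
apply: (@finite_dim_sub _ _ #|{: I}| _ (fun i => b (enum_val i))).
  exact: eigen_subspace.
move=> v [_ /spanned_energy[L [PL vE]]].
suff [c ->] : B v by exists (fun i => c (enum_val i)); rewrite big_enum_val.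
rewrite vE; apply: (subspace_sum sB) => y yL _; apply: (subspaceZ sB).
have /andP[uy /allP yn] := allP PL y yL.
pose T : I := finset (fun z : A * 'I_n => (z.1, val z.2) \in y.2).
have [|c ->] := @mono_perm K l F y.2
  [seq (z.1, val z.2) | z <- enum T].
  apply: uniq_perm => //.
    rewrite map_inj_uniq ?enum_uniq // => -[a k] [a' k'] /= [-> kk'].
    by congr (_, _); apply: val_inj.
  move=> [a k]; apply/idP/mapP => [ak|[z]].
    by exists (a, Ordinal (yn _ ak)); rewrite // mem_enum inE.
  by rewrite mem_enum inE => zy ->.
by apply: (subspaceZ sB); apply: (Bb T).
Qed.

Lemma sgn_L0 v : sgn (L0 v) = L0 (sgn v).
Proof.
by rewrite !fock_L0E sgn_fock_act //; case: (dinf_denergy K).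
Qed.

Lemma so_hw_space_L0 v : so_hw_space lam v -> so_hw_space lam (L0 v).
Proof. by rewrite fock_L0E; apply: so_hw_space_fock_act; apply: dinf_denergy. Qed.

Lemma hw_half_L0 eps v : hw_half lam eps v -> hw_half lam eps (L0 v).
Proof. by rewrite fock_L0E; apply: hw_half_fock_act; apply: dinf_denergy. Qed.

Lemma slice_traces n : exists n1 n2,
  [/\ exists b : 'I_n1 -> F, is_basis (slice (hw_half lam false) n) b,
      exists b : 'I_n2 -> F, is_basis (slice (hw_half lam true) n) b,
      finite_dim (slice (so_hw_space lam) n),
      is_trace (slice (so_hw_space lam) n) idfun (n1%:R + n2%:R) &
      is_trace (slice (so_hw_space lam) n) sgn (n1%:R - n2%:R)].
Proof.
have [n1 [b1 B1]] := slice_finite_dim n (hw_half_subspace F lam false).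
have [n2 [b2 B2]] := slice_finite_dim n (hw_half_subspace F lam true).
have sU : subspace (slice (so_hw_space lam) n).
  by apply: eigen_subspace => //; exact: so_hw_space_subspace.
have [||v [Wv Lv]|b [B bS]] := is_basis_split lS B1 B2 _ _ sU _.
- by move=> v [[Wv Sv] Lv]; rewrite expr0 scale1r in Sv.
- by move=> v [[Wv Sv] Lv]; rewrite expr1 scaleN1r in Sv.
- have sW := so_hw_space_subspace F lam.
  have WSv := so_hw_space_sgn Wv.
  have LSv : L0 (sgn v) = (n%:R / 2) *: sgn v by rewrite -sgn_L0 Lv (lfunZ lS).
  exists (2^-1 *: (v + sgn v)), (2^-1 *: (v - sgn v)); split.
  + split; first split.
    * exact/(subspaceZ sW)/(subspaceD sW).
    * by rewrite (lfunZ lS) (lfunD lS) sgnK expr0 scale1r addrC.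
    * by rewrite (lfunZ lL) (lfunD lL) Lv LSv -scalerDr !scalerA mulrC.
  + split; first split.
    * exact/(subspaceZ sW)/(subspaceB sW).
    * by rewrite (lfunZ lS) (lfunB lS) sgnK expr1 scaleN1r -scalerN opprB.
    * by rewrite (lfunZ lL) (lfunB lL) Lv LSv -scalerBr !scalerA mulrC.
  + rewrite -scalerDr addrACA subrr addr0 -mulr2n -scaler_nat scalerA mulVf ?pnatr_eq0 //.
    by rewrite scale1r.
exists n1, n2; split; [by exists b1|by exists b2|by exists (n1 + n2)%N, b| |].
  rewrite -natrD -[(n1 + n2)%N]card_ord -sum1_card natr_sum.
  by apply: (is_trace_diag B) => i; rewrite scale1r.
have -> : n1%:R - n2%:R =
    \sum_(i < n1 + n2) (if fintype.split i is inl _ then 1 else - 1) :> K.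
  rewrite big_split_ord /=; congr (_ + _).
    rewrite -[n1 in LHS]card_ord -sum1_card natr_sum; apply: eq_bigr => i _.
    by rewrite (unsplitK (inl i)).
  rewrite -[n2 in LHS]card_ord -sum1_card natr_sum -sumrN; apply: eq_bigr => i _.
  by rewrite (unsplitK (inr i)).
exact: (is_trace_diag B bS).
Qed.

Lemma idfun_linear (V : lmodType K) : linear (@idfun V). Proof. by []. Qed.

Lemma has_Q (g : F -> F) : (forall n, exists t, is_trace (slice
  (so_hw_space lam) n) g t) ->
  has_qtrace (so_hw_space lam) L0 g.
Proof.
move=> tr; split=> [n|v Wv]; last first.
  apply: energy_components => //; first exact: so_hw_space_subspace.
  exact: so_hw_space_L0.
by split; [have [n1 [n2 []]] := slice_traces n|exact: tr].
Qed.

Section Module.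
Variables (eps : bool) (M : dinf_module K).
Hypothesis irrM : is_irr_hw_module M (if eps then Lambda_det lam else Lambda lam).

Lemma irr_module_fock : exists g : M -> F, [/\ linear g, injective g,
  forall m, hw_half lam eps (g m), forall v, hw_half lam eps v -> exists m, g m = v &
  forall m, g (dact M (denergy K) m) = L0 (g m)].
Proof.
have W0 := hw_seq_half F eps lam_sorted.
have us := hw_seq_uniq lam eps; have cs := closed_hw_seq eps lam_sorted.
have [||||||g [lg ig gU gs gX]] := irr_hw_module_iso (N := fock_module F)
  (U := hw_half lam eps) (w := mono F (hw_seq lam eps)) irrM.
- split; first exact: hw_half_subspace.
  by move=> X v dX; rewrite /= fock_dactE //; apply: hw_half_fock_act.
- exact: W0.
- exact: mono_neq0.
- move=> X rX; rewrite /= fock_dactE; last by case: rX.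
  by apply: fock_act_raising rX _ => i j; apply: closed_bilin.
- move=> X cX; rewrite /= fock_dactE; last by case: cX.
  by rewrite hw_weight //; case: (eps).
- move=> Z [sZ ZX] ZU Znz; apply: hw_half_irreducible => // X v dX Zv.
  by have := ZX X v dX Zv; rewrite /= fock_dactE.
exists g; split=> // m; rewrite gX; last exact: dinf_denergy.
by rewrite fock_L0E /= fock_dactE //; exact: dinf_denergy.
Qed.

Lemma module_traces n d (b : 'I_d -> F) : is_basis (slice (hw_half lam eps) n) b ->
  exists b' : 'I_d -> M, is_basis (eigen_in setT (dact M (denergy K)) (n%:R / 2)) b'.
Proof.
have [g [lg ig gU gs gE]] := irr_module_fock => B.
apply: (is_basis_lift lg ig _ _ B) => [m|v [Wv _]]; last exact: gs.
split=> [[_ Em]|[_ Lm]].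
  by split; [exact: gU|rewrite -gE Em (lfunZ lg)].
by split=> //; apply: ig; rewrite gE Lm (lfunZ lg).
Qed.

Lemma module_qtrace n d (b : 'I_d -> F) : is_basis (slice (hw_half lam eps) n) b ->
  is_trace (eigen_in setT (dact M (denergy K)) (n%:R / 2)) idfun d%:R.
Proof.
move=> /module_traces[b' B']; rewrite -[d]card_ord -sum1_card natr_sum.
by apply: (is_trace_diag B') => i; rewrite scale1r.
Qed.

Lemma module_has_qdim : has_qdim M.
Proof.
split=> [n|m _].
  have [d [b B]] := slice_finite_dim n (hw_half_subspace F lam eps).
  split; last by exists d%:R; apply: module_qtrace B.
  by have [b' B'] := module_traces B; exists d, b'.
have [g [lg ig gU gs gE]] := irr_module_fock.
have [N [w [wE gm]]] := energy_components (hw_half_subspace F lam eps)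
  (@hw_half_L0 eps) (gU m).
have /choice[m' m'E] : forall n, exists m', g m' = w n.
  by move=> n; apply: gs; case: (wE n).
exists N, m'; split=> [n|].
  split=> //; apply: ig; rewrite gE m'E (lfunZ lg) m'E.
  by case: (wE n).
by apply: ig; rewrite gm (lfun_sum lg); apply: eq_bigr => n _; rewrite m'E.
Qed.

End Module.
End Traces.

Theorem proposition3p4 (R : realType) (l : nat) (lam : l.-tuple nat)
    (F : fock_space R[i] l) (M Mdet : dinf_module R[i]) :
  (1 <= l)%N ->
  sorted geq lam ->
  is_irr_hw_module M (Lambda lam) ->
  is_irr_hw_module Mdet (Lambda_det lam) ->
  [/\ has_qdim M, has_qdim Mdet, has_Qplus F lam & has_Qminus F lam] /\
  (forall n : nat, qdim M n = (Qplus F lam n + Qminus F lam n) / 2) /\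
  (forall n : nat, qdim Mdet n = (Qplus F lam n - Qminus F lam n) / 2).
Proof.
move=> _ lam_sorted irrM irrMdet.
have hM := module_has_qdim (eps := false) F lam_sorted irrM.
have hMdet := module_has_qdim (eps := true) F lam_sorted irrMdet.
(* All four coefficients are expressed by the dimensions [n1] and [n2] of the two sign eigenspaces
   at energy [n/2]. *)
have dims n : exists n1 n2 : nat, [/\ qdim M n = n1%:R, qdim Mdet n = n2%:R,
    Qplus F lam n = n1%:R + n2%:R & Qminus F lam n = n1%:R - n2%:R].
  have [n1 [n2 [[b1 B1] [b2 B2] _ T1 T2]]] := slice_traces F lam n.
  exists n1, n2; split; apply: trace_onE; try exact: idfun_linear.
  - exact: (module_qtrace (eps := false) lam_sorted irrM B1).
  - exact: (module_qtrace (eps := true) lam_sorted irrMdet B2).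
  - exact: T1.
  - exact: sgn_linear.
  - exact: T2.
split; first split=> //.
- by apply: has_Q => n; have [n1 [n2 [_ _ _ T _]]] := slice_traces F lam n;
    exists (n1%:R + n2%:R).
- by apply: has_Q => n; have [n1 [n2 [_ _ _ _ T]]] := slice_traces F lam n;
    exists (n1%:R - n2%:R).
by split=> n; have [n1 [n2 [E1 E2 E3 E4]]] := dims n; rewrite ?E1 ?E2 E3 E4; field.
Qed.
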